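(* Let $1<q<p<\infty$ and let $\{r_i\}_{i\in\mathbb{N}}$, $\mathbb{N}=\{0,1,2,\dots\}$, be a sequence of strictly positive real numbers such that \[ \sum_{i=0}^\infty r_i^{\frac{p\,q}{p-q}+N}<+\infty. \] Define the sequence of points $\{x_i\}_{i\in\mathbb{N}}\subset\mathbb{R}^N$ by $x_0=(0,\dots,0)$ and $x_{i+1}=(2^{-i}+r_i+r_{i+1},0,\dots,0)+x_i$ for $i\in\mathbb{N}$, and the disjoint union of open balls \[ \mathcal{T}=\bigcup_{i=0}^\infty B_{r_i}(x_i)\subset\mathbb{R}^N. \] Then \[ \mathrm{Spec}_{LS}(\mathcal{T};p,q)\neq\mathrm{Spec}(\mathcal{T};p,q), \] and the set $\mathrm{Spec}(\mathcal{T};p,q)$ has (at least) countably infinitely many accumulation points. Moreover, the first eigenvalue $\lambda^1_{p,q}(\mathcal{T})$ is not isolated in $\mathrm{Spec}(\mathcal{T};p,q)$.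
   Context: Let $1<q<p<\infty$ and let $\Omega\subset\mathbb{R}^N$ be a (nonempty) open set. The homogeneous Sobolev space $\mathcal{D}^{1,p}_0(\Omega)$ is the completion of $C^\infty_0(\Omega)$ with respect to the norm $u\mapsto\left(\int_\Omega|\nabla u|^p\,dx\right)^{1/p}$. Let $\Delta_p u=\mathrm{div}(|\nabla u|^{p-2}\nabla u)$. When the embedding $\mathcal{D}^{1,p}_0(\Omega)\hookrightarrow L^q(\Omega)$ is compact, define: The $(p,q)$-spectrum $\mathrm{Spec}(\Omega;p,q)$ is the set of all $\lambda\in\mathbb{R}$ (called $(p,q)$-eigenvalues of $\Omega$) for which there is $u\in\mathcal{D}^{1,p}_0(\Omega)\setminus\{0\}$ solving, in the weak sense, \[ -\Delta_p u=\lambda\,\|u\|_{L^q(\Omega)}^{p-q}\,|u|^{q-2}u\ \text{ in }\Omega,\qquad u=0\ \text{ on }\partial\Omega, \] i.e. $\int_\Omega|\nabla u|^{p-2}\nabla u\cdot\nabla\varphi\,dx=\lambda\|u\|_{L^q(\Omega)}^{p-q}\int_\Omega|u|^{q-2}u\,\varphi\,dx$ for all $\varphi\in C^\infty_0(\Omega)$. Let $\mathcal{S}_{p,q}(\Omega)=\{u\in\mathcal{D}^{1,p}_0(\Omega):\|u\|_{L^q(\Omega)}=1\}$. The first $(p,q)$-eigenvalue is $\lambda^1_{p,q}(\Omega)=\min_{u\in\mathcal{S}_{p,q}(\Omega)}\int_\Omega|\nabla u|^p\,dx$; it is the least element of $\mathrm{Spec}(\Omega;p,q)$. It is called not isolated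 if there is a sequence $\{\lambda_n\}_n\subset\mathrm{Spec}(\Omega;p,q)\setminus\{\lambda^1_{p,q}(\Omega)\}$ with $\lambda_n\to\lambda^1_{p,q}(\Omega)$. For a closed symmetric set $A$ ($A=-A$), the Krasnosel'skii genus is $\gamma(A)=\inf\{k\in\mathbb{N}:\exists\text{ a continuous odd map }\phi:A\to\mathbb{S}^{k-1}\}$, with $\gamma(A)=+\infty$ if no such $k$ exists. For $k\in\mathbb{N}\setminus\{0\}$ let $\Sigma^k_{p,q}(\Omega)=\{A\subset\mathcal{S}_{p,q}(\Omega): A\text{ compact and symmetric},\ \gamma(A)\ge k\}$ and \[ \lambda^k_{p,q}(\Omega)=\inf_{A\in\Sigma^k_{p,q}(\Omega)}\max_{u\in A}\int_\Omega|\nabla u|^p\,dx \] (for $k=1$ this agrees with the first eigenvalue above). The Lusternik–Schnirelmann $(p,q)$-spectrum is $\mathrm{Spec}_{LS}(\Omega;p,q)=\{\lambda^k_{p,q}(\Omega)\}_{k\in\mathbb{N}\setminus\{0\}}$. *)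

(* Defs.v *)
From HB Require Import structures.
From mathcomp Require Import all_boot all_order all_algebra.
From mathcomp Require Import all_classical all_reals all_analysis.

Set Implicit Arguments.
Unset Strict Implicit.
Unset Printing Implicit Defensive.

Import Order.TTheory GRing.Theory Num.Theory.
Import numFieldNormedType.Exports.

Local Open Scope classical_set_scope.
Local Open Scope ring_scope.

Definition dotv {R : realType} {N : nat} (x y : 'rV[R]_N) : R :=
  \sum_(i < N) x 0 i * y 0 i.

(* The library's norm on 'rV[R]_N is the sup norm. *)
Definition enorm {R : realType} {N : nat} (x : 'rV[R]_N) : R :=
  Num.sqrt (dotv x x).

Definition eball {R : realType} {N : nat} (c : 'rV[R]_N) (r : R) :
    set 'rV[R]_N :=
  [set x | enorm (x - c) < r].

Definition axis1 {R : realType} {N : nat} (a : R) : 'rV[R]_N :=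
  \row_(j < N) (if val j == 0%N then a else 0).

Definition rV_display : measure_display -> measure_display.
Proof. exact. Qed.

Section measurable_rV.
Context {d : measure_display} {T : measurableType d} (n : nat).

Let coord (i : 'I_n) (x : 'rV[T]_n) : T := x 0 i.

Let rV_set0 : g_sigma_preimage coord set0.
Proof. exact: sigma_algebra0. Qed.

Let rV_setC A : g_sigma_preimage coord A -> g_sigma_preimage coord (~` A).
Proof. exact: sigma_algebraC. Qed.

Let rV_bigcup (F : (set 'rV[T]_n)^nat) :
  (forall i, g_sigma_preimage coord (F i)) ->
  g_sigma_preimage coord (\bigcup_i F i).
Proof. exact: sigma_algebra_bigcup. Qed.

(* The product sigma-algebra, i.e. the one generated by the coordinates; for
   the real numbers it is the Borel sigma-algebra of R^n. *)
HB.instance Definition _ := @isMeasurable.Build (rV_display d) 'rV[T]_n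
  (g_sigma_preimage coord) rV_set0 rV_setC rV_bigcup.

End measurable_rV.

Definition rcons_rV {R : Type} {n : nat} (x : 'rV[R]_n * R) : 'rV[R]_n.+1 :=
  \row_i (if unlift ord_max i is Some j then x.1 0 j else x.2).

Lemma measurable_rcons_rV {R : realType} {n : nat} :
  measurable_fun [set: 'rV[R]_n * measurableTypeR R]
    (@rcons_rV R n : _ -> 'rV[R]_n.+1).
Proof.
have mcoord (j : 'I_n) : measurable_fun [set: 'rV[R]_n] (fun x => x 0 j).
  move=> _ Y mY; rewrite setTI; apply: sub_sigma_algebra.
  rewrite -bigcup_seq/=; exists j; first by rewrite /= mem_index_enum.
  by exists Y; rewrite ?setTI.
suff : g_sigma_preimage (fun i (x : 'rV[R]_n * measurableTypeR R) =>
    (rcons_rV x : 'rV[R]_n.+1) 0 i : R) `<=` measurable.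
  move=> mr _ Y mY; apply: mr.
  rewrite (_ : (fun i x => _) =
    fun i => (fun y : 'rV[R]_n.+1 => y 0 i) \o (@rcons_rV R n))//.
  by rewrite (@g_sigma_preimage_comp _ R n.+1 'rV[R]_n.+1); exists Y.
apply: smallest_sub; first exact: sigma_algebra_measurable.
rewrite -bigcup_mkord_ord; apply: bigcup_sub => i Ii A [B mB <-].
set k := inord i.
suff : measurable_fun [set: 'rV[R]_n * measurableTypeR R]
    (fun x => (rcons_rV x : 'rV[R]_n.+1) 0 k : R) by exact.
case: (unliftP ord_max k) => [j kj|kmax].
- rewrite (_ : (fun x => _) = (fun y : 'rV[R]_n => y 0 j : R) \o fst).
    by apply: measurableT_comp; [exact: mcoord|exact: measurable_fst].
  by apply/funext => x /=; rewrite mxE kj liftK.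
- rewrite (_ : (fun x => _) = snd); first exact: measurable_snd.
  by apply/funext => x /=; rewrite mxE kmax unlift_none.
Qed.

(* Lebesgue measure on R^n as an iterated product of the measure on R. *)
Fixpoint lebesgue_rV (R : realType) (n : nat) : set 'rV[R]_n -> \bar R :=
  match n with
  | 0 => \d_(0 : 'rV[R]_0)
  | m.+1 => pushforward (@lebesgue_rV R m \x @lebesgue_measure R)%E
              (@rcons_rV R m)
  end.

Section lebesgue_rV_measure.
Context (R : realType) (n : nat).

Let is_measure_lebesgue_rV :
  exists mu : {measure set 'rV[R]_n -> \bar R}, @lebesgue_rV R n = mu.
Proof.
elim: n => [|m [mu IH]]; first by exists (dirac (0 : 'rV[R]_0)).
rewrite /= IH; exists
  (measure_function_pushforward__canonical__measure_function_Measure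
     (mu \x @lebesgue_measure R)%E measurable_rcons_rV).
by [].
Qed.

Let lebesgue_rV0 : @lebesgue_rV R n set0 = 0%E.
Proof. by have [mu ->] := is_measure_lebesgue_rV; exact: measure0. Qed.

Let lebesgue_rV_ge0 A : (0 <= @lebesgue_rV R n A)%E.
Proof. by have [mu ->] := is_measure_lebesgue_rV; exact: measure_ge0. Qed.

Let lebesgue_rV_sigma_additive : semi_sigma_additive (@lebesgue_rV R n).
Proof.
have [mu ->] := is_measure_lebesgue_rV.
exact: measure_semi_sigma_additive.
Qed.

HB.instance Definition _ := isMeasure.Build _ _ _ (@lebesgue_rV R n)
  lebesgue_rV0 lebesgue_rV_ge0 lebesgue_rV_sigma_additive.

End lebesgue_rV_measure.

Definition partial_deriv {R : realType} {N : nat} (i : 'I_N)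
    (f : 'rV[R]_N -> R) : 'rV[R]_N -> R :=
  fun x => 'D_(delta_mx 0 i) f x.

Definition grad {R : realType} {N : nat} (f : 'rV[R]_N -> R) (x : 'rV[R]_N) :
    'rV[R]_N :=
  \row_(i < N) partial_deriv i f x.

(* C^oo: partial derivatives of all orders exist and are differentiable. *)
Definition smooth {R : realType} {N : nat} (f : 'rV[R]_N -> R) : Prop :=
  forall (s : seq 'I_N) (x : 'rV[R]_N),
    differentiable (foldr partial_deriv f s) x.

Definition fsupport {R : realType} {N : nat} (f : 'rV[R]_N -> R) :
    set 'rV[R]_N :=
  closure [set x | f x != 0].

Definition test_function {R : realType} {N : nat} (Omega : set 'rV[R]_N)
    (f : 'rV[R]_N -> R) : Prop :=
  [/\ smooth f, compact (fsupport f) & fsupport f `<=` Omega].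

Definition normL {R : realType} {N : nat} (p : R) (Omega : set 'rV[R]_N)
    (f : 'rV[R]_N -> R) : \bar R :=
  'N[@lebesgue_rV R N]_p%:E[(EFin \o f) \_ Omega].

Definition vnormL {R : realType} {N : nat} (p : R) (Omega : set 'rV[R]_N)
    (G : 'rV[R]_N -> 'rV[R]_N) : \bar R :=
  normL p Omega (fun x => enorm (G x)).

Definition grad_norm {R : realType} {N : nat} (p : R) (Omega : set 'rV[R]_N)
    (f : 'rV[R]_N -> R) : \bar R :=
  vnormL p Omega (grad f).

(* The completion of the space of test functions for the norm grad_norm,
   presented by Cauchy sequences.  Two sequences represent the same element of the
   completion when they are at distance D01dist 0; all the notions below are
   compatible with this identification, so it is not quotiented out. *)
Record D01p {R : realType} {N : nat} (p : R) (Omega : set 'rV[R]_N) := MkD01p {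
  D01seq :> nat -> 'rV[R]_N -> R;
  D01_test : forall n, test_function Omega (D01seq n);
  D01_cauchy : forall e : R, 0 < e -> exists n0 : nat, forall m n : nat,
    (n0 <= m)%N -> (n0 <= n)%N ->
    (grad_norm p Omega (D01seq m \- D01seq n)%R < e%:E)%E }.

Section D01p.
Context {R : realType} {N : nat} {p : R} {Omega : set 'rV[R]_N}.
Implicit Types u v : D01p p Omega.

Definition D01norm u : \bar R := limn (fun n => grad_norm p Omega (u n)).

Definition D01dist u v : \bar R :=
  limn (fun n => grad_norm p Omega (u n \- v n)).

(* v = - u in the completion *)
Definition D01opp u v : Prop :=
  limn (fun n => grad_norm p Omega (u n \+ v n)) = 0%E.

HB.instance Definition _ := gen_eqMixin (D01p p Omega).
HB.instance Definition _ := gen_choiceMixin (D01p p Omega).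

Let D01open (A : set (D01p p Omega)) : Prop :=
  forall u, A u -> exists2 e : R, 0 < e &
    forall v, (D01dist u v < e%:E)%E -> A v.

Let D01openT : D01open setT.
Proof. by move=> u _; exists 1. Qed.

Let D01openI : setI_closed D01open.
Proof.
move=> A B oA oB u [/oA[e e0 eA] /oB[f f0 fB]].
exists (Num.min e f); first by rewrite lt_min e0.
move=> v uv; split; [apply: eA|apply: fB]; apply: lt_le_trans uv _;
  by rewrite lee_fin ge_min lexx ?orbT.
Qed.

Let D01open_bigU (I : Type) (f : I -> set (D01p p Omega)) :
  (forall i, D01open (f i)) -> D01open (\bigcup_i f i).
Proof.
move=> of_ u [i _ /of_[e e0 ef]]; exists e => // v /ef fv; by exists i.
Qed.

HB.instance Definition _ := isOpenTopological.Build (D01p p Omega)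
  D01openT D01openI D01open_bigU.

(* The weak gradient of u: a representative of the limit in L^p(Omega) of the
   gradients, which exists since L^p(Omega) is complete. *)
Definition wgrad u : 'rV[R]_N -> 'rV[R]_N :=
  xget (fun=> 0) [set G : 'rV[R]_N -> 'rV[R]_N | measurable_fun Omega G /\
    vnormL p Omega (fun x => grad (u n) x - G x) @[n --> \oo] --> 0%E].

(* The image of u by the embedding of D^{1,p}_0(Omega) into L^q(Omega), i.e. the
   limit in L^q(Omega) of the sequence; it is meaningful when this embedding is
   continuous on test functions, so that the sequence converges. *)
Definition toLq (q : R) u : 'rV[R]_N -> R :=
  xget (fun=> 0) [set f : 'rV[R]_N -> R | measurable_fun Omega f /\
    normL q Omega (u n \- f) @[n --> \oo] --> 0%E].

Definition energy u : \bar R :=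
  (\int[@lebesgue_rV R N]_(x in Omega) (enorm (wgrad u x) `^ p)%:E)%E.

End D01p.

Definition weak_solution {R : realType} {N : nat} {p : R}
    {Omega : set 'rV[R]_N} (q lambda : R) (u : D01p p Omega) : Prop :=
  forall phi : 'rV[R]_N -> R, test_function Omega phi ->
    (\int[@lebesgue_rV R N]_(x in Omega)
       (enorm (wgrad u x) `^ (p - 2) * dotv (wgrad u x) (grad phi x)) =
     lambda * fine (normL q Omega (toLq q u)) `^ (p - q) *
     \int[@lebesgue_rV R N]_(x in Omega)
       (`|toLq q u x| `^ (q - 2) * toLq q u x * phi x))%R.

Definition Spec {R : realType} {N : nat} (Omega : set 'rV[R]_N) (p q : R) :
    set R :=
  [set lambda | exists u : D01p p Omega,
    D01norm u <> 0%E /\ weak_solution q lambda u].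

Definition sphere_pq {R : realType} {N : nat} (Omega : set 'rV[R]_N) (p q : R) :
    set (D01p p Omega) :=
  [set u | normL q Omega (toLq q u) = 1%E].
Arguments sphere_pq {R N} Omega p q.

Definition first_eigenvalue {R : realType} {N : nat} (Omega : set 'rV[R]_N)
    (p q lambda : R) : Prop :=
  (exists2 u, sphere_pq Omega p q u & energy u = lambda%:E) /\
  (forall u, sphere_pq Omega p q u -> (lambda%:E <= energy u)%E).

Definition not_isolated {R : realType} (S : set R) (l : R) : Prop :=
  exists s : nat -> R, (forall n, (S `\ l) (s n)) /\ s n @[n --> \oo] --> l.

Section genus.
Context {R : realType} {N : nat} {p : R} {Omega : set 'rV[R]_N}.
Implicit Type A : set (D01p p Omega).

(* A = - A as a subset of the completion; in particular A is closed under the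
   identification of sequences representing the same element. *)
Definition symmetric_set A : Prop := forall u v, D01opp u v -> A u -> A v.

Definition odd_sphere_map A (k : nat) (phi : D01p p Omega -> 'rV[R]_k) : Prop :=
  [/\ {within A, continuous phi},
      forall u, A u -> enorm (phi u) = 1 &
      forall u v, A u -> A v -> D01opp u v -> phi v = - phi u].

(* The infimum is taken in the extended reals: it is +oo on the empty set. *)
Definition genus A : \bar R :=
  ereal_inf [set k%:R%:E | k in
    [set k : nat | exists phi, @odd_sphere_map A k phi]].

End genus.

Definition Sigma_pq {R : realType} {N : nat} (Omega : set 'rV[R]_N) (p q : R)
    (k : nat) : set (set (D01p p Omega)) :=
  [set A | [/\ A `<=` sphere_pq Omega p q, compact A, symmetric_set A &
              (k%:R%:E <= genus A)%E]].
Arguments Sigma_pq {R N} Omega p q k.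

Definition lambda_LS {R : realType} {N : nat} (Omega : set 'rV[R]_N) (p q : R)
    (k : nat) : \bar R :=
  ereal_inf [set ereal_sup (@energy R N p Omega @` A) |
              A in Sigma_pq Omega p q k].

(* Real values of lambda_LS only: an infimum over an empty family is +oo and
   contributes nothing. *)
Definition Spec_LS {R : realType} {N : nat} (Omega : set 'rV[R]_N) (p q : R) :
    set R :=
  [set l | exists2 k : nat, (0 < k)%N & lambda_LS Omega p q k = l%:E].

(* Main.v *)
Require Import Defs.
From HB Require Import structures.
From mathcomp Require Import all_boot all_order all_algebra.
From mathcomp Require Import all_classical all_reals all_analysis.
From mathcomp Require Import measurable_realfun.
From mathcomp Require Import ring lra.

(** Write A(f) for the integral of |f|^q and D(f) for that of |grad f|^p, and
    let E(S) be the supremum of J = A - D over the test functions of the union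
    of the balls whose index belongs to S.  Everything rests on the fact that,
    when q < p, each nonempty set S of indices yields an eigenvalue of the whole
    union: the two integrals have different homogeneity, so E(S) is finite and
    positive, and a maximiser of J on the balls of S, extended by 0,
    solves the eigenvalue equation on all of the union
    ([eigenfunction_exists], [lam_Spec]).  Its eigenvalue is a strictly
    decreasing continuous function [eigen_of] of E(S), and for S the set of all
    indices it is the first eigenvalue ([eigen_of_first]).

    A test function on a union of disjoint balls is a sum of test functions on
    the balls, hence E is additive ([Jsup_union]).  The contribution of the ball
    of index i is positive ([Jsup_gt0]) and at most a constant times
    r_i^(pq/(p-q)+N) ([Jsup_ball_le]), so it tends to 0.  Let S_k consist of
    the first k+1 indices.  Adding to S_k one ball further and further away
    produces eigenvalues which converge to that of S_k and differ from it, so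
    that all the eigenvalues of the sets S_k are accumulation points, and they
    are pairwise distinct.  In the same way, removing one far ball from the
    whole union produces eigenvalues which converge to the first one.  Finally
    the eigenvalues of the S_k form a strictly decreasing sequence, whereas the
    variational eigenvalues are nondecreasing in k: the Lusternik-Schnirelmann
    spectrum contains no infinite strictly decreasing sequence.

    Existence of maximisers ([maximising_sequence]) is the analytic part.  Two
    properties of the domain are used: A is bounded by D up to a constant, and
    up to a small multiple of 1 + D it is controlled by finitely many averages
    ([coercive_balls], [compact_balls]).  On one ball the first property follows
    from the Poincare inequality and from Young's inequality, which also
    produces the exponent of the radii ([ball_estimate]); since the support of a
    test function is compact, only finite sums over the balls occur.  The second
    one is an elementary form of Rellich's theorem, proved by induction on the
    dimension ([rellich_L1]).  Along an ultrafilter the averages of a maximising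
    sequence converge, so the sequence is Cauchy for the L^q norm, and uniform
    convexity of the power p of the Euclidean norm ([enorm_uniform_convexity])
    makes the gradients Cauchy in L^p.  The completeness of L^p
    ([Lnorm_complete]) then identifies the limits with the functions attached to
    an element of the completion.

    The Euler-Lagrange equation is obtained without differentiating J: the
    inequality J(u + t psi) <= E + C t^q, where the last term accounts for the
    balls outside S, is combined with the tangent inequalities of the convex
    powers, divided by t, and passed to the limit t = 1/n by dominated
    convergence ([variation_limit]); comparing a maximiser with its multiples
    gives q A = p D ([limit_scaling]). *)

Set Implicit Arguments.
Unset Strict Implicit.
Unset Printing Implicit Defensive.

Import Order.TTheory GRing.Theory Num.Theory.
Import numFieldNormedType.Exports.

Local Open Scope classical_set_scope.
Local Open Scope ring_scope.

(** * Convexity of powers and of the Euclidean norm *)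
Section powR_facts.
Context {R : realType}.
Implicit Types (a b p s t x y : R).

(** The strict convexity of the exponential, from its tangent at the point s t
    of the segment. *)
Lemma expR_secant s t : 0 < s < 1 -> t != 0 ->
  expR (s * t) < s * expR t + (1 - s).
Proof.
move=> /andP[s0 s1] t0; set c := s * t.
have h w : w != c -> expR c * (1 + (w - c)) < expR w.
  move=> wc; rewrite [ltRHS](_ : _ = expR c * expR (w - c)); last first.
    by rewrite -expRD addrC subrK.
  by rewrite ltr_pM2l ?expR_gt0// expR_gt1Dx// subr_eq0.
have c0 : 0 != c by rewrite eq_sym mulf_neq0// gt_eqF.
have ct : t != c.
  rewrite -subr_eq0 /c -{1}[t]mul1r -mulrBl mulf_neq0// subr_eq0 gt_eqF//.
have := h _ ct; have := h _ c0; rewrite expR0 => h0 ht.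
have -> : expR c = s * (expR c * (1 + (t - c))) +
    (1 - s) * (expR c * (1 + (0 - c))) by rewrite /c; ring.
by apply: ltrD; [rewrite ltr_pM2l|rewrite -[ltRHS]mulr1 ltr_pM2l// subr_gt0].
Qed.

(** With u = exp (t / p) this is the previous inequality at s = 1 / p. *)
Lemma powR_bernoulli_lt p u : 1 < p -> 0 <= u -> u != 1 ->
  1 + p * (u - 1) < u `^ p.
Proof.
move=> p1 u0 u1; have p0 : 0 < p by lra.
have [->|un0] := eqVneq u 0; first by rewrite powR0 ?gt_eqF//; lra.
have up : 0 < u by rewrite lt_neqAle eq_sym un0.
have lu0 : p * ln u != 0.
  by rewrite mulf_neq0 ?ln_eq0// gt_eqF.
have := @expR_secant p^-1 (p * ln u) _ lu0.
rewrite mulKf ?gt_eqF// lnK ?posrE// invr_gt0 p0 invf_lt1 //= => /(_ p1).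
rewrite /powR (negbTE un0) => h.
rewrite -(ltr_pM2l p0) mulrDr mulrA mulfV ?gt_eqF// mul1r in h.
rewrite mulrBr mulfV ?gt_eqF// in h; lra.
Qed.

Lemma powR_tangent_lt p a b : 1 < p -> 0 <= a -> 0 <= b -> a != b ->
  a `^ p + p * a `^ (p - 1) * (b - a) < b `^ p.
Proof.
move=> p1 a0 b0 ab; have p0 : 0 < p by lra.
have [ae0|an0] := eqVneq a 0.
  rewrite ae0 !powR0 ?mulr0 ?mul0r ?addr0 ?gt_eqF ?subr_gt0//.
  by rewrite powR_gt0// lt_neqAle b0 -ae0 ab.
have ap : 0 < a by rewrite lt_neqAle eq_sym an0.
have := @powR_bernoulli_lt p (b / a) p1 (divr_ge0 b0 a0).
have -> : b / a != 1 by rewrite -subr_eq0 -(divff an0) -mulrBl mulf_neq0 ?invr_eq0// subr_eq0 eq_sym.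
move=> /(_ isT); rewrite powRM// ?invr_ge0//.
have -> : a^-1 `^ p = (a `^ p)^-1 by rewrite -powR_inv1// -powRrM mulN1r powRN.
rewrite ltr_pdivlMr ?powR_gt0//.
apply: le_lt_trans; rewrite -(mulr_powRB1 a0 p0).
rewrite le_eqVlt; apply/orP; left; apply/eqP; field; exact: an0.
Qed.

Lemma powR_tangent p a b : 1 < p -> 0 <= a -> 0 <= b ->
  a `^ p + p * a `^ (p - 1) * (b - a) <= b `^ p.
Proof.
move=> p1 a0 b0; have [->|ab] := eqVneq a b; first by rewrite subrr mulr0 addr0.
exact/ltW/powR_tangent_lt.
Qed.

Lemma powR_midpoint_le p a b : 1 < p -> 0 <= a -> 0 <= b ->
  ((a + b) / 2) `^ p <= (a `^ p + b `^ p) / 2.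
Proof.
move=> p1 a0 b0; have m0 : 0 <= (a + b) / 2 by lra.
have := powR_tangent p1 m0 a0; have := powR_tangent p1 m0 b0.
set m := (_ + _) / 2; set M := m `^ p; set M' := m `^ _.
have -> : p * M' * (a - m) = - (p * M' * (b - m)) by rewrite /m; field.
lra.
Qed.

Lemma powR_midpoint_lt p a b : 1 < p -> 0 <= a -> 0 <= b -> a != b ->
  ((a + b) / 2) `^ p < (a `^ p + b `^ p) / 2.
Proof.
move=> p1 a0 b0 ab; have m0 : 0 <= (a + b) / 2 by lra.
have ma : (a + b) / 2 != a by apply: contra ab => /eqP ab; apply/eqP; lra.
have := powR_tangent_lt p1 m0 a0 ma; have := powR_tangent p1 m0 b0.
set m := (_ + _) / 2; set M := m `^ p; set M' := m `^ _.
have -> : p * M' * (a - m) = - (p * M' * (b - m)) by rewrite /m; field.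
lra.
Qed.

Lemma powRD_le p a b : 1 < p -> 0 <= a -> 0 <= b ->
  (a + b) `^ p <= 2 `^ p * (a `^ p + b `^ p).
Proof.
move=> p1 a0 b0; have := powR_midpoint_le p1 a0 b0.
have -> : (a + b) `^ p = 2 `^ p * ((a + b) / 2) `^ p.
  by rewrite -powRM ?divr_ge0 ?addr_ge0// mulrC divfK.
move=> h; rewrite ler_pM2l ?powR_gt0//; apply: le_trans h _.
have := powR_ge0 a p; have := powR_ge0 b p; lra.
Qed.

Lemma normr_powR_continuous p : 0 < p -> continuous (fun x : R => `|x| `^ p).
Proof.
move=> p0 x; have [->|x0] := eqVneq x 0.
  rewrite /continuous_at normr0 powR0 ?gt_eqF//.
  apply/cvgr0Pnorm_lt => e e0.
  have d0 : 0 < e `^ p^-1 by rewrite powR_gt0.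
  near=> z.
  have zd : `|z| < e `^ p^-1.
    by near: z; apply: (@cvgr0_norm_lt _ _ _ _ _ id) => //; exact: cvg_id.
  rewrite ger0_norm ?powR_ge0//.
  have -> : e = (e `^ p^-1) `^ p by rewrite -powRrM mulVf ?gt_eqF// powRr1// ltW.
  by rewrite gt0_ltr_powR ?nnegrE// ltW.
have -> : (fun x : R => `|x| `^ p) = (fun y => y `^ p) \o (fun y => `|y|) by [].
apply: continuous_comp; first exact: norm_continuous.
apply: differentiable_continuous; apply/derivable1_diffP.
by apply: derivable_powR; rewrite in_itv/= normr_gt0 x0.
Unshelve. all: by end_near. Qed.

(** For q < p a q-th power is absorbed by any small multiple of the p-th power
    up to a constant; the power of e in this constant is what fixes the
    exponent of the radii. *)
Lemma powR_absorb p q e y : 0 < q -> q < p -> 0 < e -> 0 <= y ->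
  y `^ q <= e * y `^ p + e `^ (- (q / (p - q))).
Proof.
move=> q0 qp e0 y0; have pq : 0 < p - q by lra.
have [y00|yn0] := eqVneq y 0.
  rewrite y00 powR0 ?gt_eqF// powR0 ?gt_eqF ?(lt_trans q0)//.
  by rewrite mulr0 add0r powR_ge0.
have yp : 0 < y by rewrite lt_neqAle eq_sym yn0.
have [h|h] := leP 1 (e * y `^ (p - q)).
  apply: (@le_trans _ _ (e * y `^ p)); last by rewrite lerDl powR_ge0.
  have -> : p = q + (p - q) by ring.
  rewrite powRD; last by rewrite yn0 implybT.
  by rewrite mulrCA -[leLHS]mulr1 ler_pM2l ?powR_gt0//.
apply: (@le_trans _ _ (e `^ (- (q / (p - q))))); last first.
  by rewrite lerDr mulr_ge0 ?powR_ge0// ltW.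
have -> : y `^ q = (y `^ (p - q)) `^ (q / (p - q)).
  by rewrite -powRrM mulrC divfK// gt_eqF.
have -> : e `^ (- (q / (p - q))) = (e `^ (-1)) `^ (q / (p - q)).
  by rewrite -powRrM mulN1r.
rewrite ge0_ler_powR ?divr_ge0 ?nnegrE ?powR_ge0 ?ltW//.
by rewrite powR_inv1 ?ltW// -(ltr_pM2l e0) mulfV// gt_eqF.
Qed.

(** The same absorption after factoring out y, with exponents q - 1 < p - 1. *)
Lemma powR_absorb_id p q e y : 1 < q -> q < p -> 0 < e -> 0 <= y ->
  y `^ q <= e * y `^ p + e `^ (- ((q - 1) / (p - q))) * y.
Proof.
move=> q1 qp e0 y0.
have -> : y `^ q = y `^ (q - 1) * y by rewrite mulrC mulr_powRB1//; lra.
have -> : y `^ p = y `^ (p - 1) * y by rewrite mulrC mulr_powRB1//; lra.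
rewrite mulrA -mulrDl ler_wpM2r//.
have := @powR_absorb (p - 1) (q - 1) e y.
have -> : p - 1 - (q - 1) = p - q by ring.
by apply => //; lra.
Qed.

End powR_facts.

Lemma continuous_sum {R : realType} (T : topologicalType) (I : Type)
    (s : seq I) (P : pred I) (h : I -> T -> R) :
  (forall i, P i -> continuous (h i)) ->
  continuous (fun x => \sum_(i <- s | P i) h i x).
Proof.
move=> ch; elim: s => [|i s IH] x.
  by under eq_fun do rewrite big_nil; exact: cvg_cst.
under eq_fun do rewrite big_cons.
case: ifPn => Pi; last exact: IH.
by apply: cvgD; [exact: ch|exact: IH].
Qed.

Section euclidean.
Context {R : realType} {N : nat}.
Implicit Types (a b c : 'rV[R]_N).

Lemma dotvC a b : dotv a b = dotv b a.
Proof. by apply: eq_bigr => i _; rewrite mulrC. Qed.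

Lemma dotvDl a b c : dotv (a + b) c = dotv a c + dotv b c.
Proof. by rewrite -big_split; apply: eq_bigr => i _; rewrite mxE mulrDl. Qed.

Lemma dotvZl (k : R) a b : dotv (k *: a) b = k * dotv a b.
Proof. by rewrite /dotv mulr_sumr; apply: eq_bigr => i _; rewrite mxE mulrA. Qed.

Lemma dotvDr a b c : dotv c (a + b) = dotv c a + dotv c b.
Proof. by rewrite dotvC dotvDl !(dotvC c). Qed.

Lemma dotvZr (k : R) a b : dotv b (k *: a) = k * dotv b a.
Proof. by rewrite dotvC dotvZl (dotvC b). Qed.

Lemma dotvNl a b : dotv (- a) b = - dotv a b.
Proof. by rewrite -scaleN1r dotvZl mulN1r. Qed.

Lemma dotvNr a b : dotv b (- a) = - dotv b a.
Proof. by rewrite dotvC dotvNl dotvC. Qed.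

Lemma dotv_ge0 a : 0 <= dotv a a.
Proof. by apply: sumr_ge0 => i _; rewrite -expr2 sqr_ge0. Qed.

Lemma enorm_ge0 a : 0 <= enorm a.
Proof. exact: sqrtr_ge0. Qed.

Lemma enorm_sqr a : enorm a ^+ 2 = dotv a a.
Proof. by rewrite sqr_sqrtr// dotv_ge0. Qed.

Lemma enorm0 : enorm (0 : 'rV[R]_N) = 0.
Proof.
by rewrite /enorm /dotv big1 ?sqrtr0// => i _; rewrite mxE mul0r.
Qed.

Lemma enormZ (k : R) a : enorm (k *: a) = `|k| * enorm a.
Proof.
by rewrite /enorm dotvZl dotvZr mulrA -expr2 sqrtrM ?sqr_ge0// sqrtr_sqr.
Qed.

Lemma enormN a : enorm (- a) = enorm a.
Proof. by rewrite -scaleN1r enormZ normrN1 mul1r. Qed.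

Lemma normr_coord_le a i : `|a 0 i| <= enorm a.
Proof.
rewrite -sqrtr_sqr ler_wsqrtr// /dotv (bigD1 i)//= expr2 lerDl.
by apply: sumr_ge0 => j _; rewrite -expr2 sqr_ge0.
Qed.

Lemma enorm_eq0 a : enorm a = 0 -> a = 0.
Proof.
move=> a0; apply/rowP => i; apply/eqP; rewrite mxE -normr_le0 -a0.
exact: normr_coord_le.
Qed.

Lemma dotv_le a b : dotv a b <= enorm a * enorm b.
Proof.
have [/eqP/enorm_eq0 -> |a0] := boolP (enorm a == 0).
  by rewrite enorm0 mul0r /dotv big1// => i _; rewrite mxE mul0r.
have [/eqP/enorm_eq0 -> |b0] := boolP (enorm b == 0).
  by rewrite enorm0 mulr0 /dotv big1// => i _; rewrite mxE mulr0.
have ap : 0 < enorm a by rewrite lt_neqAle eq_sym a0 enorm_ge0.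
have bp : 0 < enorm b by rewrite lt_neqAle eq_sym b0 enorm_ge0.
have := dotv_ge0 (enorm b *: a - enorm a *: b).
rewrite dotvDl !dotvDr !(dotvNl, dotvNr) !dotvZl !dotvZr -!enorm_sqr (dotvC b a).
move=> h; have : 0 <= 2 * (enorm a * enorm b) * (enorm a * enorm b - dotv a b).
  by move: h; congr (_ <= _); ring.
by rewrite pmulr_rge0 ?mulr_gt0// subr_ge0.
Qed.

Lemma normr_dotv_le a b : `|dotv a b| <= enorm a * enorm b.
Proof.
rewrite ler_norml dotv_le andbT lerNl -dotvNl (le_trans (dotv_le _ _))//.
by rewrite enormN.
Qed.

Lemma enormD a b : enorm (a + b) <= enorm a + enorm b.
Proof.
rewrite -(@ler_pXn2r _ 2) ?nnegrE ?addr_ge0 ?enorm_ge0//.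
rewrite sqrrD !enorm_sqr dotvDl !dotvDr (dotvC b a).
by have := dotv_le a b; lra.
Qed.

Lemma enormB a b : enorm (a - b) <= enorm a + enorm b.
Proof. by rewrite -(enormN b) enormD. Qed.

Lemma enorm_lipschitz a b : `|enorm a - enorm b| <= enorm (a - b).
Proof.
rewrite ler_norml; apply/andP; split.
  have := enormD (b - a) a; rewrite subrK -(enormN (b - a)) opprB; lra.
have := enormD (a - b) b; rewrite subrK; lra.
Qed.

Lemma enorm_le_sum a : enorm a <= \sum_i `|a 0 i|.
Proof.
have s0 : 0 <= \sum_i `|a 0 i| by apply: sumr_ge0.
rewrite -[leRHS]ger0_norm// -sqrtr_sqr ler_wsqrtr//.
rewrite expr2 big_distrl/=; apply: ler_sum => i _.
rewrite (le_trans (ler_norm _))// normrM ler_wpM2l// (bigD1 i)//= lerDl.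
by apply: sumr_ge0.
Qed.

Lemma enorm_parallelogram a b :
  enorm (2^-1 *: (a + b)) ^+ 2 =
  (enorm a ^+ 2 + enorm b ^+ 2) / 2 - enorm (a - b) ^+ 2 / 4.
Proof.
rewrite !enorm_sqr dotvZl dotvZr !(dotvDl, dotvDr, dotvNl, dotvNr) (dotvC b a).
by field.
Qed.

Lemma dotv_continuous (T : topologicalType) (f g : T -> 'rV[R]_N) :
  continuous f -> continuous g -> continuous (fun x => dotv (f x) (g x)).
Proof.
move=> cf cg x; apply: continuous_sum => i _ {}x.
apply: cvgM; first by apply: (cvg_comp _ (fun y : 'rV[R]_N => y 0 i) (cf x)); exact: coord_continuous.
by apply: (cvg_comp _ (fun y : 'rV[R]_N => y 0 i) (cg x)); exact: coord_continuous.
Qed.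

Lemma enorm_continuous : continuous (@enorm R N).
Proof.
move=> x; apply: (@continuous_comp _ _ _ (fun x => dotv x x) Num.sqrt).
  by apply: dotv_continuous => ?; exact: cvg_id.
exact: sqrt_continuous.
Qed.

(** Cauchy--Schwarz reduces the tangent inequality for a power of the Euclidean
    norm to the one for real numbers. *)
Lemma enorm_powR_tangent p a b : 1 < p ->
  enorm a `^ p + p * enorm a `^ (p - 2) * dotv a (b - a) <= enorm b `^ p.
Proof.
move=> p1; apply: le_trans (powR_tangent p1 (enorm_ge0 a) (enorm_ge0 b)).
rewrite lerD2l -!mulrA ler_wpM2l//; first lra.
rewrite dotvDr dotvNr -enorm_sqr.
have [a0|a0] := eqVneq (enorm a) 0.
  rewrite (enorm_eq0 a0) enorm0 (_ : dotv 0 b = 0) ?expr0n/= ?subr0 ?mulr0.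
    by rewrite mulr_ge0 ?powR_ge0 ?enorm_ge0.
  by rewrite /dotv big1// => i _; rewrite mxE mul0r.
have -> : p - 1 = (p - 2) + 1 by ring.
rewrite [X in _ <= X * _]powRD; last by rewrite a0 implybT.
rewrite powRr1 ?enorm_ge0// -mulrA ler_wpM2l ?powR_ge0//.
by rewrite mulrBr expr2 lerD2r dotv_le.
Qed.

Lemma enorm_powR_midpoint p a b : 1 < p ->
  enorm (2^-1 *: (a + b)) `^ p <= (enorm a `^ p + enorm b `^ p) / 2.
Proof.
move=> p1; apply: le_trans (powR_midpoint_le p1 (enorm_ge0 a) (enorm_ge0 b)).
rewrite ge0_ler_powR ?nnegrE ?enorm_ge0 ?divr_ge0 ?addr_ge0 ?enorm_ge0//; first lra.
by rewrite enormZ ger0_norm// mulrC ler_pM2r// enormD.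
Qed.

(** Equality forces equal norms by strict convexity of the power, and then
    equal vectors by the parallelogram identity. *)
Lemma enorm_powR_midpoint_eq p a b : 1 < p ->
  (enorm a `^ p + enorm b `^ p) / 2 <= enorm (2^-1 *: (a + b)) `^ p -> a = b.
Proof.
move=> p1 h; have na0 := enorm_ge0 a; have nb0 := enorm_ge0 b.
have m1 : enorm (2^-1 *: (a + b)) <= (enorm a + enorm b) / 2.
  by rewrite enormZ ger0_norm// mulrC ler_pM2r// enormD.
have m2 : enorm (2^-1 *: (a + b)) `^ p <= ((enorm a + enorm b) / 2) `^ p.
  rewrite ge0_ler_powR ?nnegrE ?enorm_ge0 ?divr_ge0 ?addr_ge0//.
  by rewrite ltW// (lt_trans ltr01).
have ab : enorm a = enorm b.
  apply/eqP; apply/negPn/negP => /(powR_midpoint_lt p1 na0 nb0).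
  by rewrite ltNge (le_trans h m2).
rewrite ab in h m1.
have : enorm b <= enorm (2^-1 *: (a + b)).
  rewrite leNgt; apply/negP => /(@gt0_ltr_powR _ p) lt.
  have := lt (lt_trans ltr01 p1); rewrite !nnegrE !enorm_ge0 => /(_ isT isT).
  move: h; set A := enorm b `^ p; set B := enorm _ `^ p; lra.
rewrite -(@ler_pXn2r _ 2) ?nnegrE ?enorm_ge0// enorm_parallelogram ab => h2.
have := sqr_ge0 (enorm (a - b)) => h3.
have : enorm (a - b) ^+ 2 == 0 by apply/eqP; lra.
by rewrite sqrf_eq0 => /eqP/enorm_eq0 /eqP; rewrite subr_eq0 => /eqP.
Qed.

Let closed_ge (T : topologicalType) (f : T -> R) (c : R) :
  continuous f -> closed [set x | c <= f x].
Proof.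
move=> cf; apply: (closed_comp (f := f) (D := [set y : R | c <= y])).
  by move=> x _; exact: cf.
exact: closed_ge.
Qed.

Let closed_eq (T : topologicalType) (f : T -> R) (c : R) :
  continuous f -> closed [set x | f x = c].
Proof.
move=> cf; apply: (closed_comp (f := f) (D := [set y : R | y = c])).
  by move=> x _; exact: cf.
exact: closed_eq.
Qed.

(** A pointwise form of the uniform convexity of L^p, valid for all p > 1: by
    homogeneity and compactness of the unit sphere, the convexity deficit of
    a pair which is not almost diagonal is at least a fixed fraction of its
    size. *)
Lemma enorm_uniform_convexity p e : 1 < p -> 0 < e -> exists2 C, 0 <= C &
  forall a b, enorm (a - b) `^ p <= e * (enorm a `^ p + enorm b `^ p) +
    C * ((enorm a `^ p + enorm b `^ p) / 2 - enorm (2^-1 *: (a + b)) `^ p).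
Proof.
move=> p1 e0; have p0 : 0 < p by lra.
pose V := ('rV[R]_N * 'rV[R]_N)%type.
pose S (x : V) := enorm x.1 `^ p + enorm x.2 `^ p.
pose D (x : V) := enorm (x.1 - x.2) `^ p.
pose H (x : V) := S x / 2 - enorm (2^-1 *: (x.1 + x.2)) `^ p.
have cnp (f : V -> 'rV[R]_N) : continuous f -> continuous (fun x => enorm (f x) `^ p).
  move=> cf x.
  have -> : (fun x => enorm (f x) `^ p) = (fun x => `|x| `^ p) \o (@enorm R N \o f).
    by apply/funext => y /=; rewrite ger0_norm ?enorm_ge0.
  apply: continuous_comp; last exact: normr_powR_continuous.
  by apply: continuous_comp; [exact: cf|exact: enorm_continuous].
have c1 : continuous (fst : V -> _) by move=> x; exact: cvg_fst.
have c2 : continuous (snd : V -> _) by move=> x; exact: cvg_snd.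
have cS : continuous S by move=> x; apply: cvgD; exact: cnp.
have cD : continuous D by apply: cnp => x; apply: cvgB; [exact: c1|exact: c2].
have cH : continuous H.
  move=> x; apply: cvgB; first by apply: cvgMl; exact: cS.
  by apply: cnp => y; apply: cvgZl_tmp; apply: cvgD; [exact: c1|exact: c2].
have nS0 x : 0 <= S x by rewrite addr_ge0// powR_ge0.
have H0 x : 0 <= H x by rewrite subr_ge0; exact: enorm_powR_midpoint.
(* the compact set of normalised pairs which are not almost diagonal, on which
   the deficit H has a positive minimum *)
pose K := [set x : V | S x = 1] `&` [set x : V | e <= D x].
have cK : compact K.
  apply: (@subclosed_compact _ _
      ([set x : 'rV[R]_N | forall i, x 0 i \in `[-1, 1]%R] `*`
       [set x : 'rV[R]_N | forall i, x 0 i \in `[-1, 1]%R])).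
  - by apply: closedI; [exact: closed_eq|exact: closed_ge].
  - have cI : compact [set x : 'rV[R]_N | forall i, x 0 i \in `[-1, 1]%R].
      by apply: (@rV_compact R N (fun=> [set` `[-1, 1]%R])) => i; exact: segment_compact.
    exact: compact_setX.
  - move=> [a b] [/= S1 _]; rewrite /S/= in S1.
    have := powR_ge0 (enorm a) p; have := powR_ge0 (enorm b) p => hb ha.
    have h (c : 'rV[R]_N) : enorm c `^ p <= 1 -> forall i, c 0 i \in `[-1, 1]%R.
      move=> hc i; rewrite in_itv/= -ler_norml (le_trans (normr_coord_le _ _))//.
      rewrite leNgt; apply/negP => c1'.
      have : 1 `^ p < enorm c `^ p by rewrite gt0_ltr_powR ?nnegrE ?enorm_ge0.
      by rewrite powR1; lra.
    by split; apply: h; lra.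
have [d d0 hd] : exists2 d, 0 < d & forall x, K x -> d <= H x.
  have [->|/set0P K0] := eqVneq K set0; first by exists 1.
  have [c cK' hc] := compact_EVT_min K0 cK (continuous_subspaceT cH).
  exists (H c); last by move=> x Kx; apply: hc; rewrite inE.
  rewrite lt_neqAle H0 andbT; apply/eqP => Hc.
  move: cK'; rewrite inE => -[_ /=]; rewrite /D.
  have -> : c.1 = c.2.
    by apply: (enorm_powR_midpoint_eq p1); rewrite -subr_le0 -/(S c) -/(H c) -Hc.
  by rewrite subrr enorm0 powR0 ?gt_eqF// leNgt e0.
exists (2 `^ p * 2 / d); first by rewrite divr_ge0 ?mulr_ge0 ?powR_ge0 ?ltW.
move=> a b; rewrite -/(S (a, b)) -/(H (a, b)) -/(D (a, b)).
have C0 : 0 <= 2 `^ p * 2 / d by rewrite divr_ge0 ?mulr_ge0 ?powR_ge0 ?ltW.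
have [De|De] := leP (D (a, b)) (e * S (a, b)).
  by apply: le_trans De _; rewrite lerDl mulr_ge0.
have Sp : 0 < S (a, b).
  rewrite lt_neqAle nS0 andbT; apply/eqP => S0; move: De; rewrite -S0 mulr0.
  have := powR_ge0 (enorm a) p; have := powR_ge0 (enorm b) p.
  rewrite /S/= in S0 => hb ha.
  have /powR_eq0_eq0/enorm_eq0 -> : enorm a `^ p = 0 by lra.
  have /powR_eq0_eq0/enorm_eq0 -> : enorm b `^ p = 0 by lra.
  by rewrite /D/= subrr enorm0 powR0 ?ltxx// gt_eqF.
set s := S (a, b) in De Sp *.
(* the dilation which normalises the pair *)
pose k := s `^ (- p^-1).
have k0 : 0 < k by rewrite powR_gt0.
have kp : k `^ p = s^-1.
  by rewrite /k -powRrM mulNr mulVf ?gt_eqF// powR_inv1// ltW.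
have hom c : enorm (k *: c) `^ p = s^-1 * enorm c `^ p.
  by rewrite enormZ gtr0_norm// powRM ?enorm_ge0 ?(ltW k0)// kp.
have Sk : S (k *: a, k *: b) = s^-1 * S (a, b) by rewrite /S/= !hom mulrDr.
have Hk : H (k *: a, k *: b) = s^-1 * H (a, b).
  rewrite /H Sk/= -scalerDr scalerA [2^-1 * k]mulrC -scalerA hom mulrBr.
  by rewrite mulrA.
have Dk : D (k *: a, k *: b) = s^-1 * D (a, b) by rewrite /D/= -scalerBr hom.
have : d <= H (k *: a, k *: b).
  apply: hd; split => /=; first by rewrite Sk mulVf// gt_eqF.
  by rewrite Dk mulrC ler_pdivlMr// ltW.
rewrite Hk mulrC ler_pdivlMr// => dH.
have DS : D (a, b) <= 2 `^ p * 2 * s.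
  rewrite /D/= (@le_trans _ _ ((enorm a + enorm b) `^ p))//.
    rewrite ge0_ler_powR ?nnegrE ?addr_ge0 ?enorm_ge0 ?(ltW p0)//.
    exact: enormB.
  rewrite (le_trans (powRD_le p1 (enorm_ge0 _) (enorm_ge0 _)))//.
  rewrite -mulrA ler_pM2l ?powR_gt0// -/(S (a, b)) -/s.
  by rewrite mulr_natl mulr2n lerDl ltW.
apply: le_trans DS _; rewrite -[leLHS]add0r lerD ?mulr_ge0 ?(ltW e0) ?(ltW Sp)//.
by rewrite -!mulrA !ler_pM2l ?powR_gt0// mulrC ler_pdivlMr// mulrC.
Qed.

End euclidean.

(** * Borel measurability and the theorem of Tonelli on R^n *)
Lemma continuous_rV {R : realType} (T : topologicalType) n (f : T -> 'rV[R]_n) :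
  (forall i, continuous (fun x => f x 0 i)) -> continuous f.
Proof.
move=> cf x; apply/cvg_ballP => e e0.
have : \forall y \near x, forall i, ball (f x 0 i) e (f y 0 i).
  apply: filter_forall => i.
  have := cf i x => /cvg_ballP /(_ e e0); exact.
by apply: filterS => y xy; split => // i j; rewrite (ord1 i).
Qed.

Section measurability_rV.
Context {R : realType} {n : nat}.

Lemma measurable_coord (i : 'I_n) :
  measurable_fun [set: 'rV[R]_n] (fun x => x 0 i).
Proof.
move=> _ Y mY; rewrite setTI; apply: sub_sigma_algebra.
rewrite -bigcup_seq/=; exists i; first by rewrite /= mem_index_enum.
by exists Y; rewrite ?setTI.
Qed.

Lemma measurable_fun_rV d (T : measurableType d) (D : set T)
    (G : T -> 'rV[R]_n) :
  (forall i, measurable_fun D (fun x => G x 0 i)) -> measurable_fun D G.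
Proof.
move=> mG mD.
apply: (@measurability _ _ _ 'rV[R]_n _ _ (\big[setU/set0]_(i < n)
  preimage_set_system setT (fun x : 'rV[R]_n => x 0 i) measurable)) => //.
move=> _ [Y + <-]; rewrite -bigcup_seq => -[i _ [B mB <-]].
rewrite setTI; exact: (mG i).
Qed.

Lemma measurable_fun_coord d (T : measurableType d) (D : set T)
    (G : T -> 'rV[R]_n) (i : 'I_n) :
  measurable_fun D G -> measurable_fun D (fun x => G x 0 i).
Proof. by move=> mG; apply: (measurableT_comp (measurable_coord i)). Qed.

(** The measurable structure is generated by the coordinates, so open sets need
    an argument: f is the pointwise limit of f o g_k where g_k rounds every
    coordinate down to a multiple of 1 / (k + 1), hence takes countably many
    values. *)
Lemma continuous_measurable_rV (f : 'rV[R]_n -> R) :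
  continuous f -> measurable_fun setT f.
Proof.
move=> cf.
pose z k (x : 'rV[R]_n) : 'rV[int]_n := \row_i Num.floor (k.+1%:R * x 0 i).
pose g k (v : 'rV[int]_n) : 'rV[R]_n := \row_i ((v 0 i)%:~R / k.+1%:R).
apply: (measurable_fun_cvg (h := fun k => f \o (g k \o z k))) => [k _ Y mY|x _].
  rewrite setTI.
  have -> : (f \o (g k \o z k)) @^-1` Y =
      \bigcup_(v in [set: 'rV[int]_n])
        (if f (g k v) \in Y then [set x | z k x = v] else set0).
    apply/seteqP; split => [x /= Yx|x [v _]].
      by exists (z k x) => //; rewrite mem_set.
    by case: ifPn => //; rewrite inE => Yv /= ->.
  apply: countable_bigcupT_measurable; first exact: countableP.
  move=> v; case: ifPn => // _.
  have -> : [set x | z k x = v] = \bigcap_(i in [set: 'I_n])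
      [set x : 'rV[R]_n | (v 0 i)%:~R / k.+1%:R <= x 0 i < (v 0 i + 1)%:~R / k.+1%:R].
    apply/seteqP; split => [x /= <- i _ /=|x /= h].
      rewrite mxE ler_pdivrMr ?ltr0n// ltr_pdivlMr ?ltr0n// mulrC.
      exact: floor_itv.
    apply/rowP => i; rewrite mxE; apply/eqP; rewrite floor_eq.
    have := h i Logic.I => /=; rewrite ler_pdivrMr ?ltr0n// ltr_pdivlMr ?ltr0n//.
    by rewrite mulrC.
  apply: fin_bigcap_measurable; first exact: finite_finset.
  move=> i _; rewrite -[X in measurable X]setTI.
  pose I : interval R := `[(v 0 i)%:~R / k.+1%:R, (v 0 i + 1)%:~R / k.+1%:R[.
  have := measurable_coord i measurableT (measurable_itv I).
  by congr (measurable (_ `&` _)).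
apply: continuous_cvg; first exact: cf.
apply/cvg_ballP => e e0.
near=> k; split => // i j; rewrite (ord1 i) /ball/= !mxE.
have k0 : 0 < k.+1%:R :> R by rewrite ltr0n.
have /andP[h1 h2] := floor_itv (k.+1%:R * x 0 j).
set y := x 0 j in h1 h2 *; set m : R := _%:~R.
rewrite intrD -/m in h1 h2.
have ke : 1 < e * k.+1%:R.
  rewrite -ltr_pdivrMr// mul1r.
  by near: k; exact: (near_infty_natSinv_lt (PosNum e0)).
have -> : y - m / k.+1%:R = (k.+1%:R * y - m) / k.+1%:R by field; lra.
rewrite ger0_norm; last by rewrite divr_ge0 ?subr_ge0// ltW.
by rewrite ltr_pdivrMr//; move: h1 h2 ke; rewrite -/m; lra.
Unshelve. all: by end_near. Qed.

Lemma measurable_enorm d (T : measurableType d) (D : set T)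
    (G : T -> 'rV[R]_n) :
  measurable_fun D G -> measurable_fun D (fun x => enorm (G x)).
Proof.
move=> mG; apply: (measurableT_comp (f := @enorm R n)) => //.
apply: continuous_measurable_rV; exact: enorm_continuous.
Qed.

Lemma measurable_dotv d (T : measurableType d) (D : set T)
    (G H : T -> 'rV[R]_n) : measurable_fun D G -> measurable_fun D H ->
  measurable_fun D (fun x => dotv (G x) (H x)).
Proof.
move=> mG mH; apply: measurable_sum => i; apply: measurable_funM.
  exact: measurable_fun_coord.
exact: measurable_fun_coord.
Qed.

Lemma eball_measurable (c : 'rV[R]_n) (r : R) :
  measurable (eball c r : set 'rV[R]_n).
Proof.
have ce : continuous (fun x : 'rV[R]_n => enorm (x - c)).
  have -> : (fun x : 'rV[R]_n => enorm (x - c)) = @enorm R n \o (fun x => x - c) by [].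
  move=> x; apply: continuous_comp; last exact: enorm_continuous.
  exact: (@cvgD _ _ _ (nbhs x) _ id (cst (- c)) x (- c) cvg_id (cvg_cst _)).
have := continuous_measurable_rV ce measurableT (measurable_itv `]-oo, r[).
by rewrite setTI; congr measurable.
Qed.

End measurability_rV.

Section slices.
Context {R : realType} {n : nat}.
Implicit Types (x : 'rV[R]_n) (t : R).

Lemma rcons_rV_lift x t (j : 'I_n) : rcons_rV (x, t) 0 (lift ord_max j) = x 0 j.
Proof. by rewrite mxE liftK. Qed.

Lemma rcons_rV_max x t : rcons_rV (x, t) 0 ord_max = t.
Proof. by rewrite mxE unlift_none. Qed.

Definition belast_rV (y : 'rV[R]_n.+1) : 'rV[R]_n :=
  \row_j y 0 (lift ord_max j).

Lemma rcons_rV_continuousl t : continuous (fun x => rcons_rV (x, t)).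
Proof.
apply: continuous_rV => i; case: (unliftP ord_max i) => [j ->|->].
  under eq_fun do rewrite rcons_rV_lift; exact: coord_continuous.
have -> : (fun x => rcons_rV (x, t) 0 ord_max) = cst t.
  by apply/funext => x; rewrite rcons_rV_max.
exact: cst_continuous.
Qed.

Lemma rcons_rV_continuousr x : continuous (fun t => rcons_rV (x, t)).
Proof.
apply: continuous_rV => i; case: (unliftP ord_max i) => [j ->|->].
  under eq_fun do rewrite rcons_rV_lift; move=> ?; exact: cvg_cst.
by under eq_fun do rewrite rcons_rV_max; move=> ?; exact: cvg_id.
Qed.

End slices.

Definition cube {R : realType} {n : nat} (c : 'rV[R]_n) (r : R) : set 'rV[R]_n :=
  [set x | forall i, x 0 i \in `]c 0 i - r, c 0 i + r[ ].

Section lebesgue_rV.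
Context {R : realType}.

Lemma cube_measurable n (c : 'rV[R]_n) r : measurable (cube c r : set 'rV[R]_n).
Proof.
have -> : cube c r = \bigcap_(i in [set: 'I_n])
    ((fun x : 'rV[R]_n => x 0 i) @^-1` [set` `]c 0 i - r, c 0 i + r[ ]).
  by apply/seteqP; split => x /= h i; [move=> _|]; exact: h.
apply: fin_bigcap_measurable; first exact: finite_finset.
move=> i _; rewrite -[X in measurable X]setTI.
exact: (measurable_coord i measurableT (measurable_itv _)).
Qed.

Lemma lebesgue_cube n (c : 'rV[R]_n) r : 0 < r ->
  lebesgue_rV (cube c r) = ((2 * r) ^+ n)%:E.
Proof.
move=> r0; elim: n c => [|n IH] c.
  by rewrite /= diracE expr0 mem_set// => -[].
have I2 : (@lebesgue_measure R)
    [set` `]c 0 ord_max - r, c 0 ord_max + r[ ] = (2 * r)%:E.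
  rewrite lebesgue_measure_itv/= lte_fin ifT; last lra.
  by rewrite -EFinB; congr (_%:E); ring.
have := @product_measure1E _ _ _ _ _ (@lebesgue_rV R n) (@lebesgue_measure R)
  (cube (belast_rV c) r) [set` `]c 0 ord_max - r, c 0 ord_max + r[ ]
  (cube_measurable _ _) (measurable_itv _).
move=> h; rewrite exprSr EFinM -(IH (belast_rV c)) -I2.
etransitivity; last exact: h.
rewrite [LHS]/= /pushforward; congr (product_measure1 _ _ _).
apply/seteqP; split => [[x t] /= xt|[x t] [/= hx ht] i].
  split => /=; last by have := xt ord_max; rewrite rcons_rV_max.
  by move=> i; have := xt (lift ord_max i); rewrite rcons_rV_lift mxE.
case: (unliftP ord_max i) => [j ->|->]; last by rewrite rcons_rV_max.
by rewrite rcons_rV_lift; have := hx j; rewrite mxE.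
Qed.

Lemma lebesgue_rV_sigma_finite n : sigma_finite setT (@lebesgue_rV R n).
Proof.
exists (fun k => cube 0 k.+1%:R).
  rewrite eqEsubset; split => // x _.
  exists (Num.bound (\sum_i `|x 0 i|)) => // i.
  rewrite mxE sub0r add0r in_itv/= -ltr_norml.
  have s0 : 0 <= \sum_i `|x 0 i| by apply: sumr_ge0.
  have := archi_boundP s0; set k := Num.bound _ => h.
  rewrite (@le_lt_trans _ _ (\sum_i `|x 0 i|))//.
    by rewrite (bigD1 i)//= lerDl sumr_ge0.
  by rewrite (lt_trans h)// ltr_nat.
move=> k; split; first exact: cube_measurable.
by rewrite lebesgue_cube ?ltr0n// ltry.
Qed.

HB.instance Definition _ n := @Measure_isSigmaFinite.Build _ _ _
  (@lebesgue_rV R n) (lebesgue_rV_sigma_finite n).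

Section tonelli.
Context {n : nat} (f : 'rV[R]_n.+1 -> \bar R).
Hypothesis mf : measurable_fun setT f.
Hypothesis f0 : forall x, (0 <= f x)%E.

Let mfr : measurable_fun [set: 'rV[R]_n * measurableTypeR R]
  (fun z => f (rcons_rV z)).
Proof. exact: (measurableT_comp mf measurable_rcons_rV). Qed.

Let fr0 (z : 'rV[R]_n * measurableTypeR R) : (0 <= f (rcons_rV z))%E.
Proof. exact: f0. Qed.

Lemma integral_rcons_rV : (\int[@lebesgue_rV R n.+1]_x f x =
  \int[@lebesgue_rV R n]_x \int[@lebesgue_measure R]_t f (rcons_rV (x, t)))%E.
Proof.
rewrite [LHS]/=.
rewrite (ge0_integral_pushforward measurable_rcons_rV
  (@lebesgue_rV R n \x @lebesgue_measure R)%E measurableT mf); last by [].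
rewrite preimage_setT.
exact: (fubini_tonelli1 (m1 := @lebesgue_rV R n) (m2 := @lebesgue_measure R) _ mfr fr0).
Qed.

Lemma integral_rcons_rV_swap : (\int[@lebesgue_rV R n.+1]_x f x =
  \int[@lebesgue_measure R]_t \int[@lebesgue_rV R n]_x f (rcons_rV (x, t)))%E.
Proof.
rewrite integral_rcons_rV.
exact: (fubini_tonelli (m1 := @lebesgue_rV R n) (m2 := @lebesgue_measure R) _ mfr fr0).
Qed.

Lemma measurable_integral_rcons_rV : measurable_fun [set: 'rV[R]_n]
  (fun x => \int[@lebesgue_measure R]_t f (rcons_rV (x, t)))%E.
Proof.
exact: (measurable_fun_fubini_tonelli_F (m2 := @lebesgue_measure R) _ mfr fr0).
Qed.

Lemma measurable_integral_rcons_rV_swap :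
  measurable_fun [set: measurableTypeR R]
    (fun t => \int[@lebesgue_rV R n]_x f (rcons_rV (x, t)))%E.
Proof.
exact: (measurable_fun_fubini_tonelli_G (m1 := @lebesgue_rV R n) _ mfr fr0).
Qed.

End tonelli.
End lebesgue_rV.

(** * Completeness of L^p *)
Lemma cvge0P {R : realType} (u : nat -> \bar R) : (forall n, 0 <= u n)%E ->
  u @ \oo --> 0%E <-> (forall e : R, 0 < e -> \forall n \near \oo, (u n < e%:E)%E).
Proof.
move=> u0; split => [/fine_cvgP[ufin ucvg] e e0|h].
  move/cvgr0Pnorm_lt : ucvg => /(_ e e0) ucvg.
  near=> n; rewrite -(@fineK _ (u n)); last by near: n.
  by rewrite lte_fin (le_lt_trans (ler_norm _))//; near: n.
apply/fine_cvgP; split.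
  apply: filterS (h 1 ltr01) => n un; rewrite ge0_fin_numE//.
  by rewrite (lt_trans un)// ltry.
apply/cvgr0Pnorm_lt => e e0; apply: filterS (h e e0) => n /= un.
rewrite ger0_norm ?fine_ge0// -lte_fin fineK// ge0_fin_numE//.
by rewrite (lt_trans un)// ltry.
Unshelve. all: by end_near. Qed.

Section Lp.
Context d (T : measurableType d) (R : realType).
Variable mu : {measure set T -> \bar R}.
Implicit Types (f g : T -> R) (p : R).
Local Notation "''N_' p [ f ]" := (Lnorm mu p%:E (EFin \o f%R)).
Local Notation pint p f := (\int[mu]_x (`|f x| `^ p)%:E)%E.

Lemma measurable_powR_norm p f : measurable_fun setT f ->
  measurable_fun setT (fun x => (`|f x| `^ p)%:E).
Proof.
move=> mf; apply/measurable_EFinP.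
apply: (@measurableT_comp _ _ _ _ _ _ (@powR R ^~ p)) => //.
exact: measurableT_comp.
Qed.

Lemma pint_ge0 p f : (0 <= pint p f)%E.
Proof. by apply: integral_ge0 => x _; rewrite lee_fin powR_ge0. Qed.

Lemma LnormE p f : 'N_p[f] = ((pint p f) `^ p^-1)%E.
Proof. by rewrite unlock. Qed.

Lemma Lnorm_powR p f : p != 0 -> (('N_p[f]) `^ p)%E = pint p f.
Proof. by move=> p0; rewrite poweR_Lnorm. Qed.

Lemma Lnorm_leE p f e : 0 < p -> 0 <= e ->
  ('N_p[f] <= e%:E)%E = (pint p f <= (e `^ p)%:E)%E.
Proof.
move=> p0 e0; apply/idP/idP => h.
  rewrite -Lnorm_powR ?gt_eqF// -poweR_EFin.
  apply: gt0_ler_poweR => //; first exact: ltW.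
    by rewrite in_itv/= leey Lnorm_ge0.
  by rewrite in_itv/= leey andbT lee_fin.
have -> : e%:E = (((e `^ p)%:E) `^ p^-1)%E.
  by rewrite poweR_EFin -powRrM mulfV ?gt_eqF// powRr1.
rewrite LnormE; apply: gt0_ler_poweR => //.
- by rewrite invr_ge0 ltW.
- by rewrite in_itv/= leey pint_ge0.
- by rewrite in_itv/= leey andbT lee_fin powR_ge0.
Qed.

Lemma Lnorm_ltE p f e : 0 < p -> 0 <= e ->
  ('N_p[f] < e%:E)%E = (pint p f < (e `^ p)%:E)%E.
Proof.
move=> p0 e0; apply/idP/idP => h.
  have Nfin : 'N_p[f] \is a fin_num.
    by rewrite ge0_fin_numE ?Lnorm_ge0// (lt_trans h)// ltry.
  rewrite -Lnorm_powR ?gt_eqF// -(fineK Nfin) poweR_EFin lte_fin.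
  rewrite gt0_ltr_powR ?nnegrE// ?fine_ge0 ?Lnorm_ge0//.
  by rewrite -lte_fin fineK.
have Ifin : pint p f \is a fin_num.
  by rewrite ge0_fin_numE ?pint_ge0// (lt_trans h)// ltry.
have -> : e%:E = (((e `^ p)%:E) `^ p^-1)%E.
  by rewrite poweR_EFin -powRrM mulfV ?gt_eqF// powRr1.
rewrite LnormE -(fineK Ifin) !poweR_EFin lte_fin.
rewrite gt0_ltr_powR ?nnegrE ?powR_ge0 ?invr_gt0// ?fine_ge0 ?pint_ge0//.
by rewrite -lte_fin fineK.
Qed.

Lemma Lnorm_fin p f : 0 < p -> (pint p f < +oo)%E -> 'N_p[f] \is a fin_num.
Proof.
move=> p0 h; rewrite ge0_fin_numE ?Lnorm_ge0// LnormE.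
by rewrite poweR_lty.
Qed.

Lemma Lnorm_fin_pint p f : 0 < p -> 'N_p[f] \is a fin_num ->
  pint p f = (fine ('N_p[f]) `^ p)%:E.
Proof. by move=> p0 h; rewrite -Lnorm_powR ?gt_eqF// -{1}(fineK h). Qed.

Lemma le_Lnorm p f g : 0 < p -> measurable_fun setT f -> measurable_fun setT g ->
  (forall x, `|f x| <= `|g x|) -> ('N_p[f] <= 'N_p[g])%E.
Proof.
move=> p0 mf mg fg; rewrite !LnormE; apply: gt0_ler_poweR.
- by rewrite invr_ge0 ltW.
- by rewrite in_itv/= leey pint_ge0.
- by rewrite in_itv/= leey pint_ge0.
apply: ge0_le_integral => //.
- exact: measurable_powR_norm.
- exact: measurable_powR_norm.
- by move=> x _; rewrite lee_fin ge0_ler_powR ?nnegrE ?(ltW p0).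
Qed.

Lemma LnormBC p f g : 'N_p[f \- g] = 'N_p[g \- f].
Proof.
rewrite !LnormE; congr (_ `^ _)%E; apply: eq_integral => x _.
by rewrite /= distrC.
Qed.

Lemma LnormD_le p f g : 1 <= p -> measurable_fun setT f ->
  measurable_fun setT g -> ('N_p[f \+ g] <= 'N_p[f] + 'N_p[g])%E.
Proof. by move=> p1 mf mg; exact: minkowski_EFin. Qed.

Lemma Lnorm_le_dist p f g : 1 <= p -> measurable_fun setT f ->
  measurable_fun setT g -> ('N_p[f] <= 'N_p[g] + 'N_p[f \- g])%E.
Proof.
move=> p1 mf mg.
have -> : 'N_p[f] = 'N_p[g \+ (f \- g)].
  by apply: eq_Lnorm => x /=; rewrite subrKC.
by apply: LnormD_le => //; exact: measurable_funB.
Qed.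

Lemma Lnorm_sum_le p (I : eqType) (s : seq I) (F : I -> T -> R) : 1 <= p ->
  (forall i, measurable_fun setT (F i)) ->
  ('N_p[(fun x => \sum_(i <- s) F i x)] <= \sum_(i <- s) 'N_p[F i])%E.
Proof.
move=> p1 mF; elim: s => [|i s IH].
  rewrite big_nil (@eq_Lnorm _ _ _ _ _ _ (cst 0%E)); last first.
    by move=> x /=; rewrite big_nil.
  by rewrite Lnorm0// eqe gt_eqF// (lt_le_trans ltr01).
rewrite big_cons (@eq_Lnorm _ _ _ _ _ _ (EFin \o (F i \+ fun x => \sum_(i <- s) F i x))).
  apply: (le_trans (LnormD_le p1 _ _)) => //; first exact: measurable_sum.
  exact: leeD2l.
by move=> x /=; rewrite big_cons.
Qed.

Lemma Lnorm_lim_fin p (f_ : nat -> T -> R) f : 1 <= p ->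
  (forall n, measurable_fun setT (f_ n)) -> measurable_fun setT f ->
  (forall n, 'N_p[f_ n] \is a fin_num) ->
  'N_p[f_ n \- f] @[n --> \oo] --> 0%E -> 'N_p[f] \is a fin_num.
Proof.
move=> p1 mf_ mf ffin /(cvge0P (fun n => Lnorm_ge0 _ _ _)) /(_ 1 ltr01) [n _ /(_ n (leqnn n))] h.
rewrite ge0_fin_numE ?Lnorm_ge0//.
apply: (le_lt_trans (Lnorm_le_dist p1 mf (mf_ n))).
apply: lte_add_pinfty; first by rewrite -ge0_fin_numE ?Lnorm_ge0.
by rewrite LnormBC (lt_trans h)// ltry.
Qed.

Lemma Lnorm_cvg p (f_ : nat -> T -> R) f : 1 <= p ->
  (forall n, measurable_fun setT (f_ n)) -> measurable_fun setT f ->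
  'N_p[f] \is a fin_num ->
  'N_p[f_ n \- f] @[n --> \oo] --> 0%E ->
  'N_p[f_ n] @[n --> \oo] --> 'N_p[f].
Proof.
move=> p1 mf_ mf ffin h.
have {}h := (cvge0P (fun n => Lnorm_ge0 _ _ _)).1 h.
rewrite -(fineK ffin); apply/fine_cvgP.
have hfin n e : ('N_p[f_ n \- f] < e%:E)%E -> 'N_p[f_ n] \is a fin_num.
  move=> un; rewrite ge0_fin_numE ?Lnorm_ge0//.
  apply: (le_lt_trans (Lnorm_le_dist p1 (mf_ n) mf)).
  apply: lte_add_pinfty; first by rewrite -ge0_fin_numE ?Lnorm_ge0.
  by rewrite (lt_trans un)// ltry.
split; first by apply: filterS (h 1 ltr01) => n; exact: hfin.
apply/cvgrPdist_lt => e e0; apply: filterS (h e e0) => n un.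
have fn := hfin _ _ un.
have h1 := Lnorm_le_dist p1 (mf_ n) mf.
have h2 := Lnorm_le_dist p1 mf (mf_ n); rewrite LnormBC in h2.
have dfin : 'N_p[f_ n \- f] \is a fin_num.
  by rewrite ge0_fin_numE ?Lnorm_ge0// (lt_trans un)// ltry.
rewrite /= ltr_norml; move: h1 h2 un.
rewrite -(fineK fn) -(fineK ffin) -(fineK dfin) -!EFinD !lee_fin lte_fin /=.
lra.
Qed.

(** Along a fast subsequence g_j the weighted sum of the j-th powers of the
    increments has a finite integral, so that the increments are almost
    everywhere bounded by a geometric sequence. *)
Lemma fast_cauchy_ae_cvg p (g : nat -> T -> R) : 0 < p ->
  (forall j, measurable_fun setT (g j)) ->
  (forall j, pint p (g j.+1 \- g j) <= ((4^-1 ^+ j) `^ p * 2^-1 ^+ j.+1)%:E)%E ->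
  {ae mu, forall x, cvgn (g ^~ x)}.
Proof.
move=> p0 mg hg.
pose h j x := ((`|g j.+1 x - g j x| * 2 ^+ j) `^ p)%:E.
have mh j : measurable_fun setT (h j).
  apply/measurable_EFinP.
  apply: (@measurableT_comp _ _ _ _ _ _ (@powR R ^~ p)) => //.
  apply: measurable_funM => //; apply: measurableT_comp => //.
  exact: measurable_funB.
have h0 j x : (0 <= h j x)%E by rewrite lee_fin powR_ge0.
have ih j : (\int[mu]_x h j x <= (1 / 2 ^+ j.+1)%:E)%E.
  have -> : (\int[mu]_x h j x = ((2 ^+ j) `^ p)%:E * pint p (g j.+1 \- g j))%E.
    rewrite -ge0_integralZl//; last first.
      by apply: (@measurable_powR_norm p (g j.+1 \- g j)); exact: measurable_funB.
    by apply: eq_integral => x _; rewrite /h -EFinM powRM ?exprn_ge0// mulrC.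
  apply: (le_trans (lee_pmul _ _ (lexx _) (hg j))).
  - by rewrite lee_fin powR_ge0.
  - exact: pint_ge0.
  rewrite -EFinM lee_fin mulrA -powRM ?exprn_ge0//.
  rewrite -exprMn exprVn mul1r -[leRHS]mul1r ler_wpM2r ?invr_ge0 ?exprn_ge0//.
  rewrite -[leRHS](congr1 (@^~ p) (powR1 R)) ge0_ler_powR ?nnegrE ?exprn_ge0 ?(ltW p0)//.
  by rewrite exprn_ile1//; lra.
have hfin : (\int[mu]_x (\sum_(j <oo) h j x) < +oo)%E.
  rewrite integral_nneseries//.
  apply: (@le_lt_trans _ _ (\sum_(j <oo) (1 / (2 ^+ j.+1))%:E)%E).
    by apply: lee_nneseries => [j _ _|j _]; [exact: integral_ge0|exact: ih].
  under eq_eseriesr do rewrite -natrX.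
  exact: (le_lt_trans (epsilon_trick0 _ ler01) (ltry _)).
have mS : measurable_fun setT (fun x => \sum_(j <oo) h j x)%E.
  by apply: ge0_emeasurable_sum => // j x _ _.
have iS : mu.-integrable setT (fun x => \sum_(j <oo) h j x)%E.
  apply/integrableP; split => //.
  by under eq_integral do rewrite gee0_abs ?nneseries_ge0//.
have := integrable_ae measurableT iS.
apply: filterS => x /(_ Logic.I) Sfin.

have hC j : `|g j.+1 x - g j x| <= (fine (\sum_(j <oo) h j x)%E) `^ p^-1 * 2^-1 ^+ j.
  rewrite exprVn ler_pdivlMr ?exprn_gt0//.
  set a := _ * _; have a0 : 0 <= a by rewrite mulr_ge0// exprn_ge0.
  have -> : a = (a `^ p) `^ p^-1 by rewrite -powRrM mulfV ?gt_eqF// powRr1.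
  rewrite ge0_ler_powR ?nnegrE ?powR_ge0 ?invr_ge0 ?(ltW p0)//.
    by rewrite fine_ge0// nneseries_ge0.
  rewrite -lee_fin fineK//.
  rewrite (nneseriesD1 (n := j))//.
  by rewrite leeDl// nneseries_ge0.
set K := _ `^ _ in hC.
have sK : cvgn (series (fun j => K * 2^-1 ^+ j)).
  by apply: is_cvg_geometric_series; rewrite ger0_norm ?invr_ge0// invf_lt1// ltr1n.
have : cvgn (series (fun j => g j.+1 x - g j x)).
  apply: normed_cvg; apply: series_le_cvg sK => //.
    by move=> j /=.
  by move=> j; rewrite mulr_ge0 ?powR_ge0// exprn_ge0// invr_ge0.
move=> /cvg_ex[l hl]; apply/cvg_ex; exists (g 0%N x + l).
have -> : g ^~ x = (fun n => g 0%N x + series (fun j => g j.+1 x - g j x) n).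
  by apply/funext => n; rewrite /series/= telescope_sumr// subrKC.
by apply: cvgD => //; exact: cvg_cst.
Qed.

(** The limit is the pointwise limit of a fast subsequence; the upper limit makes
    it measurable everywhere, and Fatou's lemma controls the distance to it. *)
Lemma Lnorm_complete p (f_ : nat -> T -> R) : 1 <= p ->
  (forall n, measurable_fun setT (f_ n)) ->
  (forall e : R, 0 < e -> exists n0, forall m n, (n0 <= m)%N -> (n0 <= n)%N ->
    ('N_p[f_ m \- f_ n] < e%:E)%E) ->
  exists2 f, measurable_fun setT f & 'N_p[f_ n \- f] @[n --> \oo] --> 0%E.
Proof.
move=> p1 mf_ cf; have p0 : 0 < p by lra.
(* the p-th power of this threshold is the bound required of a fast
   subsequence *)
pose ev (j : nat) : R := 4^-1 ^+ j * (2^-1 ^+ j.+1) `^ p^-1.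
have ev0 j : 0 < ev j by rewrite mulr_gt0 ?powR_gt0 ?exprn_gt0.
have {}cf' j := cid (cf _ (ev0 j)).
pose K := fix K j := if j is i.+1 then maxn (K i).+1 (projT1 (cf' j)) else projT1 (cf' 0%N).
have K1 j : (projT1 (cf' j) <= K j)%N by case: j => //= j; rewrite leq_maxr.
have K2 j : (K j <= K j.+1)%N by rewrite /= leq_max leqnSn.
have K3 j : (j <= K j)%N.
  by elim: j => // j IH; rewrite /= leq_max ltnS IH.

pose g j := f_ (K j).
have gK j n : (K j <= n)%N -> ('N_p[f_ n \- g j] < (ev j)%:E)%E.
  move=> jn; apply: (projT2 (cf' j)); last exact: K1.
  exact: leq_trans (K1 j) jn.
have cE (u : nat -> R) l : u @ \oo --> l -> (u n)%:E @[n --> \oo] --> l%:E.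
  by move=> ul; apply: cvg_EFin => //; exact: nearW.
have gae : {ae mu, forall x, cvgn (g ^~ x)}.
  apply: (@fast_cauchy_ae_cvg p) => // j.
    exact: mf_.
  have := ltW (gK j _ (K2 j)); rewrite (Lnorm_leE _ p0 (ltW (ev0 j))).
  by rewrite /ev powRM ?exprn_ge0 ?powR_ge0// -powRrM mulVf ?gt_eqF// powRr1 ?exprn_ge0.
pose f x := fine (limn_esup (fun j => (g j x)%:E)).
have mf : measurable_fun setT f.
  apply: (measurableT_comp (f := fine)) => //.
  apply: measurable_fun_limn_esup => j; apply/measurable_EFinP; exact: mf_.
exists f => //; apply/cvge0P => [n|e e0]; first exact: Lnorm_ge0.
have e20 : 0 < e / 2 by lra.
have [n0 hn0] := cf _ e20.
exists n0 => // n /= n0n.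
suff : ('N_p[f_ n \- f] <= (e / 2)%:E)%E.
  by move=> /le_lt_trans; apply; rewrite lte_fin; lra.
rewrite Lnorm_leE//; last lra.
pose F j x := (`|f_ n x - g j x| `^ p)%:E.
have F0 j x : (0 <= F j x)%E by rewrite lee_fin powR_ge0.
have mF j : measurable_fun setT (F j).
  by apply: (@measurable_powR_norm p (f_ n \- g j)); apply: measurable_funB; exact: mf_.
have -> : (pint p (f_ n \- f) = \int[mu]_x limn_einf (F^~ x))%E.
  apply: ge0_ae_eq_integral => //.
  - by apply: (@measurable_powR_norm p (f_ n \- f)); exact: measurable_funB.
  - apply: measurableT_comp => //.
    by apply: measurable_fun_limn_esup => j; exact: measurableT_comp.
  - move=> x _; rewrite limn_einf_lim; apply: lime_ge; first exact: is_cvg_einfs.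
    by apply: nearW => k; apply: le_ereal_inf_tmp => _ [i _ <-]; exact: F0.
  apply: filterS gae => x gx _.
  have fx : f x = limn (g ^~ x).
    have hg := cE _ _ gx.
    rewrite /f is_cvg_limn_esupE; last by apply/cvg_ex; eexists; exact: hg.
    by rewrite (cvg_lim _ hg).
  have hF : F^~ x @ \oo --> (`|f_ n x - f x| `^ p)%:E.
    apply: (cE (fun j => `|f_ n x - g j x| `^ p)).
    apply: (@cvg_comp _ _ _ (fun j => f_ n x - g j x) (fun y => `|y| `^ p)); last first.
      exact: (normr_powR_continuous p0).
    by apply: cvgB; [exact: cvg_cst|rewrite fx].
  by rewrite is_cvg_limn_einfE; [rewrite (cvg_lim _ hF)|apply/cvg_ex; eexists; exact: hF].
apply: (le_trans (fatou mu measurableT mF (fun j x _ => F0 j x))).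
rewrite limn_einf_lim; apply: lime_le; first exact: is_cvg_einfs.
apply: nearW => k; apply: ereal_inf_le.
exists (\int[mu]_x F (maxn k n0) x)%E.
  by exists (maxn k n0) => //=; rewrite leq_maxl.
rewrite -[leLHS]/(pint p (f_ n \- g (maxn k n0))) -Lnorm_leE//; last lra.
by apply/ltW/hn0 => //; rewrite (leq_trans (leq_maxr k _))// K3.
Unshelve. all: by end_near. Qed.

Section vector.
Context {N : nat}.
Implicit Types G : T -> 'rV[R]_N.

(** Componentwise: the Euclidean norm is squeezed between the largest coordinate
    and their sum. *)
Lemma vLnorm_complete p (G_ : nat -> T -> 'rV[R]_N) : 1 <= p ->
  (forall n, measurable_fun setT (G_ n)) ->
  (forall e : R, 0 < e -> exists n0, forall m n, (n0 <= m)%N -> (n0 <= n)%N ->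
    ('N_p[(fun x => enorm (G_ m x - G_ n x))] < e%:E)%E) ->
  exists2 G : T -> 'rV[R]_N, measurable_fun setT G &
    'N_p[(fun x => enorm (G_ n x - G x))] @[n --> \oo] --> 0%E.
Proof.
move=> p1 mG cG; have p0 : 0 < p by lra.
have mGi n i : measurable_fun setT (fun x => G_ n x 0 i).
  exact: measurable_fun_coord.
have mdist G G' : measurable_fun setT G -> measurable_fun setT G' ->
    measurable_fun setT (fun x => enorm (G x - G' x)).
  move=> mG1 mG2; apply: measurable_enorm; apply: measurable_fun_rV => i.
  under eq_fun do rewrite !mxE.
  by apply: measurable_funB; exact: measurable_fun_coord.
have H i : {f : T -> R | measurable_fun setT f &
    'N_p[(fun x => G_ n x 0 i) \- f] @[n --> \oo] --> 0%E}.
  apply: cid2; apply: Lnorm_complete => // e e0.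
  have [n0 hn0] := cG e e0; exists n0 => m n m0 n0'.
  apply: le_lt_trans (hn0 m n m0 n0').
  apply: le_Lnorm => //; first exact: measurable_funB.
    exact: mdist.
  move=> x /=; rewrite [leRHS]ger0_norm ?enorm_ge0//.
  by have := normr_coord_le (G_ m x - G_ n x) i; rewrite !mxE.
pose F i := s2val (H i); have mF i : measurable_fun setT (F i) := s2valP (H i).
have cF i : 'N_p[(fun x => G_ n x 0 i) \- F i] @[n --> \oo] --> 0%E := s2valP' (H i).
pose G x : 'rV[R]_N := \row_i F i x.
have mGG : measurable_fun setT G.
  apply: measurable_fun_rV => i.
  by rewrite (_ : (fun x => _) = F i)//; apply/funext => x; rewrite mxE.
exists G => //.
apply: (@squeeze_cvge _ _ _ _ (cst 0%E) _
  (fun n => \sum_(i <- index_enum 'I_N) 'N_p[(fun x => `|G_ n x 0 i - F i x|)])%E).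
- apply: nearW => n; rewrite Lnorm_ge0/=.
  apply: (le_trans _ (Lnorm_sum_le _ p1 _)) => [|i]; last first.
    by apply: measurableT_comp => //; exact: measurable_funB.
  apply: le_Lnorm => //; first exact: mdist.
    apply: measurable_sum => i.
    by apply: measurableT_comp => //; exact: measurable_funB.
  move=> x; rewrite ger0_norm ?enorm_ge0// ger0_norm ?sumr_ge0//.
  apply: (le_trans (enorm_le_sum _)); apply: ler_sum => i _.
  by rewrite !mxE.
- exact: cvg_cst.
- elim: (index_enum _) => [|i s IH].
    by under eq_fun do rewrite big_nil; exact: cvg_cst.
  under eq_fun do rewrite big_cons.
  have h1 : 'N_p[(fun x => `|G_ n x 0 i - F i x|)] @[n --> \oo] --> 0%E.
    suff -> : (fun n => 'N_p[(fun x => `|G_ n x 0 i - F i x|)]) =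
      (fun n => 'N_p[(fun x => G_ n x 0 i) \- F i]) by exact: cF.
    apply/funext => n; rewrite !LnormE; congr (_ `^ _)%E.
    by apply: eq_integral => x _; rewrite /= normr_id.
  have := cvgeD _ h1 IH; rewrite adde0; exact.
Qed.

Lemma vLnorm_distl p G G' : 0 < p -> measurable_fun setT G ->
  measurable_fun setT G' ->
  ('N_p[(fun x => enorm (G x)) \- (fun x => enorm (G' x))] <=
   'N_p[(fun x => enorm (G x - G' x))])%E.
Proof.
move=> p0 mG mG'.
have mi (K : T -> 'rV[R]_N) i : measurable_fun setT K -> measurable_fun setT (fun x => K x 0 i).
  exact: measurable_fun_coord.
apply: le_Lnorm => //.
- by apply: measurable_funB; exact: measurable_enorm.
- apply: measurable_enorm; apply: measurable_fun_rV => i.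
  under eq_fun do rewrite !mxE.
  by apply: measurable_funB; exact: mi.
- move=> x /=; rewrite [leRHS]ger0_norm ?enorm_ge0//; exact: enorm_lipschitz.
Qed.

Lemma vLnorm_cvg p (G_ : nat -> T -> 'rV[R]_N) G : 1 <= p ->
  (forall n, measurable_fun setT (G_ n)) -> measurable_fun setT G ->
  (forall n, 'N_p[(fun x => enorm (G_ n x))] \is a fin_num) ->
  'N_p[(fun x => enorm (G_ n x - G x))] @[n --> \oo] --> 0%E ->
  'N_p[(fun x => enorm (G x))] \is a fin_num /\
  'N_p[(fun x => enorm (G_ n x))] @[n --> \oo] --> 'N_p[(fun x => enorm (G x))].
Proof.
move=> p1 mG_ mG fG h; have p0 : 0 < p by lra.
have mE_ n : measurable_fun setT (fun x => enorm (G_ n x)).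
  exact: measurable_enorm.
have mE : measurable_fun setT (fun x => enorm (G x)) by exact: measurable_enorm.
have cE : 'N_p[(fun x => enorm (G_ n x)) \- (fun x => enorm (G x))]
    @[n --> \oo] --> 0%E.
  apply: (@squeeze_cvge _ _ _ _ (cst 0%E) _
    (fun n => 'N_p[(fun x => enorm (G_ n x - G x))])) => //; last exact: cvg_cst.
  by apply: nearW => n; rewrite Lnorm_ge0 vLnorm_distl.
have fin : 'N_p[(fun x => enorm (G x))] \is a fin_num by exact: (Lnorm_lim_fin p1 mE_ mE).
by split => //; exact: (Lnorm_cvg p1 mE_ mE).
Qed.

End vector.
End Lp.

(** * The inequalities of Rellich and Poincare *)

(** ** One-dimensional inequalities *)
Section one_dim.
Context {R : realType}.
Local Notation leb := (@lebesgue_measure R).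
Implicit Types (g m : R -> R) (a b s t h : R).

Lemma cont_int_itv g a b : continuous g ->
  leb.-integrable `[a, b] (EFin \o g).
Proof.
move=> cg; apply: continuous_compact_integrable; first exact: segment_compact.
exact: continuous_subspaceT.
Qed.

Lemma FTC_osc g a b s t : (forall u, derivable g u 1) ->
  continuous (derive1 g) -> s \in `[a, b] -> t \in `[a, b] ->
  (`|g s - g t|%:E <= \int[leb]_(u in `[a, b]) `|derive1 g u|%:E)%E.
Proof.
move=> dg cg'.
wlog st : s t / s <= t.
  move=> h; have [|/ltW] := leP s t; first exact: h.
  by move=> ts sab tab; rewrite distrC; exact: h.
rewrite !in_itv/= => /andP[as_ sb] /andP[at_ tb].
have mg' : measurable_fun setT (fun u => `|derive1 g u|%:E).
  apply/measurable_EFinP; apply: measurableT_comp => //.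
  exact: continuous_measurable_fun.
move: st; rewrite le_eqVlt => /predU1P[->|st].
  by rewrite subrr normr0; apply: integral_ge0 => u _; rewrite lee_fin.
have cg : continuous g.
  by move=> u; apply: differentiable_continuous; apply/derivable1_diffP.
have := @continuous_FTC2 R (derive1 g) g s t st (continuous_subspaceT cg').
have dLR : derivable_oo_LRcontinuous g s t.
  split; first by move=> u _; exact: dg.
    by apply: cvg_at_right_filter; exact: cg.
  by apply: cvg_at_left_filter; exact: cg.
move=> /(_ dLR (fun _ _ => erefl)) FTC.
rewrite distrC -abse_EFin EFinB -FTC.
apply: (le_trans (le_abse_integral _ _ _)) => //.
  by apply/measurable_EFinP; apply: measurable_funTS; exact: continuous_measurable_fun.
apply: ge0_subset_integral => //.
- exact: measurable_funTS.
- by apply: subset_itv; rewrite bnd_simp.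
Qed.

(** Integrate the tangent inequality at the mean value c. *)
Lemma jensen_itv g a b p : 1 < p -> a < b -> continuous g ->
  (((\int[leb]_(u in `[a, b]) `|g u|) `^ p)%:E <=
   ((b - a) `^ (p - 1))%:E * \int[leb]_(u in `[a, b]) (`|g u| `^ p)%:E)%E.
Proof.
move=> p1 ab cg; have p0 : 0 < p by lra.
have cng : continuous (fun u => `|g u|).
  move=> u; apply: (@continuous_comp _ _ _ g (fun x => `|x|)) => //.
    exact: cg.
  exact: norm_continuous.
have cngp : continuous (fun u => `|g u| `^ p).
  move=> u; apply: (@continuous_comp _ _ _ g (fun x => `|x| `^ p)) => //.
    exact: cg.
  exact: normr_powR_continuous.
have ba : 0 < b - a by lra.
pose I := \int[leb]_(u in `[a, b]) `|g u|.
have I0 : 0 <= I by apply: Rintegral_ge0.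
pose c := I / (b - a).
have c0 : 0 <= c by rewrite divr_ge0// ltW.
have EI : (\int[leb]_(u in `[a, b]) `|g u|%:E = I%:E)%E.
  rewrite /I /Rintegral fineK//.
  exact: (integrable_fin_num _ (cont_int_itv a b cng)).
have mu_ab : (leb `[a, b] = (b - a)%:E)%E.
  by rewrite lebesgue_measure_itv/= lte_fin ab -EFinB.
have icst k : leb.-integrable `[a, b] (EFin \o (fun=> k)).
  by apply: cont_int_itv => u; exact: cvg_cst.
have vcst k : (\int[leb]_(u in `[a, b]) k%:E = (k * (b - a))%:E)%E.
  transitivity (k%:E * leb `[a, b])%E; first by rewrite integral_cst.
  by rewrite mu_ab -EFinM.
have key : (((b - a) * c `^ p)%:E <= \int[leb]_(u in `[a, b]) (`|g u| `^ p)%:E)%E.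
  have -> : ((b - a) * c `^ p)%:E =
      (\int[leb]_(u in `[a, b]) (c `^ p + p * c `^ (p - 1) * (`|g u| - c))%:E)%E.
    under eq_integral do rewrite EFinD EFinM EFinB.
    have i2 : leb.-integrable `[a, b] (fun u => (`|g u|%:E - c%:E)%E).
      by apply: integrableB => //; [exact: (cont_int_itv a b cng)|exact: icst].
    rewrite integralD//; [|exact: icst|]; last exact: integrableZl.
    rewrite integralZl// integralB//; [|exact: (cont_int_itv a b cng)|exact: icst].
    rewrite !vcst EI -EFinB -EFinM -EFinD.
    by rewrite /c divfK ?gt_eqF// subrr mulr0 addr0 mulrC.
  apply: le_integral => //.
  - have : leb.-integrable `[a, b] (EFin \o (fun u => c `^ p + p * c `^ (p - 1) * (`|g u| - c))).
      apply: cont_int_itv => u; apply: cvgD; first exact: cvg_cst.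
      by apply: cvgMr; apply: cvgB; [exact: cng|exact: cvg_cst].
    exact.
  - exact: (cont_int_itv a b cngp).
  - by move=> u _; rewrite lee_fin powR_tangent.
have -> : (I `^ p)%:E = (((b - a) `^ (p - 1))%:E * ((b - a) * c `^ p)%:E)%E.
  rewrite -EFinM; congr EFin; rewrite mulrA [_ `^ _ * _]mulrC mulr_powRB1 ?(ltW ba)//.
  by rewrite -powRM ?(ltW ba)// mulrC divfK// gt_eqF.
by apply: lee_wpmul2l => //; rewrite lee_fin powR_ge0.
Qed.

(** A function of constant sign has the same L^1 norm as its mean; a function
    which changes sign is bounded by its oscillation. *)
Lemma integral_norm_le_osc (D : set R) m (B : \bar R) (h : R) :
  measurable D -> measurable_fun D m -> (leb D <= h%:E)%E -> 0 <= h ->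
  (0 <= B)%E ->
  (forall s t, D s -> D t -> (`|m s - m t|%:E <= B)%E) ->
  (\int[leb]_(u in D) `|m u|%:E <=
   h%:E * B + `|\int[leb]_(u in D) (m u)%:E|)%E.
Proof.
move=> mD mm Dh h0 B0 osc.
have hB0 : (0 <= h%:E * B)%E by rewrite mule_ge0.
have [pos|/existsNP[s /not_implyP[Ds /negP]]] := pselect (forall u, D u -> 0 <= m u).
  have -> : (\int[leb]_(u in D) `|m u|%:E = `|\int[leb]_(u in D) (m u)%:E|)%E.
    rewrite gee0_abs; last by apply: integral_ge0 => u Du; rewrite lee_fin pos.
    by apply: eq_integral => u; rewrite inE => Du; rewrite ger0_norm// pos.
  by rewrite leeDr.
rewrite -ltNge => ms.
have [neg|/existsNP[t /not_implyP[Dt /negP]]] := pselect (forall u, D u -> m u <= 0).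
  have -> : (\int[leb]_(u in D) `|m u|%:E = `|\int[leb]_(u in D) (m u)%:E|)%E.
    have -> : (\int[leb]_(u in D) (m u)%:E = \int[leb]_(u in D) (- `|m u|%:E))%E.
      apply: eq_integral => u; rewrite inE => Du.
      by rewrite -EFinN ler0_norm ?neg// opprK.
    rewrite integral_ge0N; last by move=> u _; rewrite lee_fin.
    by rewrite abseN gee0_abs//; apply: integral_ge0 => u _; rewrite lee_fin.
  by rewrite leeDr.
rewrite -ltNge => mt.
apply: (@le_trans _ _ (\int[leb]_(u in D) (cst B u))%E).
  apply: ge0_le_integral => //.
  - by apply/measurable_EFinP; apply: measurableT_comp.
  - move=> u Du; have [mu0|mu0] := leP 0 (m u).
      apply: le_trans (osc u s Du Ds); rewrite lee_fin ger0_norm//.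
      by rewrite (le_trans _ (ler_norm _))//; lra.
    apply: le_trans (osc t u Dt Du); rewrite lee_fin ltr0_norm//.
    by rewrite (le_trans _ (ler_norm _))//; lra.
rewrite integral_cst// [leLHS]muleC.
apply: (@le_trans _ _ (h%:E * B)%E); first by apply: lee_wpmul2r.
by rewrite leeDl.
Qed.

(** On each interval of length h of the grid the oscillation of m is at most the
    integral of beta there. *)
Lemma integral_norm_le_osc_grid m (beta : R -> \bar R) h a J :
  0 < h -> measurable_fun setT m -> measurable_fun setT beta ->
  (forall u, (0 <= beta u)%E) ->
  (forall s t, s <= t -> (`|m s - m t|%:E <= \int[leb]_(u in `[s, t]) beta u)%E) ->
  (\int[leb]_(u in `[a, (a + J%:R * h)%R[) `|m u|%:E <=
   h%:E * \int[leb]_(u in `[a, (a + J%:R * h)%R[) beta u +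
   \sum_(j <- iota 0 J) `|\int[leb]_(u in `[(a + j%:R * h)%R, (a + j.+1%:R * h)%R[) (m u)%:E|)%E.
Proof.
move=> h0 mm mb b0 osc; elim: J => [|J IH].
  by rewrite mul0r addr0 set_itvco0 !integral_set0 big_nil mule0 adde0.
set c := a + J%:R * h; set d := a + J.+1%:R * h.
have cd : d = c + h by rewrite /c /d -natr1; ring.
have ac : a <= c by rewrite lerDl mulr_ge0// ltW.
have split_itv (F : R -> \bar R) : measurable_fun setT F -> (forall u, 0 <= F u)%E ->
    (\int[leb]_(u in `[a, d[) F u =
     \int[leb]_(u in `[a, c[) F u + \int[leb]_(u in `[c, d[) F u)%E.
  move=> mF F0; rewrite (@itv_bndbnd_setU _ _ _ (BLeft c)) ?bnd_simp//; last first.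
    by rewrite cd lerDl ltW.
  rewrite ge0_integral_setU//.
    exact: measurable_funTS.
  apply/disj_setPS => u /=; rewrite !in_itv/= => -[/andP[_ uc] /andP[cu _]].
  by move: (lt_le_trans uc cu); rewrite ltxx.
have mnm : measurable_fun setT (fun u => `|m u|%:E).
  by apply/measurable_EFinP; apply: measurableT_comp.
rewrite !split_itv//.
have last_ := @integral_norm_le_osc `[c, d[%classic m
  (\int[leb]_(u in `[c, d[) beta u)%E h.
have {last_} Hl : (\int[leb]_(u in `[c, d[) `|m u|%:E <=
   h%:E * \int[leb]_(u in `[c, d[) beta u + `|\int[leb]_(u in `[c, d[) (m u)%:E|)%E.
  apply: last_ => //.
  - exact: measurable_funTS.
  - rewrite lebesgue_measure_itv/= lte_fin cd ltrDl h0 -EFinB lee_fin.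
    by rewrite addrAC subrr add0r.
  - exact: ltW.
  - by apply: integral_ge0.
  - move=> s t; wlog st : s t / s <= t.
      move=> H Ds Dt; have [st|/ltW ts] := leP s t; first exact: H.
      by rewrite distrC; exact: H.
    rewrite /= !in_itv/= => /andP[cs sd] /andP[ct td].
    apply: (le_trans (osc s t st)); apply: ge0_subset_integral => //.
      exact: measurable_funTS.
    move=> u /=; rewrite !in_itv/= => /andP[su ut].
    by rewrite (le_trans cs su) (le_lt_trans ut td).
rewrite -[in iota 0 J.+1]addn1 iotaD big_cat/= big_seq1 add0n -/d -/c.
rewrite ge0_muleDr; [|exact: integral_ge0|exact: integral_ge0].
have leeDACA (x y x1 x2 y1 y2 : \bar R) : (x <= x1 + x2)%E -> (y <= y1 + y2)%E ->
    (x + y <= (x1 + y1) + (x2 + y2))%E.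
  by move=> hx hy; rewrite addeACA; exact: leeD.
exact: leeDACA IH Hl.
Qed.

End one_dim.

(** ** Slices of functions of class C1 *)
Definition C1 {R : realType} {n : nat} (f : 'rV[R]_n -> R) : Prop :=
  continuous f /\ forall i, (forall x, derivable f x (delta_mx 0 i)) /\
    continuous (partial_deriv i f).

Definition rcons_set {R : realType} {n : nat} (A : set 'rV[R]_n) (I : set R) :
    set 'rV[R]_n.+1 :=
  [set y | A (belast_rV y) /\ I (y 0 ord_max)].

Section slices_C1.
Context {R : realType} {n : nat}.
Local Notation leb := (@lebesgue_measure R).
Implicit Types (f : 'rV[R]_n.+1 -> R) (x : 'rV[R]_n) (t : R).

Lemma belast_rcons_rV x t : belast_rV (rcons_rV (x, t)) = x.
Proof. by apply/rowP => j; rewrite mxE rcons_rV_lift. Qed.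

Lemma rcons_rV_addl x t h (i : 'I_n) :
  rcons_rV (h *: delta_mx 0 i + x, t) =
  h *: delta_mx 0 (lift ord_max i) + rcons_rV (x, t).
Proof.
apply/rowP => k; case: (unliftP ord_max k) => [j ->|->].
  rewrite rcons_rV_lift !mxE liftK /=; congr (_ * _%:R + _).
  by rewrite (inj_eq lift_inj).
by rewrite rcons_rV_max !mxE unlift_none /= eq_liftF mulr0 add0r.
Qed.

Lemma rcons_rV_addr x t h :
  rcons_rV (x, h + t) = h *: delta_mx 0 ord_max + rcons_rV (x, t).
Proof.
apply/rowP => k; case: (unliftP ord_max k) => [j ->|->].
  by rewrite rcons_rV_lift !mxE liftK /= lift_eqF mulr0 add0r.
by rewrite rcons_rV_max !mxE unlift_none /= !eqxx mulr1.
Qed.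

(** Fixing the last coordinate leaves the difference quotients in the other
    directions unchanged, so derivability transfers with the same value. *)
Lemma slice_quotient f x t (i : 'I_n) :
  (fun h : R => h^-1 *: (((fun z => f (rcons_rV (z, t))) \o shift x)
     (h *: delta_mx 0 i) - f (rcons_rV (x, t)))) =
  (fun h : R => h^-1 *: ((f \o shift (rcons_rV (x, t)))
     (h *: delta_mx 0 (lift ord_max i)) - f (rcons_rV (x, t)))).
Proof. by apply/funext => h /=; rewrite rcons_rV_addl. Qed.

Lemma slice_partial_deriv f t (i : 'I_n) :
  partial_deriv i (fun z => f (rcons_rV (z, t))) =
  (fun z => partial_deriv (lift ord_max i) f (rcons_rV (z, t))).
Proof.
by apply/funext => x; rewrite /partial_deriv /derive slice_quotient.
Qed.

Lemma C1_slice f t : C1 f -> C1 (fun z => f (rcons_rV (z, t))).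
Proof.
move=> [cf df]; split.
  move=> x; apply: (@continuous_comp _ _ _ (fun z => rcons_rV (z, t)) f).
    exact: rcons_rV_continuousl.
  exact: cf.
move=> i; have [d c] := df (lift ord_max i); split.
  by move=> x; rewrite /derivable slice_quotient; exact: d.
rewrite slice_partial_deriv => x.
apply: (@continuous_comp _ _ _ (fun z => rcons_rV (z, t))
  (partial_deriv (lift ord_max i) f)).
  exact: rcons_rV_continuousl.
exact: c.
Qed.

Lemma fiber_quotient f x t :
  (fun h : R => h^-1 *: (((fun s => f (rcons_rV (x, s))) \o shift t) (h *: 1) -
     f (rcons_rV (x, t)))) =
  (fun h : R => h^-1 *: ((f \o shift (rcons_rV (x, t)))
     (h *: delta_mx 0 ord_max) - f (rcons_rV (x, t)))).
Proof.
by apply/funext => h /=; rewrite -rcons_rV_addr /GRing.scale/= mulr1.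
Qed.

Lemma derivable_fiber f x t : C1 f -> derivable (fun s => f (rcons_rV (x, s))) t 1.
Proof.
move=> [_ df]; rewrite /derivable fiber_quotient.
by have [d _] := df ord_max; exact: d.
Qed.

Lemma derive1_fiber f x : derive1 (fun s => f (rcons_rV (x, s))) =
  (fun s => partial_deriv ord_max f (rcons_rV (x, s))).
Proof.
by apply/funext => t; rewrite derive1E /partial_deriv /derive fiber_quotient.
Qed.

Lemma continuous_fiber f x : continuous f -> continuous (fun s => f (rcons_rV (x, s))).
Proof.
move=> cf t; apply: (@continuous_comp _ _ _ (fun z => rcons_rV (x, z)) f).
  exact: rcons_rV_continuousr.
exact: cf.
Qed.

Lemma fiber_osc f x s t : C1 f -> s <= t ->
  (`|f (rcons_rV (x, s)) - f (rcons_rV (x, t))|%:E <=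
   \int[leb]_(u in `[s, t]) `|partial_deriv ord_max f (rcons_rV (x, u))|%:E)%E.
Proof.
move=> Cf st; have := @FTC_osc R (fun u => f (rcons_rV (x, u))) s t s t.
rewrite derive1_fiber; apply.
- by move=> u; exact: derivable_fiber.
- by apply: continuous_fiber; case: Cf => _ /(_ ord_max)[].
- by rewrite in_itv/= lexx st.
- by rewrite in_itv/= lexx st.
Qed.

Lemma rcons_set_measurable (A : set 'rV[R]_n) (I : set R) :
  measurable A -> measurable (I : set (measurableTypeR R)) ->
  measurable (rcons_set A I).
Proof.
move=> mA mI.
have -> : rcons_set A I = (@belast_rV R n @^-1` A) `&`
    ((fun y : 'rV[R]_n.+1 => y 0 ord_max) @^-1` I) by [].
apply: measurableI.
  rewrite -[X in measurable X]setTI.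
  suff : measurable_fun setT (@belast_rV R n) by apply.
  apply: measurable_fun_rV => i; under eq_fun do rewrite mxE.
  exact: measurable_coord.
rewrite -[X in measurable X]setTI.
exact: (measurable_coord ord_max measurableT mI).
Qed.

Lemma patch_rcons_set (F : 'rV[R]_n.+1 -> \bar R) (A : set 'rV[R]_n) (I : set R) x t :
  (F \_ (rcons_set A I)) (rcons_rV (x, t)) =
  if (x \in A) && (t \in I) then F (rcons_rV (x, t)) else 0%E.
Proof.
rewrite patchE; have -> // : (rcons_rV (x, t) \in rcons_set A I) = (x \in A) && (t \in I).
apply/idP/idP; rewrite ?inE /rcons_set/= belast_rcons_rV rcons_rV_max.
  by move=> [xA tI]; rewrite !mem_set.
by move=> /andP[/set_mem xA /set_mem tI].
Qed.

Section tonelli_sets.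
Variables (F : 'rV[R]_n.+1 -> \bar R) (A : set 'rV[R]_n) (I : set R).
Hypotheses (mF : measurable_fun setT F) (F0 : forall y, (0 <= F y)%E).
Hypotheses (mA : measurable A) (mI : measurable (I : set (measurableTypeR R))).

Let mFA : measurable_fun setT (F \_ (rcons_set A I)).
Proof.
apply/(measurable_restrictT _ _).1; first exact: rcons_set_measurable.
exact: measurable_funTS.
Qed.

Let FA0 y : (0 <= (F \_ (rcons_set A I)) y)%E.
Proof. by rewrite patchE; case: ifP. Qed.

Lemma integral_rcons_set :
  (\int[@lebesgue_rV R n.+1]_(y in rcons_set A I) F y =
   \int[@lebesgue_rV R n]_(x in A) \int[leb]_(t in I) F (rcons_rV (x, t)))%E.
Proof.
rewrite integral_mkcond integral_rcons_rV// [RHS]integral_mkcond.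
apply: eq_integral => x _; rewrite patchE; case: ifPn => xA.
  rewrite [RHS]integral_mkcond; apply: eq_integral => t _.
  by rewrite patch_rcons_set xA patchE.
by apply: integral0_eq => t _; rewrite patch_rcons_set (negbTE xA).
Qed.

Lemma integral_rcons_set_swap :
  (\int[@lebesgue_rV R n.+1]_(y in rcons_set A I) F y =
   \int[leb]_(t in I) \int[@lebesgue_rV R n]_(x in A) F (rcons_rV (x, t)))%E.
Proof.
rewrite integral_mkcond integral_rcons_rV_swap// [RHS]integral_mkcond.
apply: eq_integral => t _; rewrite patchE; case: ifPn => tI.
  rewrite [RHS]integral_mkcond; apply: eq_integral => x _.
  by rewrite patch_rcons_set tI andbT patchE.
by apply: integral0_eq => x _; rewrite patch_rcons_set (negbTE tI) andbF.
Qed.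

End tonelli_sets.

Lemma measurable_integral_slice (F : 'rV[R]_n.+1 -> \bar R) (A : set 'rV[R]_n) :
  measurable_fun setT F -> (forall y, (0 <= F y)%E) -> measurable A ->
  measurable_fun [set: measurableTypeR R]
    (fun t => \int[@lebesgue_rV R n]_(x in A) F (rcons_rV (x, t)))%E.
Proof.
move=> mF F0 mA.
have -> : (fun t => \int[@lebesgue_rV R n]_(x in A) F (rcons_rV (x, t)))%E =
    (fun t => \int[@lebesgue_rV R n]_x (F \_ (rcons_set A setT)) (rcons_rV (x, t)))%E.
  apply/funext => t; rewrite integral_mkcond; apply: eq_integral => x _.
  by rewrite patch_rcons_set in_setT andbT patchE.
apply: (measurable_integral_rcons_rV_swap (f := F \_ (rcons_set A setT))).
  apply/(measurable_restrictT _ _).1; first exact: rcons_set_measurable.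
  exact: measurable_funTS.
by move=> y; rewrite patchE; case: ifP.
Qed.

End slices_C1.

Lemma measurable_integral_fiber {R : realType} {n : nat}
    (F : 'rV[R]_n.+1 -> \bar R) (I : set R) :
  measurable_fun setT F -> (forall y, (0 <= F y)%E) ->
  measurable (I : set (measurableTypeR R)) ->
  measurable_fun [set: 'rV[R]_n]
    (fun x => \int[@lebesgue_measure R]_(t in I) F (rcons_rV (x, t)))%E.
Proof.
move=> mF F0 mI.
have -> : (fun x => \int[@lebesgue_measure R]_(t in I) F (rcons_rV (x, t)))%E =
    (fun x => \int[@lebesgue_measure R]_t (F \_ (rcons_set setT I)) (rcons_rV (x, t)))%E.
  apply/funext => x; rewrite integral_mkcond; apply: eq_integral => t _.
  by rewrite patch_rcons_set in_setT patchE.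
apply: (measurable_integral_rcons_rV (f := F \_ (rcons_set setT I))).
  apply/(measurable_restrictT _ _).1; first exact: rcons_set_measurable.
  exact: measurable_funTS.
by move=> y; rewrite patchE; case: ifP.
Qed.

(** ** Rellich's inequality *)

(** The intervals are half-open so that an interval of length 2 L splits into
    translates of a shorter one. *)
Definition box {R : realType} (n : nat) (L : R) : set 'rV[R]_n :=
  [set x | forall i, x 0 i \in `[- L, L[ ].
Arguments box {R} n L _.

Section rellich.
Context {R : realType}.
Implicit Types L M : R.
Local Notation leb := (@lebesgue_measure R).

Lemma boxS n L : box n.+1 L = rcons_set (box n L) [set` `[- L, L[ ].
Proof.
apply/seteqP; split => [y /= yL|y [/= h1 h2] i].
  by split => /= [i|]; rewrite ?mxE; exact: yL.
case: (unliftP ord_max i) => [j ->|->] //.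
by have := h1 j; rewrite mxE.
Qed.

Lemma box_measurable n L : measurable (box n L : set 'rV[R]_n).
Proof.
elim: n => [|n IH]; last first.
  by rewrite boxS; apply: rcons_set_measurable.
by rewrite (_ : box 0 L = setT)//; apply/seteqP; split => // x _ [].
Qed.

Lemma box_sub_cube n L : box n L `<=` cube 0 (L + 1).
Proof.
move=> x xL i; have := xL i; rewrite !in_itv/= mxE sub0r add0r => /andP[h1 h2].
by apply/andP; split; lra.
Qed.

Lemma lebesgue_box_lty n L : (@lebesgue_rV R n (box n L) < +oo)%E.
Proof.
have [L0|L0] := ltP 0 (L + 1).
  apply: (@le_lt_trans _ _ (@lebesgue_rV R n (cube 0 (L + 1)))).
    apply: le_measure; rewrite ?inE; [exact: box_measurable|exact: cube_measurable|].
    exact: box_sub_cube.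
  by rewrite lebesgue_cube// ltry.
case: n => [|n].
  by rewrite /= diracE; case: (_ \in _); rewrite ltry.
rewrite (_ : box n.+1 L = set0) ?measure0 ?ltry//.
apply/seteqP; split => // x /(_ ord0); rewrite in_itv/=; lra.
Qed.

Lemma bounded_integrable_box n L (Q : set 'rV[R]_n) (w : 'rV[R]_n -> R) M :
  measurable Q -> Q `<=` box n L -> measurable_fun setT w ->
  (forall x, `|w x| <= M) -> (@lebesgue_rV R n).-integrable Q (EFin \o w).
Proof.
move=> mQ QL mw wM; apply: measurable_bounded_integrable => //.
- apply: le_lt_trans (lebesgue_box_lty n L).
  by apply: le_measure; rewrite ?inE//; exact: box_measurable.
- exact: measurable_funTS.
- exists M; split; first exact: num_real.
  by move=> y My x _ /=; rewrite (le_trans (wM x))// ltW.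
Qed.

(** Boundedness gives the integrability that Fubini's theorem asks of a function
    of variable sign. *)
Lemma integral_rcons_set_bounded n L (Q : set 'rV[R]_n) (I : set R)
    (w : 'rV[R]_n.+1 -> R) M :
  measurable Q -> Q `<=` box n L -> measurable (I : set (measurableTypeR R)) ->
  I `<=` `[- L, L[ -> measurable_fun setT w -> (forall x, `|w x| <= M) ->
  (\int[@lebesgue_rV R n.+1]_(y in rcons_set Q I) (w y)%:E =
   \int[leb]_(t in I) \int[@lebesgue_rV R n]_(x in Q) (w (rcons_rV (x, t)))%:E)%E.
Proof.
move=> mQ QL mI IL mw wM.
have mQI := rcons_set_measurable mQ mI.
pose W : 'rV[R]_n.+1 -> \bar R := (EFin \o w) \_ (rcons_set Q I).
have iW : (@lebesgue_rV R n.+1).-integrable setT W.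
  apply/(integrable_mkcond _ mQI); apply: (@bounded_integrable_box _ L _ _ M) => //.
  by rewrite boxS => y [h1 h2]; split; [exact: QL|exact: IL].
have mWr : measurable_fun [set: 'rV[R]_n * measurableTypeR R] (W \o @rcons_rV R n).
  apply: measurableT_comp measurable_rcons_rV.
  apply/(measurable_restrictT _ _).1 => //; apply: measurable_funTS.
  exact/measurable_EFinP.
have iWr : (@lebesgue_rV R n \x leb)%E.-integrable setT (W \o @rcons_rV R n).
  apply/integrableP; split => //.
  have /integrableP[_] := iW.
  rewrite (_ : (\int[@lebesgue_rV R n.+1]_y `|W y| =
    \int[(@lebesgue_rV R n \x leb)%E]_z `|(W \o @rcons_rV R n) z|)%E)//.
  rewrite [LHS]/= (ge0_integral_pushforward measurable_rcons_rV
    (@lebesgue_rV R n \x leb)%E measurableT); first by rewrite preimage_setT.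
    by apply: measurableT_comp => //; case/integrableP: iW.
  by move=> y _; exact: abse_ge0.
rewrite integral_mkcond -/W [LHS]/=.
rewrite (integral_pushforward measurable_rcons_rV (mu := (@lebesgue_rV R n \x leb)%E))//=; last first.
  by case/integrableP: iW.
rewrite preimage_setT.
rewrite -(integral21_prod_meas1 (m1 := @lebesgue_rV R n) (m2 := leb) iWr).
rewrite [RHS]integral_mkcond; apply: eq_integral => t _; rewrite patchE.
rewrite /fubini_G; case: ifPn => tI.
  rewrite [RHS]integral_mkcond; apply: eq_integral => x _ /=.
  by rewrite /W patch_rcons_set tI andbT patchE.
apply: integral0_eq => x _ /=.
by rewrite /W patch_rcons_set (negbTE tI) andbF.
Qed.

Definition sum_partial {n} (w : 'rV[R]_n -> R) (x : 'rV[R]_n) : R :=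
  \sum_i `|partial_deriv i w x|.

Lemma sum_partial_ge0 n (w : 'rV[R]_n -> R) x : 0 <= sum_partial w x.
Proof. exact: sumr_ge0. Qed.

Lemma measurable_partial n (w : 'rV[R]_n -> R) i : C1 w ->
  measurable_fun setT (partial_deriv i w).
Proof.
by move=> [_ /(_ i)[_ c]]; exact: continuous_measurable_rV.
Qed.

Lemma measurable_sum_partial n (w : 'rV[R]_n -> R) : C1 w ->
  measurable_fun setT (sum_partial w).
Proof.
move=> Cw; apply: measurable_sum => i; apply: measurableT_comp => //.
exact: measurable_partial.
Qed.

Lemma sum_partial_slice n (w : 'rV[R]_n.+1 -> R) t :
  (fun x => sum_partial (fun z => w (rcons_rV (z, t))) x) =
  (fun x => \sum_i `|partial_deriv (lift ord_max i) w (rcons_rV (x, t))|).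
Proof.
apply/funext => x; apply: eq_bigr => i _.
by rewrite (slice_partial_deriv w t i).
Qed.

Lemma sum_partialS n (w : 'rV[R]_n.+1 -> R) y : sum_partial w y =
  \sum_(i < n) `|partial_deriv (lift ord_max i) w y| +
  `|partial_deriv ord_max w y|.
Proof.
have widenE (i : 'I_n) : widen_ord (leqnSn n) i = lift ord_max i.
  by apply: val_inj; rewrite [RHS]lift_max.
rewrite /sum_partial big_ord_recr; congr +%R.
by apply: eq_bigr => i _; rewrite widenE.
Qed.

(** This is a quantitative form of the compactness of the embedding of W^{1,1}
    into L^1: only finitely many averages are not controlled by a small multiple
    of the gradient.  The induction adds one coordinate at a time and cuts its
    range into short intervals. *)
Lemma rellich_L1 (n : nat) (L eta : R) : 0 < L -> 0 < eta ->
  exists (I : finType) (Q : I -> set 'rV[R]_n),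
    (forall k, measurable (Q k) /\ Q k `<=` box n L) /\
    forall (w : 'rV[R]_n -> R) (M : R), C1 w -> (forall x, `|w x| <= M) ->
    (\int[@lebesgue_rV R n]_(x in box n L) `|w x|%:E <=
     eta%:E * \int[@lebesgue_rV R n]_(x in box n L) (sum_partial w x)%:E +
     \sum_k `|\int[@lebesgue_rV R n]_(x in Q k) (w x)%:E|)%E.
Proof.
move=> L0; elim: n eta => [|n IH] eta eta0.
  exists unit, (fun=> setT); split => [_|w M Cw wM].
    by split => // x _ [].
  have -> : box 0 L = setT by apply/seteqP; split => // x _ [].
  rewrite (big_pred1 tt); last by case.
  have int0 (f : 'rV[R]_0 -> R) :
      (\int[@lebesgue_rV R 0]_x (f x)%:E = (f 0)%:E)%E.
    have := @integral_dirac _ _ (0 : 'rV[R]_0) R setT measurableT (EFin \o f).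
    rewrite diracE in_setT mul1e; apply.
    have -> : EFin \o f = cst (f 0)%:E by apply/funext => x /=; rewrite (thinmx0 x).
    exact: measurable_cst.
  rewrite !int0 abse_EFin leeDr//.
  by rewrite mule_ge0 ?lee_fin ?(ltW eta0) ?sum_partial_ge0.
have [I [Q [QP HQ]]] := IH eta eta0.
have [J J0 hJ] : exists2 J : nat, (0 < J)%N & 2 * L / J%:R * #|I|%:R <= eta.
  have a0 : 0 <= 2 * L * #|I|%:R / eta.
    by rewrite divr_ge0 ?(ltW eta0)// mulr_ge0// mulr_ge0// ltW.
  exists (Num.bound (2 * L * #|I|%:R / eta)).+1 => //.
  rewrite mulrAC ler_pdivrMr ?ltr0n// [leRHS]mulrC -ler_pdivrMr// ltW//.
  by rewrite (lt_trans (archi_boundP a0))// ltr_nat.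
(* the range of the last coordinate is cut into J intervals of length h, with
   h times the number of averages in lower dimension at most eta *)
pose h := 2 * L / J%:R.
have Jp : 0 < J%:R :> R by rewrite ltr0n.
have h0 : 0 < h by rewrite divr_gt0 ?mulr_gt0.
have hL : - L + J%:R * h = L by rewrite /h; field; rewrite gt_eqF.
pose Ij (j : 'I_J) : set R := [set` `[- L + j%:R * h, - L + j.+1%:R * h[ ].
have IjL j : Ij j `<=` `[- L, L[.
  apply: subset_itv; rewrite bnd_simp.
    by rewrite lerDl mulr_ge0// ltW.
  by rewrite -{2}hL lerD2l ler_pM2r// ler_nat.
exists (I * 'I_J)%type, (fun k => rcons_set (Q k.1) (Ij k.2)); split.
  move=> [k j] /=; have [mQ QL] := QP k; split.
    by apply: rcons_set_measurable => //; exact: measurable_itv.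
  by rewrite boxS => y [hy1 hy2]; split; [exact: (QL _ hy1)|exact: (IjL j _ hy2)].
move=> w M Cw wM.
have cw : continuous w by case: Cw.
have mw : measurable_fun setT w by exact: continuous_measurable_rV.
have mpw i : measurable_fun setT (fun y => `|partial_deriv i w y|%:E).
  by apply/measurable_EFinP; apply: measurableT_comp => //; exact: measurable_partial.
pose ws t z := w (rcons_rV (z, t)).
have Cws t : C1 (ws t) by exact: C1_slice.
have wsM t z : `|ws t z| <= M by exact: wM.
have mws t : measurable_fun setT (ws t).
  by apply: continuous_measurable_rV; case: (Cws t).
have iws k t : (@lebesgue_rV R n).-integrable (Q k) (EFin \o ws t).
  by have [mQ QL] := QP k; exact: (bounded_integrable_box mQ QL (mws t) (wsM t)).
(* the averages of the slices: as functions of the last coordinate t they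
   oscillate at most by the integral of the last partial derivative of w *)
pose m k t := fine (\int[@lebesgue_rV R n]_(x in Q k) (ws t x)%:E).
have mE k t : (\int[@lebesgue_rV R n]_(x in Q k) (ws t x)%:E = (m k t)%:E)%E.
  by rewrite /m fineK//; have [mQ _] := QP k; exact: (integrable_fin_num mQ (iws k t)).
have mm k : measurable_fun [set: measurableTypeR R] (m k).
  have [mQ _] := QP k.
  apply: (measurableT_comp (f := fine)) => //.
  pose wp := funepos (EFin \o w); pose wn := funeneg (EFin \o w).
  have -> : (fun t => \int[@lebesgue_rV R n]_(x in Q k) (ws t x)%:E)%E =
      (fun t => \int[@lebesgue_rV R n]_(x in Q k) wp (rcons_rV (x, t)) -
                \int[@lebesgue_rV R n]_(x in Q k) wn (rcons_rV (x, t)))%E.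
    apply/funext => t; rewrite [LHS]integralE; congr (_ - _)%E.
      by apply: eq_integral => x _; rewrite /wp !funeposE.
    by apply: eq_integral => x _; rewrite /wn !funenegE.
  apply: emeasurable_funB; apply: measurable_integral_slice => //.
  - by apply: measurable_funepos; exact/measurable_EFinP.
  - by move=> y; rewrite /wp funeposE le_max lexx orbT.
  - by apply: measurable_funeneg; exact/measurable_EFinP.
  - by move=> y; rewrite /wn funenegE le_max lexx orbT.
pose F1 y := (\sum_(i < n) `|partial_deriv (lift ord_max i) w y|)%:E.
have mF1 : measurable_fun setT F1.
  apply/measurable_EFinP; apply: measurable_sum => i.
  by apply: measurableT_comp => //; exact: measurable_partial.
have F10 y : (0 <= F1 y)%E by rewrite lee_fin sumr_ge0.
pose P := (\int[@lebesgue_rV R n.+1]_(y in box n.+1 L) `|partial_deriv ord_max w y|%:E)%E.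
have P0 : (0 <= P)%E by apply: integral_ge0 => y _; rewrite lee_fin.
pose beta k u := (\int[@lebesgue_rV R n]_(x in Q k)
  `|partial_deriv ord_max w (rcons_rV (x, u))|%:E)%E.
have mbeta k : measurable_fun [set: measurableTypeR R] (beta k).
  have [mQ _] := QP k.
  by apply: (measurable_integral_slice (F := fun y => `|partial_deriv ord_max w y|%:E)).
have beta0 k u : (0 <= beta k u)%E by apply: integral_ge0 => y _; rewrite lee_fin.
have osc k s t : s <= t -> (`|m k s - m k t|%:E <=
    \int[@lebesgue_measure R]_(u in `[s, t]) beta k u)%E.
  move=> st; have [mQ _] := QP k.
  rewrite -abse_EFin EFinB -!mE -integralB//; [|exact: iws|exact: iws].
  apply: (le_trans (le_abse_integral _ _ _)) => //.
    by apply: emeasurable_funB; apply: measurable_funTS; exact/measurable_EFinP.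
  rewrite /beta -(integral_rcons_set_swap (F := fun y => `|partial_deriv ord_max w y|%:E))//.
  rewrite integral_rcons_set//.
  apply: ge0_le_integral => //.
  - apply: measurable_funTS; apply: measurableT_comp => //.
    by apply: emeasurable_funB; exact/measurable_EFinP.
  - apply: measurable_funTS.
    by apply: (measurable_integral_fiber (F := fun y => `|partial_deriv ord_max w y|%:E)).
  - by move=> x _; rewrite -EFinB abse_EFin; exact: fiber_osc.
have betaP k : (\int[@lebesgue_measure R]_(u in `[(- L)%R, L[) beta k u <= P)%E.
  have [mQ QL] := QP k.
  rewrite /beta -(integral_rcons_set_swap (F := fun y => `|partial_deriv ord_max w y|%:E))//.
  apply: ge0_subset_integral => //.
  - by apply: rcons_set_measurable => //; exact: measurable_itv.
  - exact: box_measurable.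
  - exact: measurable_funTS.
  - by rewrite boxS => y [hy1 hy2]; split => //; exact: QL.
have grid k : (\int[@lebesgue_measure R]_(u in `[(- L)%R, L[) `|m k u|%:E <=
    h%:E * P + \sum_(j < J) `|\int[@lebesgue_rV R n.+1]_(y in rcons_set (Q k) (Ij j)) (w y)%:E|)%E.
  have [mQ QL] := QP k.
  have := integral_norm_le_osc_grid (- L) J h0 (mm k) (mbeta k) (beta0 k) (osc k).
  rewrite hL => /le_trans; apply.
  apply: leeD; first by apply: lee_wpmul2l => //; rewrite lee_fin ltW.
  have -> : iota 0 J = index_iota 0 J by rewrite /index_iota subn0.
  rewrite big_mkord.
  apply: lee_sum => j _.
  have -> : (\int[@lebesgue_rV R n.+1]_(y in rcons_set (Q k) (Ij j)) (w y)%:E =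
      \int[@lebesgue_measure R]_(t in Ij j) (m k t)%:E)%E.
    rewrite (integral_rcons_set_bounded mQ QL (measurable_itv _) (IjL j) mw wM).
    by apply: eq_integral => t _; rewrite -mE.
  by [].
rewrite {1}boxS integral_rcons_set_swap//; last first.
- exact: box_measurable.
- by apply/measurable_EFinP; exact: measurableT_comp.
apply: (@le_trans _ _ (\int[@lebesgue_measure R]_(t in `[(- L)%R, L[)
  (eta%:E * \int[@lebesgue_rV R n]_(x in box n L) F1 (rcons_rV (x, t)) +
   \sum_k `|m k t|%:E))%E).
  apply: ge0_le_integral => //.
  - by move=> t _; apply: integral_ge0 => x _; rewrite lee_fin.
  - apply: measurable_funTS.
    apply: (measurable_integral_slice (F := fun y => `|w y|%:E)) => //.
      by apply/measurable_EFinP; exact: measurableT_comp.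
    exact: box_measurable.
  - apply: measurable_funTS; apply: emeasurable_funD.
      by apply: measurable_funeM; apply: measurable_integral_slice => //; exact: box_measurable.
    by apply: emeasurable_sum => k; apply/measurable_EFinP; exact: measurableT_comp.
  - move=> t _; apply: (le_trans (HQ (ws t) M (Cws t) (wsM t))).
    apply: leeD; last by apply: lee_sum => k _; rewrite mE.
    apply: lee_wpmul2l; first by rewrite lee_fin ltW.
    have sE x : (sum_partial (ws t) x)%:E = F1 (rcons_rV (x, t)).
      by rewrite /F1 -(congr1 (@^~ x) (sum_partial_slice w t)).
    by under eq_integral do rewrite sE.
rewrite ge0_integralD//; last 4 first.
- by move=> t _; rewrite mule_ge0 ?lee_fin ?(ltW eta0)// integral_ge0.
- by apply: measurable_funTS; apply: measurable_funeM; apply: measurable_integral_slice => //; exact: box_measurable.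
- by move=> t _; apply: sume_ge0 => k _; rewrite lee_fin.
- apply: measurable_funTS; apply: emeasurable_sum => k.
  by apply/measurable_EFinP; exact: measurableT_comp.
rewrite ge0_integralZl//; last 3 first.
- by apply: measurable_funTS; apply: measurable_integral_slice => //; exact: box_measurable.
- by move=> t _; exact: integral_ge0.
- by rewrite lee_fin ltW.
rewrite ge0_integral_sum//; last first.
  by move=> k; apply: measurable_funTS; apply/measurable_EFinP; exact: measurableT_comp.
rewrite -integral_rcons_set_swap//; last exact: box_measurable.
rewrite -boxS.
have -> : (\int[@lebesgue_rV R n.+1]_(y in box n.+1 L) (sum_partial w y)%:E =
    \int[@lebesgue_rV R n.+1]_(y in box n.+1 L) F1 y + P)%E.
  rewrite -ge0_integralD//; last 3 first.
  - exact: box_measurable.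
  - exact: measurable_funTS.
  - exact: measurable_funTS.
  by apply: eq_integral => y _; rewrite sum_partialS.
set A := (\int[@lebesgue_rV R n.+1]_(y in box n.+1 L) F1 y)%E.
have A0 : (0 <= A)%E by exact: integral_ge0.
have -> : (eta%:E * (A + P) = eta%:E * A + eta%:E * P)%E by rewrite ge0_muleDr.
rewrite -addeA; apply: leeD => //.
apply: (@le_trans _ _ (\sum_k (h%:E * P + \sum_(j < J)
  `|\int[@lebesgue_rV R n.+1]_(y in rcons_set (Q k) (Ij j)) (w y)%:E|))%E).
  by apply: lee_sum => k _; exact: grid.
rewrite big_split/= pair_big/=; apply: leeD => //.
rewrite -ge0_sume_distrl; last by move=> k _; rewrite lee_fin ltW.
apply: lee_wpmul2r => //; rewrite sumEFin lee_fin sumr_const.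
by rewrite -mulr_natr.
Qed.

End rellich.

(** ** The Poincare inequality *)
Section poincare.
Context {R : realType}.
Local Notation leb := (@lebesgue_measure R).

(** The function vanishes at c - r, so it is at most the integral of its
    derivative, to which Jensen's inequality applies. *)
Lemma poincare_itv (g : R -> R) c r p : 1 < p -> 0 < r ->
  (forall t, derivable g t 1) -> continuous (derive1 g) ->
  (forall t, g t != 0 -> `|t - c| < r) ->
  (\int[leb]_t (`|g t| `^ p)%:E <=
   ((2 * r) `^ p)%:E * \int[leb]_t (`|derive1 g t| `^ p)%:E)%E.
Proof.
move=> p1 r0 dg cg' g0; have p0 : 0 < p by lra.
pose a := c - r; pose b := c + r.
have ab : a < b by rewrite /a /b; lra.
have ba : b - a = 2 * r by rewrite /a /b; ring.
have cg : continuous g.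
  by move=> u; apply: differentiable_continuous; apply/derivable1_diffP.
have gout t : ~~ (t \in `[a, b]) -> g t = 0.
  move=> tab; apply/eqP/negPn/negP => /g0; rewrite ltr_norml => /andP[h1 h2].
  by move/negP: tab; apply; rewrite in_itv/= /a /b; apply/andP; split; lra.
have ga : g a = 0.
  apply/eqP/negPn/negP => /g0; rewrite /a addrAC subrr add0r normrN ger0_norm ?(ltW r0)//.
  by rewrite ltxx.
have mng' : measurable_fun setT (fun t => (`|derive1 g t| `^ p)%:E).
  by apply: measurable_powR_norm; exact: continuous_measurable_fun.
pose I := \int[leb]_(u in `[a, b]) `|derive1 g u|.
have I0 : 0 <= I by apply: Rintegral_ge0.
have EI : (\int[leb]_(u in `[a, b]) `|derive1 g u|%:E = I%:E)%E.
  rewrite /I /Rintegral fineK//.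
  have := integrable_fin_num _ (cont_int_itv a b (g := fun u => `|derive1 g u|) _).
  apply => //.
  move=> u; apply: (@continuous_comp _ _ _ (derive1 g) (fun x => `|x|)).
    exact: cg'.
  exact: norm_continuous.
have -> : (\int[leb]_t (`|g t| `^ p)%:E = \int[leb]_(t in `[a, b]) (`|g t| `^ p)%:E)%E.
  rewrite [RHS]integral_mkcond; apply: eq_integral => t _; rewrite patchE.
  case: ifPn => // /negP; rewrite inE/= => /negP tab.
  by rewrite (gout _ tab) normr0 powR0// gt_eqF.
apply: (@le_trans _ _ (\int[leb]_(t in `[a, b]) (cst (I `^ p)%:E t))%E).
  apply: ge0_le_integral => //.
  - apply: measurable_funTS; apply: measurable_powR_norm.
    exact: continuous_measurable_fun.
  - move=> t /= tab; rewrite lee_fin ge0_ler_powR ?nnegrE ?(ltW p0)//.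
    rewrite -lee_fin -EI -[g t]subr0 -ga; apply: FTC_osc => //.
    by rewrite in_itv/= lexx ltW.
have -> : (\int[leb]_(t in `[a, b]) (cst (I `^ p)%:E t) = (2 * r)%:E * (I `^ p)%:E)%E.
  transitivity ((I `^ p)%:E * leb `[a, b])%E; first by rewrite integral_cst.
  by rewrite lebesgue_measure_itv/= lte_fin ab -EFinB ba muleC.
apply: (@le_trans _ _ ((2 * r)%:E * (((2 * r) `^ (p - 1))%:E *
    \int[leb]_(u in `[a, b]) (`|derive1 g u| `^ p)%:E))%E).
  apply: lee_wpmul2l; first by rewrite lee_fin mulr_ge0// ltW.
  by rewrite -ba; exact: jensen_itv.
rewrite muleA -EFinM mulr_powRB1 ?mulr_ge0 ?(ltW r0)//.
apply: lee_wpmul2l; first by rewrite lee_fin powR_ge0.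
by apply: ge0_subset_integral => // t _; rewrite lee_fin powR_ge0.
Qed.

Lemma poincare_slab n (f : 'rV[R]_n.+1 -> R) c r p : 1 < p -> 0 < r -> C1 f ->
  (forall y, f y != 0 -> `|y 0 ord_max - c| < r) ->
  (\int[@lebesgue_rV R n.+1]_y (`|f y| `^ p)%:E <=
   ((2 * r) `^ p)%:E *
   \int[@lebesgue_rV R n.+1]_y (`|partial_deriv ord_max f y| `^ p)%:E)%E.
Proof.
move=> p1 r0 Cf f0.
have mf : measurable_fun setT f by apply: continuous_measurable_rV; case: Cf.
have mpf : measurable_fun setT (fun y => (`|partial_deriv ord_max f y| `^ p)%:E).
  by apply: measurable_powR_norm; exact: measurable_partial.
have mfp : measurable_fun setT (fun y => (`|f y| `^ p)%:E).
  exact: measurable_powR_norm.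
rewrite (integral_rcons_rV mfp) => [|y]; last by rewrite lee_fin powR_ge0.
rewrite (integral_rcons_rV mpf) => [|y]; last by rewrite lee_fin powR_ge0.
rewrite -ge0_integralZl//; last 3 first.
- by apply: (measurable_integral_rcons_rV mpf) => y; rewrite lee_fin powR_ge0.
- by move=> x _; apply: integral_ge0 => t _; rewrite lee_fin powR_ge0.
- by rewrite lee_fin powR_ge0.
apply: ge0_le_integral => //.
- by move=> x _; apply: integral_ge0 => t _; rewrite lee_fin powR_ge0.
- by apply: (measurable_integral_rcons_rV mfp) => y; rewrite lee_fin powR_ge0.
- apply: measurable_funeM.
  by apply: (measurable_integral_rcons_rV mpf) => y; rewrite lee_fin powR_ge0.
move=> x _; have := @poincare_itv (fun t => f (rcons_rV (x, t))) c r p p1 r0.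
rewrite derive1_fiber; apply.
- by move=> t; exact: derivable_fiber.
- by apply: continuous_fiber; case: Cf => _ /(_ ord_max)[].
- by move=> t /f0; rewrite rcons_rV_max.
Qed.

End poincare.

(** * A smooth bump *)
Section near_eq_diff.
Context {R : realType} {V W : normedModType R}.

Lemma near0_differentiable (k : V -> W) (x : V) :
  (\near x, k x = 0) -> differentiable k x.
Proof.
move=> k0; have kx : k x = 0 := nbhs_singleton k0.
have H : k \o shift x = cst (k x) + (\0 : {linear V -> W}) +o_ 0 id.
  apply/eqaddoP => _/posnumP[e].
  have : \forall h \near 0, k (h + x) = 0.
    by move: k0; rewrite (near_shift 0 x); apply: filterS => h /=; rewrite subr0.
  by apply: filterS => h kh; rewrite !fctE /= kh kx addr0 subr0 normr0 mulr_ge0.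
have c0 : continuous (\0 : {linear V -> W}) by exact: cst_continuous.
apply/diff_locallyP; have dk := diff_unique c0 H.
by rewrite dk.
Qed.

Lemma near_eq_differentiable (f g : V -> W) (x : V) :
  (\near x, f x = g x) -> differentiable f x -> differentiable g x.
Proof.
move=> fg df.
have -> : g = f + (g - f) by apply/funext => y; rewrite !fctE addrC subrK.
apply: differentiableD => //; apply: near0_differentiable.
by apply: filterS fg => y fgy; rewrite !fctE fgy subrr.
Qed.

End near_eq_diff.

(** The functions t ^ -n * exp (-1/t), extended by 0 for t <= 0, span a space
    which is stable under derivation. *)
Definition flat {R : realType} (n : nat) (t : R) : R :=
  if 0 < t then t^-1 ^+ n * expR (- t^-1) else 0.

Section flat.
Context {R : realType}.
Implicit Types t : R.

Lemma flat_ge0 n t : 0 <= flat n t.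
Proof.
rewrite /flat; case: ifPn => // t0.
by rewrite mulr_ge0 ?expR_ge0// exprn_ge0// invr_ge0 ltW.
Qed.

(** The exponential dominates its Taylor terms; this gives the derivative 0 at
    the origin. *)
Lemma flat_le n t : flat n t <= n.+1`!%:R * `|t|.
Proof.
rewrite /flat; case: ifPn => [t0|_]; last by rewrite mulr_ge0.
rewrite expRN ler_pdivrMr ?expR_gt0// gtr0_norm//.
apply: (@le_trans _ _ (n.+1`!%:R * t * (t^-1 ^+ n.+1 / n.+1`!%:R))).
  rewrite le_eqVlt; apply/orP; left; apply/eqP.
  have f0 : n.+1`!%:R != 0 :> R by rewrite pnatr_eq0 -lt0n fact_gt0.
  rewrite mulrACA [n.+1`!%:R * _]mulrC exprS [t * _]mulrC -mulrA.
  by rewrite mulVKf// mulrAC mulVf ?gt_eqF// mul1r.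
rewrite ler_wpM2l ?mulr_ge0 ?(ltW t0)//.
have := @expR_ge1Dxn R t^-1 n; rewrite invr_ge0 ltW// => /(_ isT) h.
by apply: le_trans h; rewrite lerDr.
Qed.

Lemma is_derive_flat n t :
  is_derive t 1 (flat n) (flat n.+2 t - n%:R * flat n.+1 t).
Proof.
have [t0|t0|->] := ltgtP t 0.
- rewrite {2 3}/flat ltNge (ltW t0)/= mulr0 subr0.
  apply: (near_eq_is_derive (f := cst 0)) => //.
  near=> s; rewrite /flat; case: ifPn => // s0; exfalso.
  by move: s0; rewrite ltNge => /negP; apply; apply: ltW; near: s; exact: lt_nbhsl.
- pose F : R -> R := fun s => s^-1 ^+ n * expR (- s^-1).
  have nF : \near t, F t = flat n t.
    by near=> s; rewrite /F /flat ifT//; near: s; exact: lt_nbhsr.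
  apply: (near_eq_is_derive nF).
  have dV : is_derive t 1 (fun s : R => s^-1) (- t ^- 2).
    have tn0 : t != 0 by rewrite gt_eqF.
    have dI : derivable (id : R -> R) t 1 by [].
    split; first exact: (derivableV (f := id)).
    rewrite (deriveV (f := id))// derive_id /GRing.scale/= mulr1.
    by [].
  have dX := @is_deriveX R R (fun s : R => s^-1) n t 1 _ dV.
  have dE : is_derive t 1 (fun s : R => expR (- s^-1)) (expR (- t^-1) * (t ^- 2)).
    apply: (@is_derive1_comp R expR (fun s : R => - s^-1)).
    by have := is_deriveN dV; rewrite opprK.
  have dM := is_deriveM dX dE.
  have -> : F = ((fun s : R => s^-1) ^+ n * (fun s : R => expR (- s^-1))).
    by apply/funext => s; rewrite !fctE /F.
  apply: is_derive_eq; rewrite /flat t0 /GRing.scale/= !fctE -exprVn.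
  set E := expR _; set y := t^-1.
  case: n {F nF dV dX dE dM} => [|n]; first by rewrite !mul0r mulr0 addr0 subr0 expr0 mul1r mulrC.
  by rewrite /= !exprS; ring.
- rewrite {2 3}/flat ltxx mulr0 subr0.
  have f0 : flat n (0 : R) = 0 by rewrite /flat ltxx.
  have C : h^-1 *: ((flat n \o shift 0) (h *: 1) - flat n 0) @[h --> 0^'] --> (0 : R).
    apply/cvgr0Pnorm_le => e e0.
    have d0 : 0 < e / n.+2`!%:R by rewrite divr_gt0// ltr0n fact_gt0.
    near=> h; rewrite /= /GRing.scale/= mulr1 addr0 f0 subr0.
    have -> : `|h^-1 * flat n h| = flat n.+1 h.
      rewrite /flat; case: ifPn => h0; last by rewrite mulr0 normr0.
      by rewrite mulrA -exprS ger0_norm// mulr_ge0 ?expR_ge0// exprn_ge0// invr_ge0 ltW.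
    apply: (le_trans (flat_le _ _)); rewrite mulrC -ler_pdivlMr ?ltr0n ?fact_gt0//.
    by near: h; exact: dnbhs0_le.
  by split; [apply/cvg_ex; exists 0|exact: cvg_lim].
Unshelve. all: by end_near. Qed.

End flat.

(** The functions built from the one-variable functions flat n by affine
    substitutions in one coordinate, sums, multiples and products; this class
    is stable under partial derivation and its members are differentiable. *)
Inductive flat_class {R : realType} {N : nat} : ('rV[R]_N -> R) -> Prop :=
| Flat_base n a b j : flat_class (fun x => flat n (a * x 0 j + b))
| Flat_cst c : flat_class (fun=> c)
| Flat_add f g : flat_class f -> flat_class g -> flat_class (fun x => f x + g x)
| Flat_mul f g : flat_class f -> flat_class g -> flat_class (fun x => f x * g x).

Section flat_class.
Context {R : realType} {N : nat}.

Lemma is_diff_affine_coord (a b : R) (j : 'I_N) (x : 'rV[R]_N) :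
  is_diff x (fun y : 'rV[R]_N => a * y 0 j + b : R) (fun v : 'rV[R]_N => a * v 0 j : R).
Proof.
have cf0 : continuous (fun v : 'rV[R]_N => a * v 0 j).
  have h : continuous (fun v : 'rV[R]_N => v 0 j : R) by exact: coord_continuous.
  by move=> v; exact: (@cvgM _ _ (nbhs v) _ (cst a) (fun v : 'rV[R]_N => v 0 j : R)
    a (v 0 j) (cvg_cst a) (h v)).
have @f : {linear 'rV[R]_N -> R}.
  exists (fun v : 'rV[R]_N => a * v 0 j); do 2![eexists]; do ?[constructor].
  - by rewrite mxE mulr0.
  - by move=> u v; rewrite !mxE mulrDr.
  - by move=> k v; rewrite !mxE mulrCA.
have cf : continuous f by exact: cf0.
have df : is_diff x (f : 'rV[R]_N -> R) f.
  by apply: DiffDef; [exact: linear_differentiable|exact: diff_lin].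
have -> : (fun y : 'rV[R]_N => a * y 0 j + b : R) = (f : 'rV[R]_N -> R) + cst b.
  by apply/funext => y; rewrite fctE.
have := is_diffD df (is_diff_cst b x).
by rewrite addr0.
Qed.

Lemma flat_class_diff (f : 'rV[R]_N -> R) : flat_class f ->
  (forall x, differentiable f x) /\ forall i, flat_class (partial_deriv i f).
Proof.
elim=> [n a b j|c|{}f g _ [df If] _ [dg Ig]|{}f g Cf [df If] Cg [dg Ig]].
- have dflat t : differentiable (flat n : R -> R) t.
    by apply/derivable1_diffP; have [] := is_derive_flat n t.
  have D x : is_diff x (fun y : 'rV[R]_N => flat n (a * y 0 j + b))
      ('d (flat n : R -> R) (a * x 0 j + b) \o (fun v : 'rV[R]_N => a * v 0 j)).
    have dA := is_diff_affine_coord a b j x.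
    by apply: (is_diff_comp dA); exact: DiffDef.
  split=> [x|i]; first by have [] := D x.
  have -> : partial_deriv i (fun y : 'rV[R]_N => flat n (a * y 0 j + b)) =
      (fun x => (a * (delta_mx 0 i : 'rV[R]_N) 0 j) *
        (flat n.+2 (a * x 0 j + b) + (- n%:R) * flat n.+1 (a * x 0 j + b))).
    apply/funext => x; rewrite /partial_deriv deriveE; last by have [] := D x.
    have [_ ->] := D x; rewrite /= diff1E// /GRing.scale/=; congr (_ * _).
    by rewrite derive1E mulNr; have [_ ->] := is_derive_flat n (a * x 0 j + b).
  apply: Flat_mul; first exact: Flat_cst.
  apply: Flat_add; first exact: Flat_base.
  by apply: Flat_mul; [exact: Flat_cst|exact: Flat_base].
- split=> [x|i]; first exact: differentiable_cst.
  have -> : partial_deriv i (fun _ : 'rV[R]_N => c) = (fun=> 0).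
    by apply/funext => x; rewrite /partial_deriv derive_cst.
  exact: Flat_cst.
- split=> [x|i]; first exact: differentiableD.
  have -> : partial_deriv i (fun x => f x + g x) =
      (fun x => partial_deriv i f x + partial_deriv i g x).
    by apply/funext => x; rewrite /partial_deriv -deriveD//; exact: diff_derivable.
  exact: Flat_add.
- split=> [x|i]; first exact: differentiableM.
  have -> : partial_deriv i (fun x => f x * g x) =
      (fun x => f x * partial_deriv i g x + g x * partial_deriv i f x).
    by apply/funext => x; rewrite /partial_deriv -deriveM//; exact: diff_derivable.
  by apply: Flat_add; exact: Flat_mul.
Qed.

Lemma flat_class_smooth (f : 'rV[R]_N -> R) : flat_class f -> smooth f.
Proof.
move=> Cf s; suff : flat_class (foldr partial_deriv f s).
  by move=> /flat_class_diff[].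
by elim: s => //= i s /flat_class_diff[_]; exact.
Qed.

End flat_class.

Section bump.
Context {R : realType} {N : nat}.
Variables (c : 'rV[R]_N) (rho : R).
Hypothesis rho0 : 0 < rho.

(** A product of one-variable bumps, positive exactly on an open cube. *)
Definition bump (x : 'rV[R]_N) : R :=
  \prod_i (flat 0 (1 * x 0 i + (rho - c 0 i)) * flat 0 (-1 * x 0 i + (rho + c 0 i))).

Lemma bump_smooth : smooth bump.
Proof.
apply: flat_class_smooth; rewrite /bump.
elim: (index_enum _) => [|i s IH].
  have -> : (fun x : 'rV[R]_N => \prod_(i <- [::])
    (flat 0 (1 * x 0 i + (rho - c 0 i)) * flat 0 (-1 * x 0 i + (rho + c 0 i)))) = fun=> 1.
    by apply/funext => x; rewrite big_nil.
  exact: Flat_cst.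
have -> : (fun x : 'rV[R]_N => \prod_(i <- i :: s)
    (flat 0 (1 * x 0 i + (rho - c 0 i)) * flat 0 (-1 * x 0 i + (rho + c 0 i)))) =
  fun x => (flat 0 (1 * x 0 i + (rho - c 0 i)) * flat 0 (-1 * x 0 i + (rho + c 0 i))) *
    \prod_(i <- s) (flat 0 (1 * x 0 i + (rho - c 0 i)) * flat 0 (-1 * x 0 i + (rho + c 0 i))).
  by apply/funext => x; rewrite big_cons.
apply: Flat_mul => //; apply: Flat_mul; exact: Flat_base.
Qed.

Lemma flat0_gt0 (t : R) : (0 < flat 0 t) = (0 < t).
Proof.
rewrite /flat; case: ifPn => _; last by rewrite ltxx.
by rewrite expr0 mul1r expR_gt0.
Qed.

Lemma bump_gt0 x : cube c rho x -> 0 < bump x.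
Proof.
move=> xc; apply: prodr_gt0 => i _; have := xc i; rewrite in_itv/= => /andP[h1 h2].
by rewrite mulr_gt0// flat0_gt0; lra.
Qed.

Lemma bump_support x : bump x != 0 -> forall i, x 0 i \in `[c 0 i - rho, c 0 i + rho].
Proof.
move=> bx i; have := bx; rewrite /bump (bigD1 i)//= mulf_eq0 negb_or => /andP[+ _].
rewrite mulf_eq0 negb_or => /andP[f1 f2].
have h (t : R) : flat 0 t != 0 -> 0 < t.
  by move=> ft; rewrite -flat0_gt0 lt_neqAle eq_sym ft flat_ge0.
by rewrite in_itv/=; move: (h _ f1) (h _ f2) => h1 h2; apply/andP; split; lra.
Qed.

Lemma closed_cube_closed :
  closed [set x : 'rV[R]_N | forall i, x 0 i \in `[c 0 i - rho, c 0 i + rho] ].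
Proof.
have -> : [set x : 'rV[R]_N | forall i, x 0 i \in `[c 0 i - rho, c 0 i + rho] ] =
    \bigcap_(i in setT) ((fun x : 'rV[R]_N => x 0 i) @^-1`
      [set` `[c 0 i - rho, c 0 i + rho] ]).
  by apply/seteqP; split => x /= h i; [move=> _|]; exact: h.
apply: closed_bigI => i _; apply: closed_comp; last exact: itv_closed.
by move=> x _; exact: coord_continuous.
Qed.

Lemma bump_test (Omega : set 'rV[R]_N) :
  [set x : 'rV[R]_N | forall i, x 0 i \in `[c 0 i - rho, c 0 i + rho] ] `<=` Omega ->
  test_function Omega bump.
Proof.
move=> cO.
have sub : fsupport bump `<=`
    [set x : 'rV[R]_N | forall i, x 0 i \in `[c 0 i - rho, c 0 i + rho] ].
  rewrite [X in _ `<=` X](closure_id _).1; last exact: closed_cube_closed.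
  by apply: closureS => x; exact: bump_support.
split; [exact: bump_smooth| |exact: subset_trans sub cO].
apply: subclosed_compact sub; first exact: closed_closure.
by apply: (@rV_compact R N (fun i => [set` `[c 0 i - rho, c 0 i + rho] ])) => i; exact: segment_compact.
Qed.

End bump.

(** * Test functions *)

(** Real-valued, because the integrals in question are finite for test functions
    and for their limits; it is 0 when the integral is infinite. *)
Definition pint {R : realType} {N : nat} (p : R) (h : 'rV[R]_N -> R) : R :=
  fine (\int[@lebesgue_rV R N]_x (`|h x| `^ p)%:E)%E.

Definition gnorm {R : realType} {N : nat} (f : 'rV[R]_N -> R) (x : 'rV[R]_N) : R :=
  enorm (grad f x).

Section smooth_functions.
Context {R : realType} {N : nat}.
Implicit Types (f g : 'rV[R]_N -> R).

Lemma smooth_differentiable f x : smooth f -> differentiable f x.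
Proof. by move=> /(_ [::] x). Qed.

Lemma smooth_continuous f : smooth f -> continuous f.
Proof.
by move=> sf x; apply: differentiable_continuous; exact: smooth_differentiable.
Qed.

Lemma smooth_partial f i : smooth f -> smooth (partial_deriv i f).
Proof.
move=> sf s x; have := sf (s ++ [:: i]) x.
by rewrite foldr_cat.
Qed.

Lemma smooth_C1 f : smooth f -> C1 f.
Proof.
move=> sf; split; first exact: smooth_continuous.
move=> i; split; first by move=> x; apply: diff_derivable; exact: smooth_differentiable.
exact/smooth_continuous/smooth_partial.
Qed.

Lemma partial_deriv_lin a f g i x : differentiable f x -> differentiable g x ->
  partial_deriv i (fun y => a * f y + g y) x =
  a * partial_deriv i f x + partial_deriv i g x.
Proof.
move=> df dg; rewrite /partial_deriv.
have -> : (fun y => a * f y + g y) = (a \*: f) + g by [].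
rewrite deriveD; [|exact/derivableZ/diff_derivable|exact: diff_derivable].
by rewrite deriveZ//; exact: diff_derivable.
Qed.

Lemma foldr_partial_lin a f g s : smooth f -> smooth g ->
  foldr partial_deriv (fun y => a * f y + g y) s =
  (fun y => a * foldr partial_deriv f s y + foldr partial_deriv g s y).
Proof.
move=> sf sg; elim: s => // i s /= ->.
by apply/funext => x; apply: partial_deriv_lin; [exact: sf|exact: sg].
Qed.

Lemma smooth_lin a f g : smooth f -> smooth g -> smooth (fun y => a * f y + g y).
Proof.
move=> sf sg s x; rewrite foldr_partial_lin//.
have -> : (fun y => a * foldr partial_deriv f s y + foldr partial_deriv g s y) =
  (a \*: (foldr partial_deriv f s)) + foldr partial_deriv g s by [].
by apply: differentiableD; [apply: differentiableZ; exact: sf|exact: sg].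
Qed.

Lemma grad_lin a f g x : differentiable f x -> differentiable g x ->
  grad (fun y => a * f y + g y) x = a *: grad f x + grad g x.
Proof. by move=> df dg; apply/rowP => i; rewrite !mxE partial_deriv_lin. Qed.

Lemma grad_continuous f : smooth f -> continuous (grad f).
Proof.
move=> sf; apply: continuous_rV => i.
rewrite (_ : (fun x => grad f x 0 i) = partial_deriv i f); last first.
  by apply/funext => x; rewrite mxE.
exact/smooth_continuous/smooth_partial.
Qed.

Lemma measurable_grad f : smooth f -> measurable_fun setT (grad f).
Proof.
move=> sf; apply: measurable_fun_rV => i.
rewrite (_ : (fun x => grad f x 0 i) = partial_deriv i f); last first.
  by apply/funext => x; rewrite mxE.
by apply: continuous_measurable_rV; apply: smooth_continuous; exact: smooth_partial.
Qed.

Lemma gnorm_continuous f : smooth f -> continuous (gnorm f).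
Proof.
move=> sf x; apply: (@continuous_comp _ _ _ (grad f) (@enorm R N)).
  exact: grad_continuous.
exact: enorm_continuous.
Qed.

Lemma fsupport_out f x : ~ fsupport f x -> \near x, f x = 0.
Proof.
move=> xf; have : nbhs x (~` fsupport f).
  by apply: open_nbhs_nbhs; split => //; apply: closed_openC; exact: closed_closure.
apply: filterS => y yf; apply/eqP/negPn/negP => fy; apply: yf.
exact: subset_closure.
Qed.

Lemma partial_near0 f i x : (\near x, f x = 0) -> partial_deriv i f x = 0.
Proof.
move=> f0; rewrite /partial_deriv (near_eq_derive (g := cst 0) _ f0).
by rewrite derive_cst.
Qed.

Lemma grad_near0 f x : (\near x, f x = 0) -> grad f x = 0.
Proof. by move=> f0; apply/rowP => i; rewrite !mxE partial_near0. Qed.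

Lemma fsupport_out_val f x : ~ fsupport f x -> f x = 0.
Proof. by move=> /fsupport_out /nbhs_singleton. Qed.

Lemma fsupport_out_grad f x : ~ fsupport f x -> grad f x = 0.
Proof. by move=> /fsupport_out; exact: grad_near0. Qed.

Lemma gnorm_out f x : ~ fsupport f x -> gnorm f x = 0.
Proof. by move=> xf; rewrite /gnorm fsupport_out_grad// enorm0. Qed.

End smooth_functions.

Section compact_support.
Context {R : realType} {N : nat}.
Implicit Types (h : 'rV[R]_N -> R) (K : set 'rV[R]_N) (p : R).

Lemma compact_continuous_bounded h K : compact K -> continuous h ->
  exists M : R, forall x, K x -> `|h x| <= M.
Proof.
move=> cK ch.
have : compact (h @` K).
  by apply: continuous_compact => //; exact: continuous_subspaceT.
move=> /compact_bounded [M [_ HM]]; exists (M + 1) => x Kx.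
by apply: (HM (M + 1)); [rewrite ltrDl|exists x].
Qed.

Lemma compact_sub_cube K : compact K -> exists2 L : R, 0 < L & K `<=` cube 0 L.
Proof.
move=> cK; have [M HM] := compact_continuous_bounded cK (@enorm_continuous R N).
exists (`|M| + 1); first by rewrite ltr_wpDl.
move=> x Kx i; rewrite mxE sub0r add0r in_itv/= -ltr_norml.
apply: (le_lt_trans (normr_coord_le x i)).
apply: (le_lt_trans (ler_norm _)); apply: (le_lt_trans (HM x Kx)).
by rewrite (le_lt_trans (ler_norm M))// ltrDl.
Qed.

Lemma compact_support_pint_lty p h K : 0 < p -> compact K -> continuous h ->
  (forall x, ~ K x -> h x = 0) ->
  (\int[@lebesgue_rV R N]_x (`|h x| `^ p)%:E < +oo)%E.
Proof.
move=> p0 cK ch h0.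
have [M HM] := compact_continuous_bounded cK ch.
have [L L0 KL] := compact_sub_cube cK.
have mhp : measurable_fun setT (fun x => (`|h x| `^ p)%:E).
  by apply: measurable_powR_norm; exact: continuous_measurable_rV.
have mc : measurable (cube 0 L : set 'rV[R]_N) by exact: cube_measurable.
have -> : (\int[@lebesgue_rV R N]_x (`|h x| `^ p)%:E =
    \int[@lebesgue_rV R N]_(x in cube 0 L) (`|h x| `^ p)%:E)%E.
  rewrite [RHS]integral_mkcond; apply: eq_integral => x _; rewrite patchE.
  case: ifPn => // /negP xL; rewrite h0 ?normr0 ?powR0 ?gt_eqF// => Kx.
  by apply: xL; rewrite inE; exact: KL.
apply: (@le_lt_trans _ _ (\int[@lebesgue_rV R N]_(x in cube 0 L) (cst (`|M| `^ p)%:E x))%E).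
  apply: ge0_le_integral => //.
  - exact: measurable_funTS.
  - move=> x _; rewrite lee_fin ge0_ler_powR ?nnegrE ?(ltW p0)//.
    have [Kx|Kx] := pselect (K x).
      by rewrite (le_trans (HM x Kx))// ler_norm.
    by rewrite h0// normr0.
rewrite integral_cst// [X in (_ * X)%E](lebesgue_cube 0 L0 : _ = _).
by rewrite -EFinM ltry.
Qed.

Section test.
Variables (Omega : set 'rV[R]_N) (f : 'rV[R]_N -> R).
Hypothesis tf : test_function Omega f.

Lemma test_smooth : smooth f. Proof. by case: tf. Qed.

Lemma test_measurable : measurable_fun setT f.
Proof.
by apply: continuous_measurable_rV; apply: smooth_continuous; exact: test_smooth.
Qed.

Lemma test_measurable_grad : measurable_fun setT (grad f).
Proof. by apply: measurable_grad; exact: test_smooth. Qed.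

Lemma test_measurable_gnorm : measurable_fun setT (gnorm f).
Proof. by apply: measurable_enorm; exact: test_measurable_grad. Qed.

Lemma test_out x : ~ Omega x -> f x = 0.
Proof. by case: tf => _ _ fO Ox; apply: fsupport_out_val => /fO. Qed.

Lemma test_out_grad x : ~ Omega x -> grad f x = 0.
Proof. by case: tf => _ _ fO Ox; apply: fsupport_out_grad => /fO. Qed.

Lemma test_out_gnorm x : ~ Omega x -> gnorm f x = 0.
Proof. by move=> /test_out_grad; rewrite /gnorm => ->; rewrite enorm0. Qed.

Lemma test_pint_lty p : 0 < p ->
  (\int[@lebesgue_rV R N]_x (`|f x| `^ p)%:E < +oo)%E.
Proof.
move=> p0; case: (tf) => sf cK _.
apply: (compact_support_pint_lty p0 cK); first exact: smooth_continuous.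
exact: fsupport_out_val.
Qed.

Lemma test_pint_grad_lty p : 0 < p ->
  (\int[@lebesgue_rV R N]_x (`|gnorm f x| `^ p)%:E < +oo)%E.
Proof.
move=> p0; case: (tf) => sf cK _.
apply: (compact_support_pint_lty p0 cK); first exact: gnorm_continuous.
exact: gnorm_out.
Qed.

Lemma test_pintE p : 0 < p ->
  (\int[@lebesgue_rV R N]_x (`|f x| `^ p)%:E = (pint p f)%:E)%E.
Proof.
move=> p0; rewrite /pint fineK// ge0_fin_numE; first exact: test_pint_lty.
by apply: integral_ge0 => x _; rewrite lee_fin powR_ge0.
Qed.

Lemma test_pint_gradE p : 0 < p ->
  (\int[@lebesgue_rV R N]_x (`|gnorm f x| `^ p)%:E = (pint p (gnorm f))%:E)%E.
Proof.
move=> p0; rewrite /pint fineK// ge0_fin_numE; first exact: test_pint_grad_lty.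
by apply: integral_ge0 => x _; rewrite lee_fin powR_ge0.
Qed.

Lemma test_bounded : exists M : R, forall x, `|f x| <= M.
Proof.
case: (tf) => sf cK _.
have [M HM] := compact_continuous_bounded cK (smooth_continuous sf).
exists `|M| => x; have [Kx|Kx] := pselect (fsupport f x).
  by rewrite (le_trans (HM x Kx))// ler_norm.
by rewrite fsupport_out_val// normr0.
Qed.

End test.

Lemma test_functionS (O O' : set 'rV[R]_N) f : O `<=` O' ->
  test_function O f -> test_function O' f.
Proof. by move=> OO' [sf cf fO]; split => //; exact: subset_trans OO'. Qed.

Lemma test_lin (O : set 'rV[R]_N) a f g : test_function O f -> test_function O g ->
  test_function O (fun x => a * f x + g x).
Proof.
move=> [sf cf fO] [sg cg gO].
have sub : fsupport (fun x => a * f x + g x) `<=` fsupport f `|` fsupport g.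
  rewrite -closureU; apply: closureS => x /= fx.
  have [f0|] := eqVneq (f x) 0; last by left.
  by right; move: fx; rewrite f0 mulr0 add0r.
split; first exact: smooth_lin.
  apply: subclosed_compact sub; first exact: closed_closure.
  exact: compactU.
by apply: subset_trans sub _ => x [/fO|/gO].
Qed.

Lemma test_cst0 (O : set 'rV[R]_N) : test_function O (fun=> 0).
Proof.
have s0 : fsupport (fun=> 0 : R) = set0 :> set 'rV[R]_N.
  rewrite /fsupport (_ : [set x | _] = set0) ?closure0//.
  by apply/seteqP; split => // x /=; rewrite eqxx.
split; last by rewrite s0.
  move=> s x; suff -> : foldr partial_deriv (fun=> 0) s = (fun=> 0) :> ('rV[R]_N -> R).
    exact: differentiable_cst.
  elim: s => //= i s ->; apply/funext => y.
  by rewrite /partial_deriv derive_cst.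
by rewrite s0; exact: compact0.
Qed.

Lemma test_scale (O : set 'rV[R]_N) a f : test_function O f ->
  test_function O (fun x => a * f x).
Proof.
move=> tf; have := test_lin a tf (test_cst0 O).
by under [X in test_function _ X -> _]eq_fun do rewrite addr0.
Qed.

Lemma gnorm_scale (O : set 'rV[R]_N) a f x : test_function O f ->
  gnorm (fun x => a * f x) x = `|a| * gnorm f x.
Proof.
move=> [sf _ _]; rewrite /gnorm -enormZ; congr enorm.
apply/rowP => i; rewrite !mxE /partial_deriv -[RHS]/(a *: 'D_(delta_mx 0 i) f x) -deriveZ//.
exact/diff_derivable/smooth_differentiable.
Qed.

End compact_support.

(** ** Cutting a test function along a partition of its domain *)
Definition cut {R : realType} {N : nat} (B : set 'rV[R]_N) (f : 'rV[R]_N -> R) :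
    'rV[R]_N -> R :=
  fun x => if `[< B x >] then f x else 0.

Section cut.
Context {R : realType} {N : nat}.
Implicit Types (f : 'rV[R]_N -> R) (B O : set 'rV[R]_N).

Lemma cutE B f x : B x -> cut B f x = f x.
Proof. by move=> Bx; rewrite /cut asboolT. Qed.

Lemma cut_out B f x : ~ B x -> cut B f x = 0.
Proof. by move=> Bx; rewrite /cut asboolF. Qed.

(** The cut vanishes near every point outside B, in particular near the boundary
    of B, so that it is as smooth as f. *)
Definition cut_off B f : Prop := forall x, ~ B x -> \near x, cut B f x = 0.

Lemma cut_near B f x : open B -> B x -> \near x, f x = cut B f x.
Proof.
move=> oB Bx; have : nbhs x B by exact: open_nbhs_nbhs.
by apply: filterS => y By; rewrite cutE.
Qed.

Lemma cut_partial B f i : open B -> cut_off B f ->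
  partial_deriv i (cut B f) = cut B (partial_deriv i f) /\
  cut_off B (partial_deriv i f).
Proof.
move=> oB cf.
have E : partial_deriv i (cut B f) = cut B (partial_deriv i f).
  apply/funext => x; have [Bx|Bx] := pselect (B x).
    rewrite cutE// /partial_deriv; apply/esym/near_eq_derive; exact: cut_near.
  by rewrite cut_out// partial_near0//; exact: cf.
split => // x Bx; rewrite -E.
apply: filterS (near_join (cf x Bx)) => y; exact: partial_near0.
Qed.

Lemma cut_foldr B f s : open B -> cut_off B f ->
  foldr partial_deriv (cut B f) s = cut B (foldr partial_deriv f s) /\
  cut_off B (foldr partial_deriv f s).
Proof.
move=> oB cf; elim: s => //= i s [-> cs]; exact: cut_partial.
Qed.

Lemma cut_smooth B f : open B -> cut_off B f -> smooth f -> smooth (cut B f).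
Proof.
move=> oB cf sf s x; have [-> cs] := cut_foldr s oB cf.
have [Bx|Bx] := pselect (B x).
  apply: (near_eq_differentiable (f := foldr partial_deriv f s)); last exact: sf.
  exact: cut_near.
apply: near0_differentiable; exact: cs.
Qed.

Section partition.
Variables (B B' : set 'rV[R]_N).
Hypotheses (oB : open B) (oB' : open B') (BB' : B `&` B' = set0).
Variable f : 'rV[R]_N -> R.
Hypothesis tf : test_function (B `|` B') f.

(** A point outside both open sets is outside the support of f. *)
Lemma test_cut_off : cut_off B f.
Proof.
move=> x Bx; have [B'x|B'x] := pselect (B' x).
  have : nbhs x B' by exact: open_nbhs_nbhs.
  apply: filterS => y B'y; rewrite cut_out// => By.
  by have : (B `&` B') y by []; rewrite BB'.
case: tf => _ _ fB; have : \near x, f x = 0 by apply: fsupport_out => /fB[].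
by apply: filterS => y fy; rewrite /cut fy; case: ifP.
Qed.

Lemma test_cut : test_function B (cut B f).
Proof.
case: (tf) => sf cf fB.
have sub : fsupport (cut B f) `<=` fsupport f.
  apply: closureS => x /=; rewrite /cut; case: ifP => //; by rewrite eqxx.
split; first exact: cut_smooth test_cut_off sf.
  by apply: subclosed_compact sub => //; exact: closed_closure.
move=> x xf; have [//|B'x] := fB x (sub x xf).
have nB' : nbhs x B' by exact: open_nbhs_nbhs.
have [y [/= fy B'y]] := xf _ nB'.
move: fy; rewrite cut_out ?eqxx// => By.
by have : (B `&` B') y by []; rewrite BB'.
Qed.

Lemma grad_cut x : B x -> grad (cut B f) x = grad f x.
Proof.
move=> Bx; apply/rowP => i; rewrite !mxE.
by have [-> _] := cut_partial i oB test_cut_off; rewrite cutE.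
Qed.

Lemma grad_cut_out x : ~ B x -> grad (cut B f) x = 0.
Proof. exact: (test_out_grad test_cut). Qed.

End partition.

Lemma test_cut_split B (B' : set 'rV[R]_N) f p : open B -> open B' -> B `&` B' = set0 ->
  test_function (B `|` B') f -> 0 < p ->
  pint p f = pint p (cut B f) + pint p (cut B' f) /\
  pint p (gnorm f) = pint p (gnorm (cut B f)) + pint p (gnorm (cut B' f)).
Proof.
move=> oB oB' BB' tf p0.
have tf' : test_function (B' `|` B) f by rewrite setUC.
have BB'' : B' `&` B = set0 by rewrite setIC.
have t1 := test_cut oB oB' BB' tf; have t2 := test_cut oB' oB BB'' tf'.
have disj x : B x -> ~ B' x.
  by move=> Bx B'x; have : (B `&` B') x by []; rewrite BB'.
have key (h h1 h2 : 'rV[R]_N -> R) :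
    measurable_fun setT h1 -> measurable_fun setT h2 ->
    (forall x, B x -> h x = h1 x /\ h2 x = 0) ->
    (forall x, ~ B x -> h x = h2 x /\ h1 x = 0) ->
    (\int[@lebesgue_rV R N]_x (`|h x| `^ p)%:E =
     \int[@lebesgue_rV R N]_x (`|h1 x| `^ p)%:E +
     \int[@lebesgue_rV R N]_x (`|h2 x| `^ p)%:E)%E.
  move=> m1 m2 hB hB'; rewrite -ge0_integralD//; last 2 first.
  - exact: measurable_powR_norm.
  - exact: measurable_powR_norm.
  apply: eq_integral => x _; have [Bx|Bx] := pselect (B x).
    by have [-> ->] := hB x Bx; rewrite normr0 powR0 ?gt_eqF// adde0.
  by have [-> ->] := hB' x Bx; rewrite normr0 powR0 ?gt_eqF// add0e.
split; apply: EFin_inj; rewrite EFinD.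
  apply: (etrans (esym (test_pintE tf p0))).
  apply: (etrans _ (congr2 adde (test_pintE t1 p0) (test_pintE t2 p0))).
  apply: key; [exact: test_measurable t1|exact: test_measurable t2| |].
    by move=> x Bx; rewrite cutE// cut_out//; exact: disj.
  move=> x Bx; rewrite (cut_out _ Bx); split => //.
  have [B'x|B'x] := pselect (B' x); first by rewrite cutE.
  by rewrite cut_out// (test_out tf)// => -[].
apply: (etrans (esym (test_pint_gradE tf p0))).
apply: (etrans _ (congr2 adde (test_pint_gradE t1 p0) (test_pint_gradE t2 p0))).
apply: key; [exact: test_measurable_gnorm t1|exact: test_measurable_gnorm t2| |].
  move=> x Bx; rewrite /gnorm (grad_cut oB oB' BB' tf)//.
  by rewrite (grad_cut_out oB' oB BB'' tf') ?enorm0//; exact: disj.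
move=> x Bx; split; last first.
  by rewrite /gnorm (grad_cut_out oB oB' BB' tf)// enorm0.
rewrite /gnorm; have [B'x|B'x] := pselect (B' x).
  by rewrite (grad_cut oB' oB BB'' tf').
by rewrite (grad_cut_out oB' oB BB'' tf')// (test_out_grad tf)// => -[].
Qed.

End cut.

(** * The functional and its maximising sequences *)
Lemma test_sub {R : realType} {N : nat} (O : set 'rV[R]_N) f g :
  test_function O f -> test_function O g -> test_function O (f \- g).
Proof.
move=> tf tg; have -> : f \- g = (fun x => -1 * g x + f x).
  by apply/funext => x /=; rewrite mulN1r addrC.
exact: test_lin.
Qed.

Lemma grad_sub {R : realType} {N : nat} (O : set 'rV[R]_N) f g x :
  test_function O f -> test_function O g ->
  grad (f \- g) x = grad f x - grad g x.
Proof.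
move=> [sf _ _] [sg _ _].
have -> : f \- g = (fun x => -1 * g x + f x).
  by apply/funext => y /=; rewrite mulN1r addrC.
rewrite grad_lin; [|exact: smooth_differentiable|exact: smooth_differentiable].
by rewrite scaleN1r addrC.
Qed.

Section pint_facts.
Context {R : realType} {N : nat}.
Local Notation mu := (@lebesgue_rV R N).
Implicit Types (f g : 'rV[R]_N -> R) (p : R).

Lemma fine_pint_ge0 p f : 0 <= pint p f.
Proof.
by apply: fine_ge0; apply: integral_ge0 => x _; rewrite lee_fin powR_ge0.
Qed.

Lemma pint_comb p (I : finType) (c : I -> R) (h : I -> 'rV[R]_N -> R) :
  (forall i, measurable_fun setT (h i)) -> (forall i, 0 <= c i) ->
  (forall i, (\int[mu]_x (`|h i x| `^ p)%:E < +oo)%E) ->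
  (\int[mu]_x (\sum_i c i * `|h i x| `^ p)%:E = (\sum_i c i * pint p (h i))%:E)%E.
Proof.
move=> mh c0 hfin.
have hE i : (\int[mu]_x (`|h i x| `^ p)%:E = (pint p (h i))%:E)%E.
  rewrite /pint fineK// ge0_fin_numE//.
  by apply: integral_ge0 => x _; rewrite lee_fin powR_ge0.
under eq_integral => x _ do rewrite -sumEFin.
under eq_integral => x _ do under eq_bigr do rewrite EFinM.
rewrite ge0_integral_sum//; last 2 first.
- by move=> i; apply: measurable_funeM; exact: measurable_powR_norm.
- by move=> i x _; rewrite mule_ge0// lee_fin ?powR_ge0.
rewrite -sumEFin; apply: eq_bigr => i _; rewrite ge0_integralZl//.
- by rewrite hE EFinM.
- exact: measurable_powR_norm.
- by rewrite lee_fin.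
Qed.

Lemma measurable_comb p (I : finType) (c : I -> R) (h : I -> 'rV[R]_N -> R) :
  (forall i, measurable_fun setT (h i)) ->
  measurable_fun setT (fun x => (\sum_i c i * `|h i x| `^ p)%:E).
Proof.
move=> mh.
have -> : (fun x => (\sum_i c i * `|h i x| `^ p)%:E) =
   (fun x => (\sum_i ((c i)%:E * (`|h i x| `^ p)%:E)))%E.
  by apply/funext => x; rewrite -sumEFin; apply: eq_bigr => i _; rewrite EFinM.
apply: emeasurable_sum => i; apply: measurable_funeM.
exact: measurable_powR_norm.
Qed.

Lemma le_pint_comb p (I J : finType) (b : J -> R) (f : J -> 'rV[R]_N -> R)
    (c : I -> R) (h : I -> 'rV[R]_N -> R) :
  (forall i, measurable_fun setT (f i)) -> (forall i, 0 <= b i) ->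
  (forall i, (\int[mu]_x (`|f i x| `^ p)%:E < +oo)%E) ->
  (forall i, measurable_fun setT (h i)) -> (forall i, 0 <= c i) ->
  (forall i, (\int[mu]_x (`|h i x| `^ p)%:E < +oo)%E) ->
  (forall x, \sum_i b i * `|f i x| `^ p <= \sum_i c i * `|h i x| `^ p) ->
  \sum_i b i * pint p (f i) <= \sum_i c i * pint p (h i).
Proof.
move=> mf b0 ffin mh c0 hfin le.
rewrite -lee_fin.
rewrite -(pint_comb mf b0 ffin) -(pint_comb mh c0 hfin).
apply: ge0_le_integral => //.
- by move=> x _; rewrite lee_fin sumr_ge0// => i _; rewrite mulr_ge0 ?powR_ge0.
- exact: measurable_comb.
- exact: measurable_comb.
- by move=> x _; rewrite lee_fin.
Qed.

Lemma le_pint22 p (b1 b2 c1 c2 : R) (f1 f2 h1 h2 : 'rV[R]_N -> R) :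
  measurable_fun setT f1 -> measurable_fun setT f2 ->
  measurable_fun setT h1 -> measurable_fun setT h2 ->
  0 <= b1 -> 0 <= b2 -> 0 <= c1 -> 0 <= c2 ->
  (\int[mu]_x (`|f1 x| `^ p)%:E < +oo)%E -> (\int[mu]_x (`|f2 x| `^ p)%:E < +oo)%E ->
  (\int[mu]_x (`|h1 x| `^ p)%:E < +oo)%E -> (\int[mu]_x (`|h2 x| `^ p)%:E < +oo)%E ->
  (forall x, b1 * `|f1 x| `^ p + b2 * `|f2 x| `^ p <=
    c1 * `|h1 x| `^ p + c2 * `|h2 x| `^ p) ->
  b1 * pint p f1 + b2 * pint p f2 <= c1 * pint p h1 + c2 * pint p h2.
Proof.
move=> mf1 mf2 m1 m2 b10 b20 c10 c20 Ff1 Ff2 F1 F2 le.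
pose s (T : Type) (a b : T) (i : bool) : T := if i then a else b.
have sP (a a' : R) (F F' : 'rV[R]_N -> R) :
    \sum_i s _ a a' i * pint p (s _ F F' i) = a * pint p F + a' * pint p F'.
  by rewrite big_bool.
have sN (a a' : R) (F F' : 'rV[R]_N -> R) x :
    \sum_i s _ a a' i * `|s _ F F' i x| `^ p = a * `|F x| `^ p + a' * `|F' x| `^ p.
  by rewrite big_bool.
rewrite -!sP; apply: le_pint_comb.
- by case; [exact: mf1|exact: mf2].
- by case; [exact: b10|exact: b20].
- by case; [exact: Ff1|exact: Ff2].
- by case; [exact: m1|exact: m2].
- by case; [exact: c10|exact: c20].
- by case; [exact: F1|exact: F2].
- by move=> x; rewrite !sN; exact: le.
Qed.

Lemma le_pint3 p (c1 c2 c3 : R) (f h1 h2 h3 : 'rV[R]_N -> R) :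
  measurable_fun setT f -> measurable_fun setT h1 -> measurable_fun setT h2 ->
  measurable_fun setT h3 -> 0 <= c1 -> 0 <= c2 -> 0 <= c3 ->
  (\int[mu]_x (`|f x| `^ p)%:E < +oo)%E ->
  (\int[mu]_x (`|h1 x| `^ p)%:E < +oo)%E -> (\int[mu]_x (`|h2 x| `^ p)%:E < +oo)%E ->
  (\int[mu]_x (`|h3 x| `^ p)%:E < +oo)%E ->
  (forall x, `|f x| `^ p <= c1 * `|h1 x| `^ p + c2 * `|h2 x| `^ p + c3 * `|h3 x| `^ p) ->
  pint p f <= c1 * pint p h1 + c2 * pint p h2 + c3 * pint p h3.
Proof.
move=> mf m1 m2 m3 c10 c20 c30 Ff f1 f2 f3 le.
pose s (T : Type) (a b c : T) (i : option bool) : T :=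
  if i is Some j then (if j then a else b) else c.
have sE (F : option bool -> R) : \sum_i F i = F (Some true) + F (Some false) + F None.
  rewrite (bigD1 None)//= addrC; congr (_ + _).
  rewrite (bigD1 (Some true))//= (bigD1 (Some false))//= big1 ?addr0//.
  by case=> [[]|].
have := @le_pint_comb p (option bool) unit (fun=> 1) (fun=> f) (s _ c1 c2 c3) (s _ h1 h2 h3).
rewrite big_const card_unit/= addr0 mul1r sE/=; apply.
- by move=> _; exact: mf.
- by move=> _; exact: ler01.
- by move=> _; exact: Ff.
- by case=> [[]|]; [exact: m1|exact: m2|exact: m3].
- by case=> [[]|]; [exact: c10|exact: c20|exact: c30].
- by case=> [[]|]; [exact: f1|exact: f2|exact: f3].
- by move=> x; rewrite big_const card_unit/= addr0 mul1r sE; exact: le.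
Qed.

Lemma pint_scale p a f : measurable_fun setT f -> pint p (fun x => a * f x) = `|a| `^ p * pint p f.
Proof.
move=> mf; rewrite /pint.
have -> : (\int[mu]_x (`|a * f x| `^ p)%:E =
    (`|a| `^ p)%:E * \int[mu]_x (`|f x| `^ p)%:E)%E.
  rewrite -ge0_integralZl//.
  - by apply: eq_integral => x _; rewrite normrM powRM// EFinM.
  - exact: measurable_powR_norm.
have fineM (c : R) (y : \bar R) : 0 <= c -> fine (c%:E * y)%E = c * fine y.
  case: y => // c0 /=; rewrite mulr0; move: c0; rewrite le_eqVlt => /orP[/eqP <-|c0];
    by rewrite ?mul0e// ?gt0_muley ?gt0_muleNy ?lte_fin.
by rewrite fineM// powR_ge0.
Qed.

End pint_facts.

(** The functional to be maximised; on the limits of its maximising sequences the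
    eigenvalue equation holds. *)
Definition Jpq {R : realType} {N : nat} (p q : R) (f : 'rV[R]_N -> R) : R :=
  pint q f - pint p (gnorm f).

Lemma test_integrable {R : realType} {N : nat} (O : set 'rV[R]_N) f :
  test_function O f -> (@lebesgue_rV R N).-integrable setT (EFin \o f).
Proof.
move=> tf; apply/integrableP; split.
  by apply/measurable_EFinP; exact: (test_measurable tf).
have := test_pint_lty tf (ltr01 : 0 < (1 : R)).
by under eq_integral do rewrite powRr1//.
Qed.

(** Tangent inequality at a, with the linear term absorbed by Young's
    inequality. *)
Lemma powR_shift {R : realType} (q e : R) : 1 < q -> 0 < e -> exists2 C, 0 <= C &
  forall a d : R, `|a| `^ q <= 1 * `|a + d| `^ q + e * `|a| `^ q + C * `|d| `^ q.
Proof.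
move=> q1 e0; pose t := e / q; have t0 : 0 < t by rewrite divr_gt0//; lra.
exists (q * t `^ (1 - q)); first by rewrite mulr_ge0 ?powR_ge0//; lra.
move=> a d; have qE : e = q * t by rewrite /t mulrC divfK//; apply/eqP; lra.
have H := powR_tangent q1 (normr_ge0 a) (normr_ge0 (a + d)).
have tri : - `|d| <= `|a + d| - `|a|.
  have := ler_normD (a + d) (- d); rewrite addrK normrN; lra.
have young : `|a| `^ (q - 1) * `|d| <= t * `|a| `^ q + t `^ (1 - q) * `|d| `^ q.
  have [dle|dgt] := lerP `|d| (t * `|a|).
    have -> : `|a| `^ q = `|a| `^ (q - 1) * `|a| by rewrite mulrC mulr_powRB1//; lra.
    have : `|a| `^ (q - 1) * `|d| <= `|a| `^ (q - 1) * (t * `|a|).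
      by rewrite ler_wpM2l// powR_ge0.
    have : 0 <= t `^ (1 - q) * `|d| `^ q by rewrite mulr_ge0// powR_ge0.
    lra.
  have -> : `|d| `^ q = `|d| `^ (q - 1) * `|d| by rewrite mulrC mulr_powRB1//; lra.
  have : `|a| `^ (q - 1) <= t `^ (1 - q) * `|d| `^ (q - 1).
    have -> : t `^ (1 - q) = (t^-1) `^ (q - 1).
      by rewrite -powR_inv1 ?(ltW t0)// -powRrM; congr (_ `^ _); ring.
    rewrite -powRM ?invr_ge0 ?(ltW t0)//.
    rewrite ge0_ler_powR ?nnegrE ?mulr_ge0 ?invr_ge0 ?(ltW t0)//; first lra.
    by rewrite mulrC ler_pdivlMr// mulrC ltW.
  move=> h; have : 0 <= t * `|a| `^ q by rewrite mulr_ge0 ?powR_ge0// ltW.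
  have := ler_wpM2r (normr_ge0 d) h; lra.
have : q * `|a| `^ (q - 1) * - `|d| <= q * `|a| `^ (q - 1) * (`|a + d| - `|a|).
  by rewrite ler_wpM2l// mulr_ge0 ?powR_ge0//; lra.
have : q * (`|a| `^ (q - 1) * `|d|) <= q * (t * `|a| `^ q + t `^ (1 - q) * `|d| `^ q).
  by rewrite ler_wpM2l//; lra.
rewrite qE !mulrDr !mulrA mulrN; lra.
Qed.

(** A bounded real sequence converges along an ultrafilter. *)
Lemma ultra_cauchy {R : realType} (U : set_system nat) (g : nat -> R) (B e : R) :
  UltraFilter U -> (forall n, `|g n| <= B) -> 0 < e ->
  exists2 P, U P & forall m n, P m -> P n -> `|g m - g n| <= e.
Proof.
move=> UU gB e0; have PU : ProperFilter U by exact: ultra_proper.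
have := @segment_compact R (- B) B (g @ U) _.
case=> [|l [_ cl]].
  by apply: (@filterS _ U _ setT); [move=> n _; rewrite /= in_itv/= -ler_norml|exact: filterT].
pose P := [set n | `|g n - l| < e / 2].
exists P; last first.
  move=> m n Pm Pn; have -> : g m - g n = (g m - l) - (g n - l) by ring.
  by apply: (le_trans (ler_normB _ _)); rewrite (splitr e) lerD// ltW.
have [//|UP] := in_ultra_setVsetC P UU.
have [|y [/= yP yl]] := cl (~` [set x | `|x - l| < e / 2]) (ball l (e / 2)) UP.
  by apply: nbhsx_ballx; rewrite divr_gt0.
by exfalso; apply: yP; move: yl; rewrite -ball_normE /= distrC.
Qed.

(** The bookkeeping of the Cauchy estimate for two almost maximisers f and g
    with midpoint m: D, A are the two integrals, D alone belongs to f - g, and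
    i1, i2 are the distances to the supremum E. *)
Lemma midpoint_budget {R : realType} (e M Cu C2 D Df Dg Dm Af Ag Am d1 d2 i1 i2 E : R) :
  0 < e -> 0 < M -> 0 <= Cu -> 0 <= C2 -> Df <= M -> Dg <= M -> Af <= M -> Ag <= M ->
  D <= e / (4 * M) * (Df + Dg) + Cu * ((Df + Dg) / 2 - Dm) ->
  Af <= Am + e / (6 * M * (Cu + 1)) * Af + C2 * d1 ->
  Ag <= Am + e / (6 * M * (Cu + 1)) * Ag + C2 * d2 ->
  Am - Dm <= E -> E - i1 < Af - Df -> E - i2 < Ag - Dg ->
  i1 <= e / (6 * (Cu + 1)) -> i2 <= e / (6 * (Cu + 1)) ->
  d1 <= e / (6 * (Cu + 1) * (C2 + 1)) -> d2 <= e / (6 * (Cu + 1) * (C2 + 1)) ->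
  D <= e.
Proof.
move=> e0 M0 Cu0 C20 DfM DgM AfM AgM h1 h2 h3 h4 h5 h6 h7 h8 h9 h10.
have cu : 0 < Cu + 1 by rewrite ltr_wpDl.
have c2 : 0 < C2 + 1 by rewrite ltr_wpDl.
set y := e / (6 * (Cu + 1)) in h7 h8; have y0 : 0 < y by rewrite divr_gt0// mulr_gt0.
have xE : e / (6 * M * (Cu + 1)) = y / M.
  by rewrite /y; field; rewrite !gt_eqF.
have zE : e / (6 * (Cu + 1) * (C2 + 1)) = y / (C2 + 1).
  by rewrite /y; field; rewrite !gt_eqF.
rewrite xE in h2 h3; rewrite zE in h9 h10.
have bA A : A <= M -> y / M * A <= y.
  by move=> AM; rewrite mulrAC ler_pdivrMr// ler_wpM2l// ltW.
have bd d : d <= y / (C2 + 1) -> C2 * d <= y.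
  rewrite ler_pdivlMr// => dy.
  have [d0|d0] := lerP 0 d; last by rewrite (le_trans _ (ltW y0))// mulr_ge0_le0// ltW.
  by apply: le_trans dy; rewrite mulrDr mulr1 mulrC lerDl.
have b1 := bA _ AfM; have b2 := bA _ AgM; have b3 := bd _ h9; have b4 := bd _ h10.
have k : (Df + Dg) / 2 - Dm <= 3 * y by lra.
have k1 : Cu * ((Df + Dg) / 2 - Dm) <= Cu * (3 * y) by rewrite ler_wpM2l.
have k2 : Cu * (3 * y) <= e / 2.
  have -> : e / 2 = (Cu + 1) * (3 * y) by rewrite /y; field; rewrite gt_eqF.
  by rewrite ler_wpM2r ?lerDl// mulr_ge0// ltW.
have k3 : e / (4 * M) * (Df + Dg) <= e / 2.
  have -> : e / 2 = e / (4 * M) * (2 * M) by field; rewrite gt_eqF.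
  by rewrite ler_wpM2l ?divr_ge0 ?(ltW e0) ?mulr_ge0 ?(ltW M0)//; lra.
lra.
Qed.

Section maximising.
Context {R : realType} {N : nat}.
Local Notation mu := (@lebesgue_rV R N).
Variables (O : set 'rV[R]_N) (p q : R).
Hypotheses (q1 : 1 < q) (qp : q < p).
Implicit Types (f g : 'rV[R]_N -> R).

Definition Jsup : R := sup [set Jpq p q f | f in test_function O].

Let p1 : 1 < p. Proof. exact: lt_trans q1 qp. Qed.
Let p0 : 0 < p. Proof. exact: lt_trans p1. Qed.
Let q0 : 0 < q. Proof. exact: lt_trans q1. Qed.

Lemma Jpq_scale a f : test_function O f ->
  Jpq p q (fun x => a * f x) = `|a| `^ q * pint q f - `|a| `^ p * pint p (gnorm f).
Proof.
move=> tf; rewrite /Jpq pint_scale; last exact: test_measurable tf.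
congr (_ - _).
have -> : gnorm (fun x => a * f x) = (fun x => `|a| * gnorm f x).
  by apply/funext => x; exact: gnorm_scale tf.
by rewrite pint_scale ?normr_id//; exact: test_measurable_gnorm tf.
Qed.

Lemma Jpq0 : Jpq p q ((fun=> 0) : 'rV[R]_N -> R) = 0.
Proof.
have t0 := test_cst0 O.
have -> : (fun=> 0) = (fun x => 0 * (fun=> 0 : R) x) :> ('rV[R]_N -> R).
  by apply/funext => x; rewrite mul0r.
by rewrite Jpq_scale// normr0 !powR0 ?gt_eqF// !mul0r subrr.
Qed.

Variable K : R.
Hypothesis H1 : forall f, test_function O f -> pint q f <= pint p (gnorm f) + K.

Lemma K_ge0 : 0 <= K.
Proof. have := H1 (test_cst0 O); have := Jpq0; rewrite /Jpq; lra. Qed.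

Lemma Jsup_has : has_sup [set Jpq p q f | f in test_function O].
Proof.
split; first by exists 0, (fun=> 0); [exact: test_cst0|exact: Jpq0].
by exists K => _ [f tf <-]; rewrite /Jpq lerBlDl; exact: H1.
Qed.

Lemma Jpq_le f : test_function O f -> Jpq p q f <= Jsup.
Proof. by move=> tf; apply: ub_le_sup; [case: Jsup_has|exists f]. Qed.

Lemma Jsup_ge0 : 0 <= Jsup.
Proof. by rewrite -Jpq0; exact/Jpq_le/test_cst0. Qed.

(** Rescaling improves the bound: the two terms have different homogeneity. *)
Lemma energy_bound : exists2 K' : R, 0 <= K' & forall f, test_function O f ->
  pint q f <= 2^-1 * pint p (gnorm f) + K'.
Proof.
pose s : R := 2^-1 `^ ((p - q)^-1).
have s0 : 0 < s by rewrite powR_gt0.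
have sE : s `^ p = 2^-1 * s `^ q.
  have -> : p = (p - q) + q by ring.
  rewrite powRD; last by rewrite (gt_eqF s0) implybT.
  by rewrite /s -powRrM mulVf ?powRr1 ?invr_ge0// subr_eq0 gt_eqF.
have sq0 : 0 < s `^ q by rewrite powR_gt0.
exists (K / s `^ q); first by rewrite divr_ge0 ?K_ge0// ltW.
move=> f tf; have := H1 (test_scale s tf).
have := Jpq_scale s tf; rewrite /Jpq gtr0_norm// sE => h h1.
rewrite -(ler_pM2l sq0) mulrDr [_ * (K / _)]mulrC divfK ?gt_eqF//.
rewrite mulrA [_ * 2^-1]mulrC -lerBlDl; apply: (le_trans _ (_ : Jpq p q (fun x => s * f x) <= K)).
  by rewrite /Jpq h.
by rewrite /Jpq lerBlDl.
Qed.

(** The compactness of the embedding, in the form in which it is used: an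
    approximate control of the L^q norm by finitely many averages. *)
Hypothesis H2 : forall eta : R, 0 < eta ->
  exists (I : finType) (Q : I -> set 'rV[R]_N) (C : R),
    [/\ forall k, measurable (Q k) /\ (mu (Q k) < +oo)%E, 0 <= C &
     forall f, test_function O f -> pint q f <=
       eta * (1 + pint p (gnorm f)) + C * \sum_k `|\int[mu]_(x in Q k) f x|].

Lemma integral_test_le (Q : set 'rV[R]_N) f : test_function O f ->
  measurable Q -> (mu Q < +oo)%E ->
  `|\int[mu]_(x in Q) f x| <= fine (mu Q) + pint q f.
Proof.
move=> tf mQ fQ.
have iQ : mu.-integrable Q (EFin \o f).
  by apply: integrableS (test_integrable tf).
apply: le_trans (le_normr_Rintegral mQ iQ) _.
rewrite -lee_fin /Rintegral fineK; last first.
  by apply: integrable_fin_num => //; exact: (integrable_norm iQ).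
have fE : mu Q \is a fin_num by rewrite ge0_fin_numE.
rewrite EFinD fineK// -(test_pintE tf)//.
apply: (@le_trans _ _ (\int[mu]_(x in Q) (1 + (`|f x| `^ q)%:E))%E).
  have mf := test_measurable tf.
  apply: ge0_le_integral => //.
  - apply/measurable_EFinP; apply: measurableT_comp => //; exact: measurable_funTS.
  - apply: emeasurable_funD; first exact: measurable_cst.
    apply: measurable_funTS; exact: measurable_powR_norm.
  - move=> x _; rewrite -EFinD lee_fin.
    have [fle|fgt] := lerP `|f x| 1; first by rewrite (le_trans fle)// lerDl powR_ge0.
    rewrite -[leLHS]powRr1//; apply: le_trans (ler_powR (ltW fgt) (ltW q1)) _.
    by rewrite lerDr.
rewrite ge0_integralD//; last first.
  apply: measurable_funTS; apply: measurable_powR_norm; exact: test_measurable tf.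
rewrite integral_cst// mul1e leeD2l//.
apply: ge0_subset_integral => //.
by apply: measurable_powR_norm; exact: test_measurable tf.
Qed.

Lemma test_mid f g : test_function O f -> test_function O g ->
  test_function O (fun x => 2^-1 * f x + 2^-1 * g x).
Proof. by move=> tf tg; exact: test_lin tf (test_scale _ tg). Qed.

Lemma grad_mid f g x : test_function O f -> test_function O g ->
  grad (fun x => 2^-1 * f x + 2^-1 * g x) x = 2^-1 *: (grad f x + grad g x).
Proof.
move=> tf tg; rewrite grad_lin.
- rewrite scalerDr; congr (_ + _).
  have -> : (fun y => 2^-1 * g y) = (fun y => 2^-1 * g y + cst 0 y).
    by apply/funext => y; rewrite /cst addr0.
  rewrite grad_lin; last exact: differentiable_cst.
    have -> : grad (cst (0 : R)) x = 0; last by rewrite addr0.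
    by apply/rowP => i; rewrite !mxE /partial_deriv derive_cst.
  apply: smooth_differentiable; exact: test_smooth tg.
- apply: smooth_differentiable; exact: test_smooth tf.
- apply: smooth_differentiable; exact: test_smooth (test_scale _ tg).
Qed.

Lemma pint_mid e : 0 < e -> exists2 C : R, 0 <= C & forall f g,
  test_function O f -> test_function O g ->
  pint q f <= pint q (fun x => 2^-1 * f x + 2^-1 * g x) + e * pint q f +
    C * pint q (f \- g).
Proof.
move=> e0; have [C C0 HC] := powR_shift q1 e0; exists C => // f g tf tg.
have tm := test_mid tf tg; have td := test_sub tf tg.
rewrite -[X in X + _ + _]mul1r; apply: le_pint3;
  [exact: test_measurable tf|exact: test_measurable tm|exact: test_measurable tf
  |exact: test_measurable td|exact: ler01|exact: ltW|exact: C0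
  |exact: test_pint_lty tf _ q0|exact: test_pint_lty tm _ q0
  |exact: test_pint_lty tf _ q0|exact: test_pint_lty td _ q0|].
move=> x; have := HC (f x) (2^-1 * (g x - f x)).
have -> : f x + 2^-1 * (g x - f x) = 2^-1 * f x + 2^-1 * g x by field.
move=> h; apply: (le_trans h); rewrite lerD2l ler_wpM2l//=.
rewrite ge0_ler_powR ?nnegrE ?(ltW q0)// normrM distrC ger0_norm//.
by rewrite ler_piMl// invf_le1// ler1n.
Qed.

(** The integrated form of the pointwise uniform convexity. *)
Lemma pint_grad_sub_le e : 0 < e -> exists2 C : R, 0 <= C & forall f g,
  test_function O f -> test_function O g ->
  pint p (gnorm (f \- g)) <= e * (pint p (gnorm f) + pint p (gnorm g)) +
    C * ((pint p (gnorm f) + pint p (gnorm g)) / 2 -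
      pint p (gnorm (fun x => 2^-1 * f x + 2^-1 * g x))).
Proof.
move=> e0; have [C C0 HC] := @enorm_uniform_convexity R N p e p1 e0.
exists C => // f g tf tg.
have tm := test_mid tf tg; have td := test_sub tf tg.
pose m := fun x => 2^-1 * f x + 2^-1 * g x.
have : 1 * pint p (gnorm (f \- g)) + C * pint p (gnorm m) <=
    (e + C / 2) * pint p (gnorm f) + (e + C / 2) * pint p (gnorm g).
  apply: le_pint22;
    [exact: test_measurable_gnorm td|exact: test_measurable_gnorm tm
    |exact: test_measurable_gnorm tf|exact: test_measurable_gnorm tg
    |exact: ler01|exact: C0| | 
    |exact: test_pint_grad_lty td _ p0|exact: test_pint_grad_lty tm _ p0
    |exact: test_pint_grad_lty tf _ p0|exact: test_pint_grad_lty tg _ p0|].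
  - by rewrite addr_ge0 ?divr_ge0// ltW.
  - by rewrite addr_ge0 ?divr_ge0// ltW.
  - move=> x; rewrite /gnorm (grad_sub x tf tg) (grad_mid x tf tg).
    rewrite !(ger0_norm (enorm_ge0 _)).
    have aux (D F G M : R) : D <= e * (F + G) + C * ((F + G) / 2 - M) ->
      1 * D + C * M <= (e + C / 2) * F + (e + C / 2) * G by lra.
    exact: aux (HC (grad f x) (grad g x)).
have aux (D F G M : R) : 1 * D + C * M <= (e + C / 2) * F + (e + C / 2) * G ->
  D <= e * (F + G) + C * ((F + G) / 2 - M) by lra.
exact: aux.
Qed.

Lemma Jpq_bounded : exists2 M : R, 0 < M & forall f, test_function O f ->
  Jsup - 1 < Jpq p q f -> pint p (gnorm f) <= M /\ pint q f <= M.
Proof.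
have [K' K'0 HK] := energy_bound; exists (2 * K' + 2); first lra.
move=> f tf Jf; have := HK f tf; have := Jsup_ge0; move: Jf; rewrite /Jpq.
have := fine_pint_ge0 q f; have := fine_pint_ge0 p (gnorm f).
set D := pint p (gnorm f); set A := pint q f; clearbody D A; split; lra.
Qed.

#[local] Opaque pint gnorm.

(** Along an ultrafilter the averages in H2 converge, so the L^q distances of a
    maximising sequence tend to 0; then uniform convexity takes care of the
    gradients, since J is at most its supremum at the midpoint of two almost
    maximisers. *)
Theorem maximising_sequence : exists phi : nat -> 'rV[R]_N -> R,
  [/\ forall n, test_function O (phi n),
      forall e, 0 < e -> exists n0, forall m n, (n0 <= m)%N -> (n0 <= n)%N ->
        pint q (phi m \- phi n) <= e /\ pint p (gnorm (phi m \- phi n)) <= e &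
      Jpq p q (phi n) @[n --> \oo] --> Jsup].
Proof.
have [M M0 HM] := Jpq_bounded.
have /choice[f Hf] (n : nat) : exists f, test_function O f /\ Jsup - n.+1%:R^-1 < Jpq p q f.
  have e0 : (0 : R) < n.+1%:R^-1 by rewrite invr_gt0.
  by have [_ [f tf <-] ?] := sup_adherent e0 Jsup_has; exists f.
have tf n : test_function O (f n) by case: (Hf n).
have Jf n : Jsup - n.+1%:R^-1 < Jpq p q (f n) by case: (Hf n).
have fM n : pint p (gnorm (f n)) <= M /\ pint q (f n) <= M.
  apply: HM => //; apply: le_lt_trans (Jf n).
  by rewrite lerB// invf_le1// ler1n.
have [U [UU subU]] := @ultraFilterLemma nat \oo _.
have PU : ProperFilter U by exact: ultra_proper.
have [C1 C10 HC1] := pint_grad_sub_le ltr01.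
pose M' := 2 * M + C1 * M; have M'0 : 0 <= M' by rewrite addr_ge0// mulr_ge0// ltW.
have DM' m n : pint p (gnorm (f m \- f n)) <= M'.
  have [Fm _] := fM m; have [Fn _] := fM n.
  apply: le_trans (HC1 _ _ (tf m) (tf n)) _; rewrite mul1r lerD//.
    have -> : 2 * M = M + M by ring.
    by apply: lerD; [exact: Fm|exact: Fn].
  rewrite ler_wpM2l// lerBlDr.
  apply: (@le_trans _ _ M); last by rewrite lerDl fine_pint_ge0.
  rewrite ler_pdivrMr//; have -> : M * 2 = M + M by ring.
  by apply: lerD; [exact: Fm|exact: Fn].
have step1 e : 0 < e -> exists2 P, U P &
    forall m n, P m -> P n -> pint q (f m \- f n) <= e.
  move=> e0; have eta0 : 0 < e / (2 * (1 + M')) by rewrite divr_gt0// mulr_gt0// ltr_pwDl.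
  have [I [Q [C [mQ C0 HQ]]]] := H2 eta0.
  pose ek := e / (2 * (C * #|I|%:R + 1)).
  have den : 0 < C * #|I|%:R + 1 by rewrite ltr_wpDl// mulr_ge0.
  have ek0 : 0 < ek by rewrite divr_gt0// mulr_gt0.
  have /choice[P HP] (k : I) : exists P, U P /\ forall m n, P m -> P n ->
      `|\int[mu]_(x in Q k) f m x - \int[mu]_(x in Q k) f n x| <= ek.
    have [mQk fQk] := mQ k.
    have [|P UP HP] := @ultra_cauchy _ U (fun n => \int[mu]_(x in Q k) f n x)
        (fine (mu (Q k)) + M) ek UU _ ek0; last by exists P.
    move=> n; apply: le_trans (integral_test_le (tf n) mQk fQk) _.
    by rewrite lerD2l; case: (fM n).
  exists [set n | forall k, P k n].
    by apply: filter_forall => k; case: (HP k).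
  move=> m n Pm Pn; apply: le_trans (HQ _ (test_sub (tf m) (tf n))) _.
  rewrite [leRHS]splitr lerD//.
    apply: (@le_trans _ _ (e / (2 * (1 + M')) * (1 + M'))).
      by rewrite ler_wpM2l ?lerD2l// divr_ge0 ?(ltW e0)// mulr_ge0// addr_ge0.
    by rewrite invfM mulrA divfK// gt_eqF// ltr_pwDl.
  apply: (@le_trans _ _ (C * \sum_(k : I) ek)).
    rewrite ler_wpM2l// ler_sum// => k _; rewrite RintegralB.
    - by have [_ H] := HP k; apply: H; [exact: Pm|exact: Pn].
    - by case: (mQ k).
    - by apply: integrableS (test_integrable (tf m)) => //; case: (mQ k).
    - by apply: integrableS (test_integrable (tf n)) => //; case: (mQ k).
  have -> : \sum_(k : I) ek = ek * #|I|%:R by rewrite sumr_const mulr_natr.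
  have -> : C * (ek * #|I|%:R) = e / 2 * (C * #|I|%:R / (C * #|I|%:R + 1)).
    by rewrite /ek; field; rewrite gt_eqF.
  rewrite -[leRHS]mulr1 ler_wpM2l ?divr_ge0 ?(ltW e0)//.
  by rewrite ler_pdivrMr// mul1r lerDl.
have step2 e : 0 < e -> exists2 P, U P &
    forall m n, P m -> P n -> pint p (gnorm (f m \- f n)) <= e.
  move=> e0; have e'0 : 0 < e / (4 * M) by rewrite divr_gt0// mulr_gt0.
  have [Cu Cu0 HCu] := pint_grad_sub_le e'0.
  have cu : 0 < Cu + 1 by rewrite ltr_wpDl.
  have e20 : 0 < e / (6 * M * (Cu + 1)) by rewrite divr_gt0// !mulr_gt0.
  have [C2 C20 HC2] := pint_mid e20.
  have c2 : 0 < C2 + 1 by rewrite ltr_wpDl.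
  have d0 : 0 < e / (6 * (Cu + 1) * (C2 + 1)) by rewrite divr_gt0// !mulr_gt0.
  have [P UP HP] := step1 _ d0.
  have e30 : 0 < e / (6 * (Cu + 1)) by rewrite divr_gt0// mulr_gt0.
  have [n0 _ Hn0] := near_infty_natSinv_lt (PosNum e30).
  exists (P `&` [set n | (n0 <= n)%N]).
    by apply: filterI => //; apply: subU; exists n0.
  move=> m n [Pm /= n0m] [Pn /= n0n].
  have h1 := HCu _ _ (tf m) (tf n).
  have h2 := HC2 _ _ (tf m) (tf n).
  have h3 := HC2 _ _ (tf n) (tf m).
  have h4 := Jpq_le (test_mid (tf m) (tf n)).
  have h5 := Jf m; have h6 := Jf n; have [D1 A1] := fM m; have [D2 A2] := fM n.
  have h7 : m.+1%:R^-1 < e / (6 * (Cu + 1)) := Hn0 _ n0m.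
  have h8 : n.+1%:R^-1 < e / (6 * (Cu + 1)) := Hn0 _ n0n.
  have h9 := HP m n Pm Pn; have h10 := HP n m Pn Pm.
  have midC : (fun x => 2^-1 * f n x + 2^-1 * f m x) = (fun x => 2^-1 * f m x + 2^-1 * f n x).
    by apply/funext => x; rewrite addrC.
  rewrite midC in h3; rewrite /Jpq in h4 h5 h6.
  exact: (midpoint_budget e0 M0 Cu0 C20 D1 D2 A1 A2 h1 h2 h3 h4 h5 h6
    (ltW h7) (ltW h8) h9 h10).
have /choice[P HP] (k : nat) : exists P, U P /\ forall m n, P m -> P n ->
    pint q (f m \- f n) <= k.+1%:R^-1 /\ pint p (gnorm (f m \- f n)) <= k.+1%:R^-1.
  have k0 : (0 : R) < k.+1%:R^-1 by rewrite invr_gt0.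
  have [P1 U1 H1'] := step1 _ k0; have [P2 U2 H2'] := step2 _ k0.
  exists (P1 `&` P2); split; first exact: filterI.
  by move=> m n [? ?] [? ?]; split; [exact: H1'|exact: H2'].
have /choice[s Hs] (k : nat) : exists n, (k <= n)%N /\ forall j, (j <= k)%N -> P j n.
  have : U ([set n | (k <= n)%N] `&` [set n | forall j : 'I_k.+1, P j n]).
    apply: filterI; first by apply: subU; exists k.
    by apply: filter_forall => j; case: (HP j).
  move=> /filter_ex[n [kn Pn]]; exists n; split => // j jk.
  by have := Pn (Ordinal (jk : (j < k.+1)%N)).
exists (fun k => f (s k)); split; first by move=> n; exact: tf.
  move=> e e0; have [n0 _ Hn0] := near_infty_natSinv_lt (PosNum e0).
  exists n0 => m n n0m n0n; have [_ H] := HP n0.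
  have [_ /(_ n0 n0m) Pm] := Hs m; have [_ /(_ n0 n0n) Pn] := Hs n.
  have := Hn0 n0 (leqnn _) => /= /ltW h.
  by have [h1 h2] := H _ _ Pm Pn; split; [exact: le_trans h1 h|exact: le_trans h2 h].
apply/cvgrPdist_lt => e e0; have [n0 _ Hn0] := near_infty_natSinv_lt (PosNum e0).
exists n0 => // k /= n0k; have [ksk _] := Hs k.
have := Hn0 (s k) (leq_trans n0k ksk) => /= h.
have := Jf (s k); have := Jpq_le (tf (s k)); move: h.
by rewrite ltr_norml; move: (Jpq p q _) (_^-1) => a b; lra.
Qed.

End maximising.

(** * From Cauchy sequences of test functions to the completion *)
Section restriction.
Context {R : realType} {N : nat}.
Local Notation mu := (@lebesgue_rV R N).
Local Notation "''N_' p [ f ]" := (Lnorm mu p%:E (EFin \o f%R)).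
Variable T : set 'rV[R]_N.
Hypothesis mT : measurable T.
Implicit Types (f : 'rV[R]_N -> R) (G : 'rV[R]_N -> 'rV[R]_N) (p q : R).

Lemma restrict_EFin_rV f : (EFin \o f) \_ T = EFin \o (f \_ T).
Proof. by apply/funext => x /=; rewrite !patchE /=; case: ifP. Qed.

Lemma restrict_id f : (forall x, ~ T x -> f x = 0) -> f \_ T = f.
Proof.
move=> f0; apply/funext => x; rewrite patchE; case: ifPn => // /negP xT.
by rewrite f0// => Tx; apply: xT; rewrite inE.
Qed.

Lemma normLE q f : normL q T f = 'N_q[(f \_ T)].
Proof. by rewrite /normL restrict_EFin_rV. Qed.

Lemma measurable_restr f : measurable_fun T f -> measurable_fun setT (f \_ T).
Proof. by move=> mf; apply/(measurable_restrictT f mT). Qed.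

Definition vrestr (G : 'rV[R]_N -> 'rV[R]_N) : 'rV[R]_N -> 'rV[R]_N :=
  fun x => if x \in T then G x else 0.

Lemma measurable_vrestr G : measurable_fun T G -> measurable_fun setT (vrestr G).
Proof.
move=> mG; apply: measurable_fun_rV => i.
rewrite (_ : (fun x => _) = (fun x => G x 0 i) \_ T).
  by apply/(measurable_restrictT _ mT); exact: measurable_fun_coord.
by apply/funext => x; rewrite patchE /vrestr; case: ifP; rewrite ?mxE.
Qed.

Lemma measurable_rV_sub (D : set 'rV[R]_N) (G H : 'rV[R]_N -> 'rV[R]_N) : measurable_fun D G -> measurable_fun D H ->
  measurable_fun D (fun x => G x - H x).
Proof.
move=> mG mH; apply: measurable_fun_rV => i.
rewrite (_ : (fun x => _) = (fun x => G x 0 i - H x 0 i)).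
  by apply: measurable_funB; exact: measurable_fun_coord.
by apply/funext => x; rewrite !mxE.
Qed.

Lemma grad_normE p f g : test_function T f -> test_function T g ->
  grad_norm p T (f \- g) = 'N_p[gnorm (f \- g)].
Proof.
move=> tf tg; rewrite /grad_norm /vnormL normLE restrict_id// => x Tx.
exact: (test_out_gnorm (test_sub tf tg)).
Qed.

Lemma Lnorm_cvg_of_pint q (F : nat -> nat -> 'rV[R]_N -> R) : 0 < q ->
  (forall m n, (\int[mu]_x (`|F m n x| `^ q)%:E < +oo)%E) ->
  (forall e, 0 < e -> exists n0, forall m n, (n0 <= m)%N -> (n0 <= n)%N ->
    pint q (F m n) <= e) ->
  forall e, 0 < e -> exists n0, forall m n, (n0 <= m)%N -> (n0 <= n)%N ->
    ('N_q[F m n] < e%:E)%E.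
Proof.
move=> q0 Ffin h e e0; have e20 : 0 < (e / 2) `^ q by rewrite powR_gt0// divr_gt0.
have [n0 Hn0] := h _ e20; exists n0 => m n n0m n0n.
rewrite (Lnorm_ltE _ _ q0 (ltW e0)); have := Hn0 m n n0m n0n.
rewrite -lee_fin /pint fineK; last first.
  by rewrite ge0_fin_numE//; apply: integral_ge0 => x _; rewrite lee_fin powR_ge0.
move=> /le_lt_trans; apply; rewrite lte_fin gt0_ltr_powR ?nnegrE ?divr_ge0 ?(ltW e0)//.
by rewrite ltr_pdivrMr// ltr_pMr// ltr1n.
Qed.

Section element.
Variables (p q : R) (u : D01p p T).
Hypotheses (p1 : 1 < p) (q1 : 1 < q).

Let tu n : test_function T (u n). Proof. exact: D01_test. Qed.

(** Representatives of the limits which vanish outside T, so that norms over T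
    become norms over the whole space. *)
Definition Lq_rep : 'rV[R]_N -> R := (toLq q u) \_ T.
Definition grad_rep : 'rV[R]_N -> 'rV[R]_N := vrestr (wgrad u).

Lemma normL_sub f n : normL q T (u n \- f) = 'N_q[(u n \- f \_ T)].
Proof.
rewrite normLE; congr Lnorm; apply/funext => x /=; rewrite !patchE.
by case: ifPn => // /negP xT; rewrite (test_out (tu n)) ?subr0// => Tx; apply: xT; rewrite inE.
Qed.

Lemma vnormL_sub G n : vnormL p T (fun x => grad (u n) x - G x) =
  'N_p[(fun x => enorm (grad (u n) x - vrestr G x))].
Proof.
rewrite /vnormL normLE; congr Lnorm; apply/funext => x /=; rewrite patchE /vrestr.
case: ifPn => // /negP xT; rewrite (test_out_grad (tu n)) ?subr0 ?enorm0//.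
by move=> Tx; apply: xT; rewrite inE.
Qed.

(** The condition under which the limit in L^q is meaningful. *)
Definition Lq_convergent : Prop := exists f, measurable_fun T f /\
  normL q T (u n \- f) @[n --> \oo] --> 0%E.

Lemma Lq_rep_spec : Lq_convergent -> measurable_fun setT Lq_rep /\
  'N_q[(u n \- Lq_rep)] @[n --> \oo] --> 0%E.
Proof.
move=> [f Pf].
have [mf cf] : [set f : 'rV[R]_N -> R | measurable_fun T f /\
    normL q T (u n \- f) @[n --> \oo] --> 0%E] (toLq q u) by apply: xgetPex; exists f.
split; first exact: measurable_restr.
rewrite (_ : (fun n => _) = (fun n => normL q T (u n \- toLq q u)))//.
by apply/funext => n; rewrite normL_sub.
Qed.

Lemma Lq_convergent_cauchy : (forall e, 0 < e -> exists n0, forall m n,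
    (n0 <= m)%N -> (n0 <= n)%N -> pint q (u m \- u n) <= e) -> Lq_convergent.
Proof.
move=> cu; have q0 : 0 < q by exact: lt_trans q1.
have mu_ n : measurable_fun setT (u n) by exact: test_measurable (tu n).
have [] := @Lnorm_complete _ _ R mu q u (ltW q1) mu_.
  apply: (@Lnorm_cvg_of_pint q (fun m n => u m \- u n)) => // m n.
  exact: (test_pint_lty (test_sub (tu m) (tu n))).
move=> f mf cf; exists f; split; first exact: measurable_funTS.
have m0 n : measurable_fun setT (u n \- f) by exact: measurable_funB.
apply: (@squeeze_cvge _ _ _ _ (cst 0%E) _ (fun n => 'N_q[(u n \- f)])) => //;
  last exact: cvg_cst.
apply: nearW => n; rewrite normL_sub Lnorm_ge0/=; apply: le_Lnorm => //.
  by apply: measurable_funB => //; apply: measurable_restr; exact: measurable_funTS.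
move=> x /=; rewrite !patchE; case: ifPn => // /negP xT.
rewrite (test_out (tu n)); first by rewrite subr0 normr0.
by move=> Tx; apply: xT; rewrite inE.
Qed.

Lemma grad_rep_spec : measurable_fun setT grad_rep /\
  'N_p[(fun x => enorm (grad (u n) x - grad_rep x))] @[n --> \oo] --> 0%E.
Proof.
suff [G PG] : exists G, measurable_fun T G /\
    vnormL p T (fun x => grad (u n) x - G x) @[n --> \oo] --> 0%E.
  have [mG cG] : [set G : 'rV[R]_N -> 'rV[R]_N | measurable_fun T G /\
      vnormL p T (fun x => grad (u n) x - G x) @[n --> \oo] --> 0%E] (wgrad u).
    by apply: xgetPex; exists G.
  split; first exact: measurable_vrestr.
  rewrite (_ : (fun n => _) = (fun n => vnormL p T (fun x => grad (u n) x - wgrad u x)))//.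
  by apply/funext => n; rewrite vnormL_sub.
have mg n : measurable_fun setT (grad (u n)) by exact: test_measurable_grad (tu n).
have [] := @vLnorm_complete _ _ R mu N p (fun n => grad (u n)) (ltW p1) mg.
  move=> e e0; have [n0 Hn0] := D01_cauchy u e0; exists n0 => m n n0m n0n.
  have := Hn0 m n n0m n0n; rewrite (grad_normE _ (tu m) (tu n)).
  rewrite (_ : gnorm _ = (fun x => enorm (grad (u m) x - grad (u n) x)))//.
  by apply/funext => x; rewrite /gnorm (grad_sub _ (tu m) (tu n)).
move=> G mG cG; exists G; split; first exact: measurable_funTS.
have mGT : measurable_fun setT (vrestr G).
  by apply: measurable_vrestr; exact: measurable_funTS.
apply: (@squeeze_cvge _ _ _ _ (cst 0%E) _
   (fun n => 'N_p[(fun x => enorm (grad (u n) x - G x))])) => //;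
  last exact: cvg_cst.
apply: nearW => n; rewrite vnormL_sub Lnorm_ge0/=; apply: le_Lnorm; first exact: lt_trans p1.
- by apply: measurable_enorm; exact: measurable_rV_sub.
- by apply: measurable_enorm; exact: measurable_rV_sub.
move=> x; rewrite /vrestr; case: ifPn => // /negP xT.
rewrite (test_out_grad (tu n)) ?subr0 ?enorm0 ?normr0//.
by move=> Tx; apply: xT; rewrite inE.
Qed.

End element.

End restriction.

(** * The Euler-Lagrange equation of a maximiser *)
Lemma cvg_normr_powR {R : realType} (q : R) (u : nat -> R) (l : R) : 0 < q ->
  u n @[n --> \oo] --> l -> `|u n| `^ q @[n --> \oo] --> `|l| `^ q.
Proof.
move=> q0 h; apply: (cvg_comp u (fun y : R => `|y| `^ q) h).
exact: normr_powR_continuous.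
Qed.

Lemma cvg_sub_seq {R : realType} (u v : nat -> R) (a b : R) :
  u n @[n --> \oo] --> a -> v n @[n --> \oo] --> b ->
  (u n - v n) @[n --> \oo] --> a - b.
Proof. by move=> ua vb; exact: cvgB. Qed.

Lemma cvg_seq_le {R : realType} (u : nat -> R) (l c : R) :
  u n @[n --> \oo] --> l -> (forall n, u n <= c) -> l <= c.
Proof.
move=> ul uc; rewrite -(cvg_lim _ ul)//; apply: limr_le.
  by apply/cvg_ex; exists l.
exact: nearW.
Qed.

Lemma cvg_seq_ge {R : realType} (u : nat -> R) (l c : R) :
  u n @[n --> \oo] --> l -> (forall n, c <= u n) -> c <= l.
Proof.
move=> ul uc; rewrite -(cvg_lim _ ul)//; apply: limr_ge.
  by apply/cvg_ex; exists l.
exact: nearW.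
Qed.

Section duality_integrands.
Context {R : realType} {N : nat}.
Local Notation mu := (@lebesgue_rV R N).
Local Notation "''N_' p [ f ]" := (Lnorm mu p%:E (EFin \o f%R)).
Implicit Types (f g U psi : 'rV[R]_N -> R) (G W V : 'rV[R]_N -> 'rV[R]_N).

Lemma powR_sub2M (p a : R) : 1 < p -> 0 <= a -> a `^ (p - 2) * a = a `^ (p - 1).
Proof.
move=> p1; rewrite le_eqVlt => /orP[/eqP <-|a0].
  by rewrite mulr0 powR0//; apply/eqP; lra.
rewrite -{2}(powRr1 (ltW a0)) -powRD; last by rewrite (gt_eqF a0) implybT.
by congr (_ `^ _); ring.
Qed.

Lemma powR_mul_le (p a b : R) : 1 < p -> 0 <= a -> 0 <= b ->
  a `^ (p - 1) * b <= a `^ p + b `^ p.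
Proof.
move=> p1 a0 b0; have pE x : 0 <= x -> x `^ p = x `^ (p - 1) * x.
  by move=> x0; rewrite mulrC mulr_powRB1//; lra.
have [ab|/ltW ba] := lerP a b.
  apply: (@le_trans _ _ (b `^ p)); last by rewrite lerDr powR_ge0.
  by rewrite (pE b)// ler_wpM2r// ge0_ler_powR ?nnegrE//; lra.
apply: (@le_trans _ _ (a `^ p)); last by rewrite lerDl powR_ge0.
by rewrite (pE a)// ler_wpM2l// powR_ge0.
Qed.

Lemma pint_integrable p f : measurable_fun setT f ->
  (\int[mu]_x (`|f x| `^ p)%:E < +oo)%E ->
  mu.-integrable setT (EFin \o (fun x => `|f x| `^ p)).
Proof.
move=> mf ffin; apply/integrableP; split; first exact: measurable_powR_norm.
by under eq_integral => x _ do rewrite /= (ger0_norm (powR_ge0 _ _)).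
Qed.

Lemma pint_fineE p f : (\int[mu]_x (`|f x| `^ p)%:E < +oo)%E ->
  (\int[mu]_x (`|f x| `^ p)%:E = (pint p f)%:E)%E.
Proof.
move=> ffin; rewrite /pint fineK// ge0_fin_numE//.
by apply: integral_ge0 => x _; rewrite lee_fin powR_ge0.
Qed.

(** The integrands of the two sides of the weak equation, right-hand side
    first. *)
Definition sdual (q : R) U psi (x : 'rV[R]_N) : R := `|U x| `^ (q - 2) * U x * psi x.
Definition vdual (p : R) W V (x : 'rV[R]_N) : R := enorm (W x) `^ (p - 2) * dotv (W x) (V x).

Lemma measurable_powR_fun (p : R) f : measurable_fun setT f ->
  measurable_fun setT (fun x => f x `^ p).
Proof.
by move=> mf; apply: (@measurableT_comp _ _ _ _ _ _ (@powR R ^~ p)).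
Qed.

Lemma normr_sdual_le q U psi x : 1 < q ->
  `|sdual q U psi x| <= `|U x| `^ q + `|psi x| `^ q.
Proof.
move=> q1; rewrite /sdual !normrM (ger0_norm (powR_ge0 _ _)) powR_sub2M//.
exact: powR_mul_le.
Qed.

Lemma normr_vdual_le p W V x : 1 < p ->
  `|vdual p W V x| <= enorm (W x) `^ (p - 1) * enorm (V x).
Proof.
move=> p1; rewrite /vdual normrM (ger0_norm (powR_ge0 _ _)).
rewrite -powR_sub2M ?enorm_ge0// -mulrA ler_wpM2l ?powR_ge0//.
exact: normr_dotv_le.
Qed.

Lemma measurable_sdual q U psi : measurable_fun setT U -> measurable_fun setT psi ->
  measurable_fun setT (sdual q U psi).
Proof.
move=> mU mpsi; apply: measurable_funM => //; apply: measurable_funM => //.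
by apply: measurable_powR_fun; exact: measurableT_comp.
Qed.

Lemma measurable_vdual p W V : measurable_fun setT W -> measurable_fun setT V ->
  measurable_fun setT (vdual p W V).
Proof.
move=> mW mV; apply: measurable_funM; last exact: measurable_dotv.
by apply: measurable_powR_fun; exact: measurable_enorm.
Qed.

Lemma integrable_sdual q U psi : 1 < q -> measurable_fun setT U -> measurable_fun setT psi ->
  (\int[mu]_x (`|U x| `^ q)%:E < +oo)%E -> (\int[mu]_x (`|psi x| `^ q)%:E < +oo)%E ->
  mu.-integrable setT (EFin \o sdual q U psi).
Proof.
move=> q1 mU mpsi fU fpsi.
apply: (@le_integrable _ _ _ _ _ _ _ (EFin \o (fun x => `|U x| `^ q + `|psi x| `^ q))) => //.
- by apply/measurable_EFinP; exact: measurable_sdual.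
- move=> x _ /=; rewrite lee_fin [leRHS]ger0_norm ?addr_ge0 ?powR_ge0//.
  exact: normr_sdual_le.
- rewrite (_ : EFin \o _ = ((EFin \o (fun x => `|U x| `^ q)%R) \+ (EFin \o (fun x => `|psi x| `^ q)%R))%E)//.
  by apply: integrableD => //; exact: pint_integrable.
Qed.

Lemma integrable_vdual p W V : 1 < p -> measurable_fun setT W -> measurable_fun setT V ->
  (\int[mu]_x (`|enorm (W x)| `^ p)%:E < +oo)%E ->
  (\int[mu]_x (`|enorm (V x)| `^ p)%:E < +oo)%E ->
  mu.-integrable setT (EFin \o vdual p W V).
Proof.
move=> p1 mW mV fW fV.
apply: (@le_integrable _ _ _ _ _ _ _
   (EFin \o (fun x => `|enorm (W x)| `^ p + `|enorm (V x)| `^ p))) => //.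
- by apply/measurable_EFinP; exact: measurable_vdual.
- move=> x _ /=; rewrite lee_fin [leRHS]ger0_norm ?addr_ge0 ?powR_ge0//.
  rewrite !(ger0_norm (enorm_ge0 _)); apply: le_trans (normr_vdual_le _ _ _ p1) _.
  by apply: powR_mul_le; rewrite ?enorm_ge0.
- rewrite (_ : EFin \o _ = ((EFin \o (fun x => `|enorm (W x)| `^ p)%R) \+
      (EFin \o (fun x => `|enorm (V x)| `^ p)%R))%E)//.
  by apply: integrableD => //; apply: pint_integrable => //; exact: measurable_enorm.
Qed.

Lemma sdual_tangent q (t : R) U psi x : 1 < q ->
  `|U x| `^ q + q * (t * sdual q U psi x) <= `|t * psi x + U x| `^ q.
Proof.
move=> q1; apply: le_trans (powR_tangent q1 (normr_ge0 (U x)) (normr_ge0 (t * psi x + U x))).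
rewrite lerD2l -[leRHS]mulrA ler_wpM2l//; first lra.
rewrite -powR_sub2M// -mulrA /sdual mulrCA -!mulrA ler_wpM2l ?powR_ge0//.
rewrite mulrBr -expr2 -[leRHS]/(_ - _) real_normK ?num_real//.
have : U x * (t * psi x + U x) <= `|U x| * `|t * psi x + U x|.
  by rewrite -normrM ler_norm.
rewrite mulrDr -expr2 mulrCA; lra.
Qed.

Lemma vdual_tangent p (t : R) W V x : 1 < p ->
  enorm (t *: V x + W x) `^ p <= enorm (W x) `^ p +
    p * (t * vdual p (fun x => t *: V x + W x) V x).
Proof.
move=> p1; have := @enorm_powR_tangent R N p (t *: V x + W x) (W x) p1.
have -> : W x - (t *: V x + W x) = - (t *: V x) by rewrite opprD addrCA subrr addr0.
rewrite dotvNr dotvZr /vdual; lra.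
Qed.

(** The vector field |w|^(p-2) w is continuous, also at 0, where p - 2 may be
    negative but the norm |w|^(p-1) tends to 0. *)
Lemma vdual_cvg p W V x (t : nat -> R) : 1 < p -> t n @[n --> \oo] --> 0 ->
  vdual p (fun x => t n *: V x + W x) V x @[n --> \oo] --> vdual p W V x.
Proof.
move=> p1 t0.
have cv : (t n *: V x + W x) @[n --> \oo] --> W x.
  rewrite -[X in _ --> X]add0r -(scale0r (V x)).
  by apply: cvgD; [apply: cvgZr_tmp|exact: cvg_cst].
have ce : enorm (t n *: V x + W x) @[n --> \oo] --> enorm (W x).
  by apply: (continuous_cvg _ _ cv); exact: enorm_continuous.
have cp : enorm (t n *: V x + W x) `^ (p - 1) @[n --> \oo] --> enorm (W x) `^ (p - 1).
  have pp : 0 < p - 1 by lra.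
  have := cvg_normr_powR pp ce.
  under eq_fun do rewrite (ger0_norm (enorm_ge0 _)).
  by rewrite (ger0_norm (enorm_ge0 _)).
have [W0|W0] := eqVneq (enorm (W x)) 0.
  have -> : vdual p W V x = 0.
    by rewrite /vdual (enorm_eq0 W0) /dotv big1 ?mulr0// => i _; rewrite mxE mul0r.
  apply: norm_cvg0.
  have c0 : enorm (t n *: V x + W x) `^ (p - 1) * enorm (V x) @[n --> \oo] --> 0.
    rewrite W0 powR0 in cp; last by apply/eqP; lra.
    by rewrite -[X in _ --> X](mul0r (enorm (V x))); apply: cvgM => //; exact: cvg_cst.
  apply: squeeze_cvgr (cvg_cst (0 : R)) c0.
  apply: nearW => n; rewrite normr_ge0/=.
  exact: (@normr_vdual_le p (fun x => t n *: V x + W x) V x p1).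
have cd : dotv (t n *: V x + W x) (V x) @[n --> \oo] --> dotv (W x) (V x).
  under eq_fun do rewrite dotvDl dotvZl.
  have := cvgD (cvgM t0 (cvg_cst (dotv (V x) (V x)))) (cvg_cst (dotv (W x) (V x))).
  by rewrite mul0r add0r; apply.
have E a : 0 <= a -> a != 0 -> a `^ (p - 2) = a `^ (p - 1) / a.
  by move=> a0 an0; rewrite -powR_sub2M// mulfK.
rewrite /vdual (E _ (enorm_ge0 _) W0).
apply: cvg_trans (cvgM (cvgM cp (cvgV W0 ce)) cd).
apply: near_eq_cvg.
have : \forall n \near \oo, enorm (t n *: V x + W x) != 0.
  have W1 : 0 < enorm (W x) by rewrite lt_neqAle eq_sym W0 enorm_ge0.
  move/cvgrPdist_lt : ce => /(_ _ W1); apply: filterS => n h.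
  by apply/eqP => n0; move: h; rewrite n0 subr0 gtr0_norm// ltxx.
by apply: filterS => n n0; rewrite E ?enorm_ge0.
Qed.

Lemma pint_cvg q (f_ : nat -> 'rV[R]_N -> R) f : 1 < q ->
  (forall n, measurable_fun setT (f_ n)) -> measurable_fun setT f ->
  (forall n, (\int[mu]_x (`|f_ n x| `^ q)%:E < +oo)%E) ->
  'N_q[f_ n \- f] @[n --> \oo] --> 0%E ->
  (\int[mu]_x (`|f x| `^ q)%:E < +oo)%E /\
  pint q (f_ n) @[n --> \oo] --> pint q f.
Proof.
move=> q1 mf_ mf ffin cf; have q0 : 0 < q by lra.
have Nf n : 'N_q[f_ n] \is a fin_num by exact: Lnorm_fin.
have Nl := Lnorm_lim_fin (ltW q1) mf_ mf Nf cf.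
have h := Lnorm_cvg (ltW q1) mf_ mf Nl cf.
split; first by rewrite (Lnorm_fin_pint q0 Nl) ltry.
have pE g : 'N_q[g] \is a fin_num -> pint q g = `|fine 'N_q[g]| `^ q.
  by move=> Ng; rewrite /pint (Lnorm_fin_pint q0 Ng)/= ger0_norm// fine_ge0// Lnorm_ge0.
under eq_fun do rewrite pE//; rewrite pE//.
apply: cvg_normr_powR => //; apply: fine_cvg; rewrite fineK//; exact: h.
Qed.

End duality_integrands.

Lemma pint_vcvg {R : realType} {N : nat} p (G_ : nat -> 'rV[R]_N -> 'rV[R]_N)
    (G : 'rV[R]_N -> 'rV[R]_N) : 1 < p ->
  (forall n, measurable_fun setT (G_ n)) -> measurable_fun setT G ->
  (forall n, (\int[@lebesgue_rV R N]_x (`|enorm (G_ n x)| `^ p)%:E < +oo)%E) ->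
  Lnorm (@lebesgue_rV R N) p%:E (EFin \o (fun x => enorm (G_ n x - G x))) @[n --> \oo] --> 0%E ->
  (\int[@lebesgue_rV R N]_x (`|enorm (G x)| `^ p)%:E < +oo)%E /\
  pint p (fun x => enorm (G_ n x)) @[n --> \oo] --> pint p (fun x => enorm (G x)).
Proof.
move=> p1 mG_ mG fG cG; have p0 : 0 < p by lra.
apply: (@pint_cvg _ _ p (fun n x => enorm (G_ n x))) => //.
- by move=> n; exact: measurable_enorm.
- exact: measurable_enorm.
apply: squeeze_cvge (cvg_cst 0%E) cG; apply: nearW => n; rewrite Lnorm_ge0/=.
exact: vLnorm_distl.
Qed.

Section Euler_Lagrange.
Context {R : realType} {N : nat}.
Local Notation mu := (@lebesgue_rV R N).
Local Notation "''N_' p [ f ]" := (Lnorm mu p%:E (EFin \o f%R)).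
Variables (T : set 'rV[R]_N) (p q : R) (phi : nat -> 'rV[R]_N -> R).
Variables (U : 'rV[R]_N -> R) (W : 'rV[R]_N -> 'rV[R]_N) (E : R).
Hypotheses (q1 : 1 < q) (qp : q < p) (tphi : forall n, test_function T (phi n)).
Hypotheses (mU : measurable_fun setT U) (mW : measurable_fun setT W).
Hypothesis cU : 'N_q[phi n \- U] @[n --> \oo] --> 0%E.
Hypothesis cW : 'N_p[(fun x => enorm (grad (phi n) x - W x))] @[n --> \oo] --> 0%E.
Hypothesis cJ : Jpq p q (phi n) @[n --> \oo] --> E.

Let p1 : 1 < p. Proof. exact: lt_trans q1 qp. Qed.
Let p0 : 0 < p. Proof. exact: lt_trans p1. Qed.
Let q0 : 0 < q. Proof. exact: lt_trans q1. Qed.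

Let A := pint q U.
Let D := pint p (fun x => enorm (W x)).

Lemma limit_U : (\int[mu]_x (`|U x| `^ q)%:E < +oo)%E /\
  pint q (phi n) @[n --> \oo] --> A.
Proof.
apply: pint_cvg => // n; first exact: test_measurable (tphi n).
exact: test_pint_lty (tphi n) _ q0.
Qed.

Lemma limit_W : (\int[mu]_x (`|enorm (W x)| `^ p)%:E < +oo)%E /\
  pint p (gnorm (phi n)) @[n --> \oo] --> D.
Proof.
apply: (@pint_vcvg _ _ p (fun n => grad (phi n))) => // n.
  exact: test_measurable_grad (tphi n).
exact: test_pint_grad_lty (tphi n) _ p0.
Qed.

Lemma limit_J : A - D = E.
Proof.
have [_ hA] := limit_U; have [_ hD] := limit_W.
have h : Jpq p q (phi n) @[n --> \oo] --> A - D := cvg_sub_seq hA hD.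
exact: (cvg_unique _ h cJ).
Qed.

(** The function s^q A - s^p D of s > 0 is maximal at s = 1, where its slope is
    q A - p D; the tangent inequalities give the sign of the slope on both sides
    of 1. *)
Lemma limit_scaling : (forall n s, 0 < s -> Jpq p q (fun x => s * phi n x) <= E) ->
  q * A = p * D.
Proof.
move=> opt; have [_ hA] := limit_U; have [_ hD] := limit_W.
have A0 : 0 <= A by exact: fine_pint_ge0.
have D0 : 0 <= D by exact: fine_pint_ge0.
have key s : 0 < s -> s `^ q * A - s `^ p * D <= A - D.
  move=> s0; rewrite limit_J.
  have h : Jpq p q (fun x => s * phi n x) @[n --> \oo] --> s `^ q * A - s `^ p * D.
    under eq_fun => n do rewrite (Jpq_scale p q s (tphi n)) gtr0_norm//.
    by apply: cvg_sub_seq; [apply: cvgM hA|apply: cvgM hD]; exact: cvg_cst.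
  by apply: cvg_seq_le h _ => n; exact: opt.
have slope s : 0 < s -> (q * A - p * s `^ (p - 1) * D) * (s - 1) <= 0.
  move=> s0; have := key s s0.
  have := powR_tangent q1 ler01 (ltW s0); have := powR_tangent p1 (ltW s0) ler01.
  rewrite !powR1 mulr1 => h1 h2 h3.
  have h4 : (1 + q * (s - 1)) * A <= s `^ q * A by rewrite ler_wpM2r.
  have h5 : (s `^ p + p * s `^ (p - 1) * (1 - s)) * D <= 1 * D by rewrite ler_wpM2r.
  lra.
have lims (e : nat -> R) : e n @[n --> \oo] --> (1 : R) ->
    q * A - p * `|e n| `^ (p - 1) * D @[n --> \oo] --> q * A - p * D.
  move=> e1; have pp : 0 < p - 1 by rewrite subr_gt0.
  have := cvg_normr_powR pp e1; rewrite normr1 powR1 => h.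
  have -> : p * D = p * 1 * D by rewrite mulr1.
  apply: cvg_sub_seq; first exact: cvg_cst.
  by apply: cvgM; [apply: cvgM h; exact: cvg_cst|exact: cvg_cst].
have inv0 : (n.+2%:R^-1 : R) @[n --> \oo] --> (0 : R).
  by have := @cvg_harmonic R; rewrite -(cvg_shiftS).
have e1 : (1 + n.+2%:R^-1 : R) @[n --> \oo] --> (1 : R).
  by rewrite -[X in _ --> X]addr0; apply: cvgD => //; exact: cvg_cst.
have e2 : (1 - n.+2%:R^-1 : R) @[n --> \oo] --> (1 : R).
  by rewrite -[X in _ --> X]subr0; apply: cvgB => //; exact: cvg_cst.
have i0 n : (0 : R) < n.+2%:R^-1 by rewrite invr_gt0.
have i1 n : (n.+2%:R^-1 : R) < 1 by rewrite invf_lt1// ltr1n.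
apply/eqP; rewrite -subr_eq0 eq_le; apply/andP; split.
  apply: cvg_seq_le (lims _ e1) _ => n; have s0 : 0 < 1 + (n.+2%:R^-1 : R) by rewrite addr_gt0.
  have := slope _ s0; rewrite (gtr0_norm s0) [X in _ * X](_ : _ = n.+2%:R^-1); last by ring.
  by rewrite pmulr_lle0.
apply: cvg_seq_ge (lims _ e2) _ => n; have s0 : 0 < 1 - (n.+2%:R^-1 : R) by rewrite subr_gt0.
have := slope _ s0; rewrite (gtr0_norm s0) [X in _ * X](_ : _ = - n.+2%:R^-1); last by ring.
by rewrite mulrN oppr_le0 pmulr_lge0.
Qed.

Section variation.
Variable psi : 'rV[R]_N -> R.
Hypothesis tpsi : test_function T psi.

Let b := \int[mu]_x sdual q U psi x.
Let d t := \int[mu]_x vdual p (fun x => t *: grad psi x + W x) (grad psi) x.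

Let mpsi : measurable_fun setT psi. Proof. exact: test_measurable tpsi. Qed.
Let mg : measurable_fun setT (grad psi). Proof. exact: test_measurable_grad tpsi. Qed.

Let ttest t n : test_function T (fun x => t * psi x + phi n x).
Proof. exact: test_lin (tphi n). Qed.

Let gradt t n x : grad (fun x => t * psi x + phi n x) x = t *: grad psi x + grad (phi n) x.
Proof.
by rewrite grad_lin//; apply: smooth_differentiable; [exact: test_smooth tpsi|exact: test_smooth (tphi n)].
Qed.

Let mWt t : measurable_fun setT (fun x => t *: grad psi x + W x).
Proof.
apply: measurable_fun_rV => i.
rewrite (_ : (fun x => _) = (fun x => t * grad psi x 0 i + W x 0 i)).
  apply: measurable_funD; last exact: measurable_fun_coord.
  by apply: measurable_funM; [exact: measurable_cst|exact: measurable_fun_coord].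
by apply/funext => x; rewrite !mxE.
Qed.

Lemma limit_shift_U t : (\int[mu]_x (`|t * psi x + U x| `^ q)%:E < +oo)%E /\
  pint q (fun x => t * psi x + phi n x) @[n --> \oo] --> pint q (fun x => t * psi x + U x).
Proof.
apply: pint_cvg => //.
- by move=> n; exact: test_measurable (ttest t n).
- by apply: measurable_funD => //; apply: measurable_funM => //; exact: measurable_cst.
- by move=> n; exact: test_pint_lty (ttest t n) _ q0.
rewrite (_ : (fun n => _) = (fun n => 'N_q[phi n \- U]))//; apply/funext => n.
by congr Lnorm; apply/funext => x /=; congr EFin; ring.
Qed.

Lemma limit_shift_W t :
  (\int[mu]_x (`|enorm (t *: grad psi x + W x)| `^ p)%:E < +oo)%E /\
  pint p (gnorm (fun x => t * psi x + phi n x)) @[n --> \oo] -->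
  pint p (fun x => enorm (t *: grad psi x + W x)).
Proof.
apply: (@pint_vcvg _ _ p (fun n => grad (fun x => t * psi x + phi n x))) => //.
- by move=> n; exact: test_measurable_grad (ttest t n).
- by move=> n; exact: test_pint_grad_lty (ttest t n) _ p0.
rewrite (_ : (fun n => _) = (fun n => 'N_p[(fun x => enorm (grad (phi n) x - W x))]))//.
apply/funext => n; congr Lnorm; apply/funext => x /=; congr (enorm _)%:E.
by rewrite gradt opprD addrACA subrr add0r.
Qed.

Lemma integrable_U : mu.-integrable setT (EFin \o sdual q U psi).
Proof.
by apply: integrable_sdual => //; [case: limit_U|exact: test_pint_lty tpsi _ q0].
Qed.

Lemma integrable_W t : mu.-integrable setT
  (EFin \o vdual p (fun x => t *: grad psi x + W x) (grad psi)).
Proof.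
apply: integrable_vdual => //; first by case: (limit_shift_W t).
exact: test_pint_grad_lty tpsi _ p0.
Qed.

(** The tangent inequality is used at U for the first integral and at the
    perturbed point for the second one, which is why the derivative term of the
    gradient still depends on t. *)
Lemma variation_ineq t C : 0 < t ->
  (forall n, Jpq p q (fun x => t * psi x + phi n x) <= E + C * t `^ q) ->
  q * b <= p * d t + C * t `^ (q - 1).
Proof.
move=> t0 opt; have [fU hU] := limit_shift_U t; have [fW hW] := limit_shift_W t.
have [fU0 _] := limit_U; have [fW0 _] := limit_W.
have key : pint q (fun x => t * psi x + U x) -
    pint p (fun x => enorm (t *: grad psi x + W x)) <= E + C * t `^ q.
  by apply: cvg_seq_le (cvg_sub_seq hU hW) _ => n; exact: opt.
have iU0 := pint_integrable mU fU0.
have iW0 := pint_integrable (measurable_enorm mW) fW0.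
have iU := @pint_integrable _ _ q (fun x => t * psi x + U x) _ fU.
have iW := @pint_integrable _ _ p (fun x => enorm (t *: grad psi x + W x))
  (measurable_enorm (mWt t)) fW.
have k1 : A + q * t * b <= pint q (fun x => t * psi x + U x).
  have -> : A + q * t * b = \int[mu]_x (`|U x| `^ q + q * t * sdual q U psi x).
    rewrite RintegralD//; first by rewrite RintegralZl//; exact: integrable_U.
    exact: (integrableZl _ (q * t) integrable_U).
  apply: le_Rintegral => //.
  - exact: (integrableD _ iU0 (integrableZl _ (q * t) integrable_U)).
  - by apply: iU; apply: measurable_funD => //; apply: measurable_funM.
  - by move=> x _; rewrite -mulrA; exact: sdual_tangent.
have k2 : pint p (fun x => enorm (t *: grad psi x + W x)) <= D + p * t * d t.
  have -> : D + p * t * d t = \int[mu]_x (`|enorm (W x)| `^ p + p * t *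
      vdual p (fun x => t *: grad psi x + W x) (grad psi) x).
    rewrite RintegralD//; first by rewrite RintegralZl//; exact: integrable_W.
    exact: (integrableZl _ (p * t) (integrable_W t)).
  apply: le_Rintegral => //.
  - exact: (integrableD _ iW0 (integrableZl _ (p * t) (integrable_W t))).
  - move=> x _; rewrite !(ger0_norm (enorm_ge0 _)) -mulrA.
    exact: (@vdual_tangent _ _ p t W (grad psi) x p1).
have tq : t `^ q = t * t `^ (q - 1) by rewrite mulr_powRB1// ltW.
rewrite tq -limit_J in key; rewrite -(ler_pM2l t0).
move: k1 k2 key; set a' := pint q _; set d' := pint p _; lra.
Qed.

(** Dominated convergence, with the p-th power of |grad psi| + |W| as a bound. *)
Lemma vdual_integral_cvg (t : nat -> R) : (forall n, 0 < t n <= 1) ->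
  t n @[n --> \oo] --> 0 -> d (t n) @[n --> \oo] --> \int[mu]_x vdual p W (grad psi) x.
Proof.
move=> t01 t0; pose S x := enorm (grad psi x) + enorm (W x).
have S0 x : 0 <= S x by rewrite addr_ge0 ?enorm_ge0.
have mS : measurable_fun setT S.
  by apply: measurable_funD; exact: measurable_enorm.
have [fW0 _] := limit_W.
have fS : (\int[mu]_x (`|S x| `^ p)%:E < +oo)%E.
  have fg := test_pint_grad_lty tpsi p0.
  apply: (@le_lt_trans _ _ (\int[mu]_x ((2 `^ p)%:E *
     ((`|gnorm psi x| `^ p)%:E + (`|enorm (W x)| `^ p)%:E)))%E).
    apply: ge0_le_integral => //.
    - exact: measurable_powR_norm.
    - apply: measurable_funeM; apply: emeasurable_funD; apply: measurable_powR_norm.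
        exact: measurable_enorm.
      exact: measurable_enorm.
    - move=> x _; rewrite -EFinD -EFinM lee_fin (ger0_norm (S0 x)).
      by rewrite !(ger0_norm (enorm_ge0 _)); apply: powRD_le; rewrite ?enorm_ge0.
  rewrite ge0_integralZl//; last 2 first.
  - apply: emeasurable_funD; apply: measurable_powR_norm; exact: measurable_enorm.
  - by move=> x _; rewrite adde_ge0// lee_fin powR_ge0.
  rewrite ge0_integralD//; last 2 first.
  - by apply: measurable_powR_norm; exact: measurable_enorm.
  - by apply: measurable_powR_norm; exact: measurable_enorm.
  by rewrite (pint_fineE fg) (pint_fineE fW0) -EFinD -EFinM ltry.
have iS := pint_integrable mS fS.
pose F n x := (vdual p (fun x => t n *: grad psi x + W x) (grad psi) x)%:E.
have cF x : F n x @[n --> \oo] --> (vdual p W (grad psi) x)%:E.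
  by apply: cvg_EFin; [exact: nearW|exact: vdual_cvg].
have := @dominated_cvg _ _ R mu setT measurableT F _ _ _ (fun x _ => cF x) _ iS _.
move=> H; have {}H : (\int[mu]_x F n x)%E @[n --> \oo] -->
    (\int[mu]_x (vdual p W (grad psi) x)%:E)%E.
  apply: H => //.
  - by move=> n; apply/measurable_EFinP; exact: measurable_vdual.
  - move=> n x _; rewrite /F lee_fin (ger0_norm (S0 x)).
    apply: le_trans (@normr_vdual_le _ _ p _ _ x p1) _.
    have /andP[tn0 tn1] := t01 n.
    have h1 : enorm (t n *: grad psi x + W x) <= S x.
      rewrite (le_trans (enormD _ _))// lerD2r enormZ gtr0_norm//.
      by rewrite ler_piMl ?enorm_ge0.
    have -> : S x `^ p = S x `^ (p - 1) * S x by rewrite mulrC mulr_powRB1.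
    apply: ler_pM; rewrite ?powR_ge0 ?enorm_ge0//.
      by rewrite ge0_ler_powR ?nnegrE ?enorm_ge0// subr_ge0 ltW.
    by rewrite lerDl enorm_ge0.
have fin0 : (\int[mu]_x (vdual p W (grad psi) x)%:E)%E \is a fin_num.
  have iv := integrable_vdual p1 mW mg fW0 (test_pint_grad_lty tpsi p0).
  apply: (@integrable_fin_num _ _ _ mu setT measurableT (EFin \o vdual p W (grad psi))).
  exact: iv.
by apply: fine_cvg; rewrite /Rintegral fineK.
Qed.

Lemma variation_limit C :
  (forall n t, 0 < t -> Jpq p q (fun x => t * psi x + phi n x) <= E + C * t `^ q) ->
  q * b <= p * \int[mu]_x vdual p W (grad psi) x.
Proof.
move=> opt; pose t n : R := n.+1%:R^-1.
have t01 n : 0 < t n <= 1 by rewrite invr_gt0 ltr0n/= invf_le1// ler1n.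
have t0 : t n @[n --> \oo] --> 0 by exact: cvg_harmonic.
have qq : 0 < q - 1 by rewrite subr_gt0.
have ct : t n `^ (q - 1) @[n --> \oo] --> 0.
  have := cvg_normr_powR qq t0; rewrite normr0 powR0 ?gt_eqF//.
  by under eq_fun => n do rewrite (gtr0_norm (proj1 (andP (t01 n)))).
have h : p * d (t n) + C * t n `^ (q - 1) @[n --> \oo] -->
    p * (\int[mu]_x vdual p W (grad psi) x) + C * 0.
  apply: cvgD; apply: cvgM; [exact: cvg_cst|exact: vdual_integral_cvg|exact: cvg_cst|exact: ct].
rewrite mulr0 addr0 in h; apply: cvg_seq_ge h _ => n; have /andP[tn0 tn1] := t01 n.
by apply: variation_ineq => // m; exact: opt.
Qed.

End variation.
End Euler_Lagrange.

(** * From maximisers to eigenvalues *)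
Section completion_limits.
Context {R : realType} {N : nat}.
Local Notation mu := (@lebesgue_rV R N).
Local Notation "''N_' p [ f ]" := (Lnorm mu p%:E (EFin \o f%R)).
Variables (T : set 'rV[R]_N) (p q : R).
Hypotheses (mT : measurable T) (q1 : 1 < q) (qp : q < p).

Let p1 : 1 < p. Proof. exact: lt_trans q1 qp. Qed.
Let p0 : 0 < p. Proof. exact: lt_trans p1. Qed.
Let q0 : 0 < q. Proof. exact: lt_trans q1. Qed.

Lemma D01p_of_cauchy (phi : nat -> 'rV[R]_N -> R) :
  (forall n, test_function T (phi n)) ->
  (forall e, 0 < e -> exists n0, forall m n, (n0 <= m)%N -> (n0 <= n)%N ->
    pint q (phi m \- phi n) <= e /\ pint p (gnorm (phi m \- phi n)) <= e) ->
  exists u : D01p p T, (forall n, u n = phi n) /\ Lq_convergent q u.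
Proof.
move=> tphi cphi.
have cp : forall e : R, 0 < e -> exists n0 : nat, forall m n : nat,
    (n0 <= m)%N -> (n0 <= n)%N -> (grad_norm p T (phi m \- phi n)%R < e%:E)%E.
  have := @Lnorm_cvg_of_pint _ _ p (fun m n => gnorm (phi m \- phi n)) p0.
  move=> H e e0; have [| |n0 Hn0] := H _ _ e e0.
  - by move=> m n; exact: test_pint_grad_lty (test_sub (tphi m) (tphi n)) _ p0.
  - move=> e' /cphi[n0 Hn0]; exists n0 => m n n0m n0n.
    by case: (Hn0 m n n0m n0n).
  exists n0 => m n n0m n0n; rewrite (grad_normE _ (tphi m) (tphi n)).
  exact: Hn0.
exists (MkD01p tphi cp); split => //.
apply: Lq_convergent_cauchy => // e /cphi[n0 Hn0]; exists n0 => m n n0m n0n.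
by case: (Hn0 m n n0m n0n).
Qed.

Section element_limits.
Variable u : D01p p T.

Let tu n : test_function T (u n). Proof. exact: D01_test. Qed.

Lemma element_grad_limit : (\int[mu]_x (`|enorm (grad_rep u x)| `^ p)%:E < +oo)%E /\
  pint p (gnorm (u n)) @[n --> \oo] --> pint p (fun x => enorm (grad_rep u x)).
Proof.
have [mG cG] := @grad_rep_spec _ _ _ mT _ u p1.
apply: (@pint_vcvg _ _ p (fun n => grad (u n))) => // n.
  exact: test_measurable_grad (tu n).
exact: test_pint_grad_lty (tu n) _ p0.
Qed.

Lemma energyE : energy u = (pint p (fun x => enorm (grad_rep u x)))%:E.
Proof.
have [fG _] := element_grad_limit; rewrite -(pint_fineE fG) /energy.
rewrite integral_mkcond; apply: eq_integral => x _.
rewrite patchE /grad_rep /vrestr; case: ifP => _.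
  by rewrite (ger0_norm (enorm_ge0 _)).
by rewrite enorm0 normr0 powR0// gt_eqF.
Qed.

Lemma energy_limit D : pint p (gnorm (u n)) @[n --> \oo] --> D -> energy u = D%:E.
Proof.
move=> h; rewrite energyE; congr EFin.
by have [_ h'] := element_grad_limit; exact: (cvg_unique _ h' h).
Qed.

Lemma D01norm_neq0 D : pint p (gnorm (u n)) @[n --> \oo] --> D -> 0 < D -> D01norm u <> 0%E.
Proof.
move=> h D0; have [mG cG] := @grad_rep_spec _ _ _ mT _ u p1.
have Nn n : grad_norm p T (u n) = 'N_p[(fun x => enorm (grad (u n) x))].
  rewrite /grad_norm /vnormL normLE restrict_id// => x Tx.
  by rewrite (test_out_grad (tu n)) ?enorm0.
have fN n : 'N_p[(fun x => enorm (grad (u n) x))] \is a fin_num.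
  by apply: Lnorm_fin => //; exact: test_pint_grad_lty (tu n) _ p0.
have [fG hN] := vLnorm_cvg (ltW p1) (fun n => test_measurable_grad (tu n)) mG fN cG.
rewrite /D01norm; under eq_fun do rewrite Nn.
rewrite (cvg_lim _ hN)// => N0.
have [_ h'] := element_grad_limit.
have DE : D = pint p (fun x => enorm (grad_rep u x)) by exact: (cvg_unique _ h h').
have := congr1 fine (Lnorm_fin_pint p0 fG); rewrite N0 /= powR0; last by rewrite gt_eqF.
by move=> Z; move: D0; rewrite DE [X in 0 < X]Z ltxx.
Qed.

Lemma normL_limit A : Lq_convergent q u -> pint q (u n) @[n --> \oo] --> A ->
  normL q T (toLq q u) = (A `^ q^-1)%:E.
Proof.
move=> cu h; have [mU cU] := Lq_rep_spec mT cu.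
have [fU hU] := pint_cvg q1 (fun n => test_measurable (tu n)) mU
  (fun n => test_pint_lty (tu n) q0) cU.
rewrite normLE -/(Lq_rep q u) LnormE (pint_fineE fU) poweR_EFin.
by rewrite (cvg_unique _ h hU).
Qed.

(** On the sphere the sequence does converge in L^q: otherwise the chosen
    representative would be 0, of norm 0. *)
Lemma sphere_limit : sphere_pq T p q u -> pint q (u n) @[n --> \oo] --> (1 : R).
Proof.
move=> su; have cu : Lq_convergent q u.
  have [//|nu] := pselect (Lq_convergent q u); exfalso.
  have t0 : toLq q u = (fun=> 0).
    by apply: xgetPN => f Pf; apply: nu; exists f.
  have := su; rewrite /sphere_pq/= t0 normLE restrict_id// LnormE.
  under eq_integral do rewrite normr0 powR0 ?gt_eqF//.
  rewrite integral0 -[0%E]/(0%:E) poweR_EFin powR0 ?invr_neq0 ?gt_eqF// => /eqP.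
  by rewrite eqe eq_sym oner_eq0.
have [mU cU] := Lq_rep_spec mT cu.
have [fU hU] := pint_cvg q1 (fun n => test_measurable (tu n)) mU
  (fun n => test_pint_lty (tu n) q0) cU.
suff <- : pint q (Lq_rep q u) = 1 by [].
have := su; rewrite /sphere_pq/= normLE -/(Lq_rep q u) => N1.
have qn0 : q != 0 by rewrite gt_eqF.
by rewrite /pint -(Lnorm_powR _ _ qn0) N1 poweR_EFin powR1.
Qed.

Lemma weak_solution_of_dual (lambda A : R) : Lq_convergent q u ->
  pint q (u n) @[n --> \oo] --> A -> 0 < A ->
  (forall psi, test_function T psi ->
    q * (\int[mu]_x sdual q (Lq_rep q u) psi x) =
    p * \int[mu]_x vdual p (grad_rep u) (grad psi) x) ->
  lambda = q / p * A `^ (- ((p - q) / q)) -> weak_solution q lambda u.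
Proof.
move=> cu hA A0 H lE psi tpsi.
have -> : \int[mu]_(x in T) (enorm (wgrad u x) `^ (p - 2) * dotv (wgrad u x) (grad psi x)) =
    \int[mu]_x vdual p (grad_rep u) (grad psi) x.
  rewrite /Rintegral integral_mkcond; congr fine; apply: eq_integral => x _.
  rewrite patchE /vdual /grad_rep /vrestr; case: ifPn => // /negP xT.
  by rewrite enorm0 /dotv big1 ?mulr0// => i _; rewrite mxE mul0r.
have -> : \int[mu]_(x in T) (`|toLq q u x| `^ (q - 2) * toLq q u x * psi x) =
    \int[mu]_x sdual q (Lq_rep q u) psi x.
  rewrite /Rintegral integral_mkcond; congr fine; apply: eq_integral => x _.
  rewrite patchE /sdual /Lq_rep patchE; case: ifPn => // /negP xT.
  by rewrite (test_out tpsi) ?mulr0// => Tx; apply: xT; rewrite inE.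
rewrite (normL_limit cu hA)/= -powRrM lE.
have -> : q / p * A `^ (- ((p - q) / q)) * A `^ (q^-1 * (p - q)) = q / p.
  rewrite -mulrA -powRD; last by rewrite (gt_eqF A0) implybT.
  by rewrite [X in _ `^ X](_ : _ = 0) ?powRr0 ?mulr1//; ring.
rewrite mulrAC [q * _]H //.
by rewrite mulrAC divff ?mul1r// gt_eqF.
Qed.

End element_limits.
End completion_limits.

(** The eigenvalue attached to the supremum E of the functional on a union of
    balls: the integral A of |u|^q for a maximiser u satisfies E = A - (q/p) A,
    and the Euler-Lagrange equation gives the factor q/p. *)
Definition eigen_of {R : realType} (p q E : R) : R :=
  q / p * (E * p / (p - q)) `^ (- ((p - q) / q)).

Section eigenvalues.
Context {R : realType} {N : nat}.
Local Notation mu := (@lebesgue_rV R N).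
Variables (p q : R).
Hypotheses (q1 : 1 < q) (qp : q < p).

Let p1 : 1 < p. Proof. exact: lt_trans q1 qp. Qed.
Let p0 : 0 < p. Proof. exact: lt_trans p1. Qed.
Let q0 : 0 < q. Proof. exact: lt_trans q1. Qed.

Definition coercive (O : set 'rV[R]_N) := exists K, forall f,
  test_function O f -> pint q f <= pint p (gnorm f) + K.

Definition compactly_embedded (O : set 'rV[R]_N) := forall eta : R, 0 < eta ->
  exists (I : finType) (Q : I -> set 'rV[R]_N) (C : R),
    [/\ forall k, measurable (Q k) /\ (mu (Q k) < +oo)%E, 0 <= C &
     forall f, test_function O f -> pint q f <=
       eta * (1 + pint p (gnorm f)) + C * \sum_k `|\int[mu]_(x in Q k) f x|].

Section one_domain.
Variables (O O' T : set 'rV[R]_N).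
Hypotheses (mT : measurable T) (oO : open O) (oO' : open O') (OO' : O `&` O' = set0)
  (TE : T = O `|` O').
Hypotheses (cO : coercive O) (kO : compactly_embedded O).
Let E := Jsup O p q.
Hypothesis E0 : 0 < E.
Let A := E * p / (p - q).

Let A0 : 0 < A.
Proof. by rewrite divr_gt0 ?subr_gt0// mulr_gt0. Qed.

Lemma ler_split_budget (a1 a2 a3 a4 a5 b : R) : a1 - a3 <= b -> a2 <= a5 -> 0 <= a4 ->
  a1 + a2 - (a3 + a4) <= b + a5.
Proof. by move=> *; lra. Qed.

(** On O the perturbed function competes with the maximiser; on O' it is t psi,
    whose contribution is at most t^q A(psi). *)
Lemma Jpq_perturb f psi t : test_function O f -> test_function T psi -> 0 < t ->
  Jpq p q (fun x => t * psi x + f x) <= E + pint q psi * t `^ q.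
Proof.
move=> tf tpsi t0; have [K HK] := cO.
have OT : O `<=` T by rewrite TE; exact: subsetUl.
have tg : test_function (O `|` O') (fun x => t * psi x + f x).
  by rewrite -TE; apply: test_lin => //; exact: test_functionS tf.
have tpsi' : test_function (O' `|` O) psi by rewrite setUC -TE.
have O'O : O' `&` O = set0 by rewrite setIC.
have disj x : O' x -> ~ O x.
  by move=> O'x Ox; have : (O `&` O') x by []; rewrite OO'.
have [sq _] := test_cut_split oO oO' OO' tg q0.
have [_ sp] := test_cut_split oO oO' OO' tg p0.
have tc := test_cut oO oO' OO' tg.
have h1 : Jpq p q (cut O (fun x => t * psi x + f x)) <= E.
  exact: (Jpq_le q1 qp HK tc).
have cE : cut O' (fun x => t * psi x + f x) = (fun x => t * cut O' psi x).
  apply/funext => x; have [xO|xO] := pselect (O' x); last by rewrite !cut_out ?mulr0.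
  by rewrite !cutE// (test_out tf (disj x xO)) addr0.
have h2 : pint q (cut O' (fun x => t * psi x + f x)) <= pint q psi * t `^ q.
  rewrite cE pint_scale; last exact: test_measurable (test_cut oO' oO O'O tpsi').
  rewrite gtr0_norm// mulrC ler_wpM2r ?powR_ge0//.
  have [-> _] := test_cut_split oO' oO O'O tpsi' q0.
  by rewrite lerDl fine_pint_ge0.
have h3 := fine_pint_ge0 p (gnorm (cut O' (fun x => t * psi x + f x))).
by rewrite /Jpq sq sp; exact: ler_split_budget h1 h2 h3.
Qed.

(** A perturbation t psi supported in the whole of T costs at most t^q A(psi) on
    the other piece, which is of higher order than t since q > 1; hence the weak
    equation holds on T for the maximiser on O extended by 0. *)
Lemma eigenfunction_exists : exists u : D01p p T,
  [/\ forall e, 0 < e -> exists n0, forall m n, (n0 <= m)%N -> (n0 <= n)%N ->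
        pint q (u m \- u n) <= e /\ pint p (gnorm (u m \- u n)) <= e,
      pint q (u n) @[n --> \oo] --> A,
      pint p (gnorm (u n)) @[n --> \oo] --> q / p * A &
      weak_solution q (eigen_of p q E) u].
Proof.
have [K HK] := cO.
have [phi [tphi cphi cJ]] := maximising_sequence q1 qp HK kO.
have OT : O `<=` T by rewrite TE; exact: subsetUl.
have tphiT n : test_function T (phi n) by exact: test_functionS (tphi n).
have [u [uE cu]] := D01p_of_cauchy mT q1 qp tphiT cphi.
have {}uE : (u : nat -> _) = phi by apply/funext.
have [mU cU] := Lq_rep_spec mT cu.
have [mW cW] := grad_rep_spec mT u p1.
rewrite uE in cU cW.
have [fU hA] := limit_U q1 tphiT mU cU.
have [fW hD] := limit_W q1 qp tphiT mW cW.
have hE := limit_J q1 qp tphiT mU mW cU cW cJ.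
have hS : q * pint q (Lq_rep q u) = p * pint p (fun x => enorm (grad_rep u x)).
  apply: (limit_scaling q1 qp tphiT mU mW cU cW cJ) => n s s0.
  exact: (Jpq_le q1 qp HK (test_scale s (tphi n))).
have pq0 : p - q != 0 by rewrite gt_eqF ?subr_gt0.
have AE : pint q (Lq_rep q u) = A.
  rewrite /A /E -hE.
  have -> : pint p (fun x => enorm (grad_rep u x)) = q / p * pint q (Lq_rep q u).
    by rewrite mulrAC hS mulrAC divff ?mul1r// gt_eqF.
  by field; rewrite pq0 gt_eqF.
have DE : pint p (fun x => enorm (grad_rep u x)) = q / p * A.
  by rewrite -AE mulrAC hS mulrAC divff ?mul1r// gt_eqF.
rewrite AE in hA; rewrite DE in hD.
exists u; split; [by rewrite uE|by rewrite uE|by rewrite uE|].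
apply: (weak_solution_of_dual mT q1 qp cu (A := A) _ A0 _ erefl); first by rewrite uE.
move=> psi tpsi.
have opt f n t : test_function T f -> 0 < t ->
    Jpq p q (fun x => t * f x + phi n x) <= E + pint q f * t `^ q.
  by move=> tf t0; exact: Jpq_perturb.
apply/eqP; rewrite eq_le; apply/andP; split.
  apply: (variation_limit q1 qp tphiT mU mW cU cW cJ tpsi (C := pint q psi)) => n t t0.
  exact: opt.
have tN := test_scale (-1) tpsi.
have := variation_limit q1 qp tphiT mU mW cU cW cJ tN (C := pint q (fun x => -1 * psi x))
  (fun n t t0 => opt _ n t tN t0).
have -> : \int[mu]_x sdual q (Lq_rep q u) (fun x => -1 * psi x) x =
    - \int[mu]_x sdual q (Lq_rep q u) psi x.
  rewrite -[RHS]mulN1r -RintegralZl//.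
    by apply: eq_Rintegral => x _; rewrite /sdual; ring.
  by apply: integrable_U tpsi.
have -> : \int[mu]_x vdual p (grad_rep u) (grad (fun x => -1 * psi x)) x =
    - \int[mu]_x vdual p (grad_rep u) (grad psi) x.
  rewrite -[RHS]mulN1r -RintegralZl//.
    apply: eq_Rintegral => x _; rewrite /vdual.
    have -> : grad (fun x => -1 * psi x) x = - grad psi x.
      rewrite (_ : (fun x => -1 * psi x) = (fun=> 0 : R) \- psi); last first.
        by apply/funext => y /=; rewrite mulN1r sub0r.
      rewrite (grad_sub x (test_cst0 T) tpsi) (_ : grad (fun=> 0) x = 0) ?sub0r//.
      by apply: (test_out_grad (test_cst0 set0)).
    by rewrite dotvNr; ring.
  exact: integrable_vdual p1 mW (test_measurable_grad tpsi) fW (test_pint_grad_lty tpsi p0).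
by rewrite !mulrN lerN2.
Qed.

Lemma eigen_of_Spec : Spec T p q (eigen_of p q E).
Proof.
have [u [cu hA hD ws]] := eigenfunction_exists; exists u; split => //.
by apply: (D01norm_neq0 mT q1 qp hD); rewrite mulr_gt0// divr_gt0.
Qed.

End one_domain.

Section first.
Variable T : set 'rV[R]_N.
Hypotheses (mT : measurable T) (oT : open T).
Hypotheses (cT : coercive T) (kT : compactly_embedded T).
Let E := Jsup T p q.
Hypothesis E0 : 0 < E.
Let A := E * p / (p - q).

Let A0 : 0 < A.
Proof. by rewrite divr_gt0 ?subr_gt0// mulr_gt0. Qed.

(** The optimal dilation of a test function shows that E determines the best
    constant of the Sobolev inequality. *)
Lemma sobolev_best f : test_function T f ->
  eigen_of p q E * pint q f `^ (p / q) <= pint p (gnorm f).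
Proof.
move=> tf; have [K HK] := cT.
have [a0|a0] := eqVneq (pint q f) 0.
  by rewrite a0 powR0 ?mulr0 ?fine_pint_ge0// gt_eqF// divr_gt0.
have {}a0 : 0 < pint q f by rewrite lt_neqAle eq_sym a0 fine_pint_ge0.
pose s := (A / pint q f) `^ q^-1.
have s0 : 0 < s by rewrite powR_gt0// divr_gt0.
have := Jpq_le q1 qp HK (test_scale s tf); rewrite (Jpq_scale p q s tf) gtr0_norm//.
have -> : s `^ q = A / pint q f.
  by rewrite /s -powRrM mulVf ?powRr1 ?gt_eqF// divr_ge0 ?fine_pint_ge0 ?(ltW A0).
have sp : s `^ p = A `^ (p / q) / pint q f `^ (p / q).
  rewrite /s -powRrM [_ * p]mulrC powRM ?(ltW A0) ?invr_ge0 ?fine_pint_ge0//.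
  by congr (_ * _); rewrite -[(pint q f)^-1]powR_inv1 ?fine_pint_ge0// -powRrM mulN1r powRN.
rewrite divfK ?gt_eqF// sp -/E.
have b0 : 0 < pint q f `^ (p / q) by rewrite powR_gt0.
have c0 : 0 < A `^ (p / q) by rewrite powR_gt0.
have pq0 : p - q != 0 by rewrite gt_eqF ?subr_gt0.
have EA : E = A - q / p * A by rewrite /A; field; rewrite pq0 gt_eqF.
have lE : eigen_of p q E = q / p * A / A `^ (p / q).
  rewrite /eigen_of -/A -[RHS]mulrA; congr (_ * _).
  transitivity (A `^ 1 * A `^ (- (p / q))); last by rewrite powRr1 ?(ltW A0)// powRN.
  rewrite -powRD; last by rewrite (gt_eqF A0) implybT.
  by congr (_ `^ _); field; rewrite gt_eqF.
rewrite {1}EA lE => h.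
have {}h : q / p * A <= A `^ (p / q) / pint q f `^ (p / q) * pint p (gnorm f).
  by move: h; rewrite lerD2l lerN2.
rewrite mulrAC ler_pdivrMr// -ler_pdivlMr//.
by apply: le_trans h _; rewrite mulrAC [pint p _ * _]mulrC.
Qed.

(** The normalised maximiser attains the best Sobolev constant. *)
Lemma eigen_of_first : first_eigenvalue T p q (eigen_of p q E).
Proof.
split; last first.
  move=> u su; have h1 := sphere_limit mT q1 su.
  have [_ h2] := element_grad_limit mT q1 qp u.
  rewrite (energyE mT q1 qp u) lee_fin.
  have h3 : eigen_of p q E * `|pint q (u n)| `^ (p / q) @[n --> \oo] --> eigen_of p q E * 1.
    apply: cvgM; first exact: cvg_cst.
    by have := @cvg_normr_powR _ (p / q) _ _ (divr_gt0 p0 q0) h1; rewrite normr1 powR1.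
  have := cvg_seq_ge (cvg_sub_seq h2 h3) (c := 0) => H.
  rewrite -subr_ge0 -[X in _ - X]mulr1; apply: H => n.
  rewrite subr_ge0 (ger0_norm (fine_pint_ge0 _ _)).
  by apply: sobolev_best; exact: D01_test.
have T0 : T `&` set0 = set0 by rewrite setI0.
have TU : T = T `|` set0 by rewrite setU0.
have [u [cu hA hD ws]] := eigenfunction_exists mT oT open0 T0 TU cT kT E0.
rewrite -/E -/A in hA hD.
pose c := A `^ (- q^-1); have c0 : 0 < c by rewrite powR_gt0.
have cq : c `^ q = A^-1.
  by rewrite /c -powRrM mulNr mulVf ?gt_eqF// powR_inv1// ltW.
have tu n : test_function T (u n) by exact: D01_test.
have mu_ m n : measurable_fun setT (u m \- u n) by exact: test_measurable (test_sub (tu m) (tu n)).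
have vE m n : ((fun x => c * u m x) \- (fun x => c * u n x)) =
    (fun x => c * (u m \- u n) x) by apply/funext => x /=; rewrite mulrBr.
have gE f : test_function T f -> gnorm (fun x => c * f x) = (fun x => c * gnorm f x).
  by move=> tf; apply/funext => x; rewrite (gnorm_scale c x tf) gtr0_norm.
have pcq f : test_function T f -> pint q (fun x => c * f x) = c `^ q * pint q f.
  by move=> tf; rewrite (pint_scale _ _ (test_measurable tf)) gtr0_norm.
have pcp f : test_function T f -> pint p (gnorm (fun x => c * f x)) = c `^ p * pint p (gnorm f).
  by move=> tf; rewrite (gE _ tf) (pint_scale _ _ (test_measurable_gnorm tf)) gtr0_norm.
have cq0 : 0 < c `^ q by rewrite powR_gt0.
have cp0 : 0 < c `^ p by rewrite powR_gt0.
have [|v [vu cv]] := @D01p_of_cauchy _ _ T p q mT q1 qp (fun n x => c * u n x)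
    (fun n => test_scale c (tu n)).
  move=> e e0; have e'0 : 0 < e / (c `^ q + c `^ p) by rewrite divr_gt0 ?addr_gt0.
  have [n0 Hn0] := cu _ e'0; exists n0 => m n n0m n0n.
  have [h1 h2] := Hn0 m n n0m n0n.
  have td := test_sub (tu m) (tu n).
  rewrite vE (pcq _ td) (pcp _ td); split.
    apply: le_trans (ler_wpM2l (ltW cq0) h1) _.
    by rewrite mulrCA ler_piMr ?(ltW e0)// ler_pdivrMr ?addr_gt0// mul1r lerDl ltW.
  apply: le_trans (ler_wpM2l (ltW cp0) h2) _.
  by rewrite mulrCA ler_piMr ?(ltW e0)// ler_pdivrMr ?addr_gt0// mul1r lerDr ltW.
have {}vu : (v : nat -> _) = (fun n x => c * u n x) by apply/funext.
exists v.
  rewrite /sphere_pq /= (normL_limit mT q1 (A := 1) cv) ?powR1// vu.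
  under eq_fun => n do rewrite (pcq _ (tu n)).
  have := cvgM (cvg_cst (c `^ q)) hA; rewrite cq mulVf ?gt_eqF//; exact.
rewrite (energy_limit mT q1 qp (D := eigen_of p q E))// vu.
under eq_fun => n do rewrite (pcp _ (tu n)).
have -> : eigen_of p q E = c `^ p * (q / p * A).
  rewrite /eigen_of -/A mulrCA; congr (_ * _).
  rewrite -{2}(powRr1 (ltW A0)) /c -powRrM -powRD; last by rewrite (gt_eqF A0) implybT.
  by congr (_ `^ _); field; rewrite gt_eqF.
by apply: cvgM hD; exact: cvg_cst.
Qed.

End first.
End eigenvalues.

(** * Unions of separated balls *)
Section one_ball.
Context {R : realType} {N : nat}.
Local Notation mu := (@lebesgue_rV R N).
Implicit Types (c : 'rV[R]_N) (r : R).

Lemma open_eball c r : open (eball c r).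
Proof.
have ce : continuous (fun x : 'rV[R]_N => enorm (x - c)).
  have -> : (fun x : 'rV[R]_N => enorm (x - c)) = @enorm R N \o (fun x => x - c) by [].
  move=> x; apply: continuous_comp; last exact: enorm_continuous.
  exact: (@cvgD _ _ _ (nbhs x) _ id (cst (- c)) x (- c) cvg_id (cvg_cst _)).
have -> : eball c r = (fun x => enorm (x - c)) @^-1` [set t | t < r] by [].
by apply: open_comp; [move=> x _; exact: ce|exact: open_lt].
Qed.

Lemma eball_coord c r y i : eball c r y -> `|y 0 i - c 0 i| < r.
Proof.
move=> yc; have -> : y 0 i - c 0 i = (y - c) 0 i by rewrite !mxE.
exact: le_lt_trans (normr_coord_le _ _) yc.
Qed.

Lemma lebesgue_eball_le c r : 0 < r -> (mu (eball c r) <= ((2 * r) ^+ N)%:E)%E.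
Proof.
move=> r0; have <- : mu (cube c r) = ((2 * r) ^+ N)%:E by exact: lebesgue_cube.
apply: le_measure; rewrite ?inE; [exact: eball_measurable|exact: cube_measurable|].
move=> y yc i; have := eball_coord i yc; rewrite in_itv/= ltr_norml => /andP[h1 h2].
by apply/andP; split; lra.
Qed.

(** The half-side r / (N + 1) is small enough since the Euclidean norm is at most
    the sum of the coordinates. *)
Lemma cube_sub_eball c r : 0 < r ->
  [set x : 'rV[R]_N | forall i, x 0 i \in `[c 0 i - r / N.+1%:R, c 0 i + r / N.+1%:R] ]
  `<=` eball c r.
Proof.
set s := r / N.+1%:R => r0 x xc; rewrite /eball/=; apply: le_lt_trans (enorm_le_sum _) _.
apply: (@le_lt_trans _ _ (\sum_(i < N) s)).
  apply: ler_sum => i _; have := xc i; rewrite in_itv/= => /andP[h1 h2].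
  by rewrite !mxE ler_norml; clearbody s; apply/andP; split; lra.
rewrite /s sumr_const card_ord -[_ *+ N]mulr_natr -mulrA gtr_pMr//.
by rewrite mulrC ltr_pdivrMr// mul1r ltr_nat.
Qed.

End one_ball.

Lemma EFin_affine {R : realType} (a b c d s : R) :
  (a%:E + b%:E * (c%:E * d%:E + s%:E) = (a + b * (c * d + s))%R%:E)%E.
Proof. by rewrite EFinD EFinM EFinD EFinM. Qed.

Section slab_estimates.
Context {R : realType} {n : nat}.
Local Notation N := n.+1.
Local Notation mu := (@lebesgue_rV R N).
Variables (p q : R).
Hypotheses (q1 : 1 < q) (qp : q < p).

Let p1 : 1 < p. Proof. exact: lt_trans q1 qp. Qed.
Let p0 : 0 < p. Proof. exact: lt_trans p1. Qed.
Let q0 : 0 < q. Proof. exact: lt_trans q1. Qed.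

(** The last partial derivative is a coordinate of the gradient. *)
Lemma poincare_test (O : set 'rV[R]_N) (g : 'rV[R]_N -> R) (c r : R) :
  0 < r -> test_function O g -> (forall y, O y -> `|y 0 ord_max - c| < r) ->
  pint p g <= (2 * r) `^ p * pint p (gnorm g).
Proof.
move=> r0 tg Or; rewrite -lee_fin EFinM -(test_pintE tg p0) -(test_pint_gradE tg p0).
have g0 y : g y != 0 -> `|y 0 ord_max - c| < r.
  move=> gy; apply: Or; apply: contrapT => Oy; move: gy; rewrite (test_out tg Oy).
  by rewrite eqxx.
apply: le_trans (poincare_slab p1 r0 (smooth_C1 (test_smooth tg)) g0) _.
rewrite lee_pmul2l//; last by rewrite lte_fin powR_gt0// mulr_gt0.
apply: ge0_le_integral => //.
- apply: measurable_powR_norm; apply: measurable_partial; apply: smooth_C1; exact: test_smooth tg.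
- apply: measurable_powR_norm; exact: test_measurable_gnorm tg.
- move=> x _; rewrite lee_fin ge0_ler_powR ?nnegrE ?(ltW p0)//.
  rewrite (ger0_norm (enorm_ge0 _)).
  have -> : partial_deriv ord_max g x = grad g x 0 ord_max by rewrite mxE.
  exact: normr_coord_le.
Qed.

(** On a ball, the Poincare inequality and Young's inequality give a bound whose
    additive constant has the scaling r^(pq/(p-q)+N) of the summability
    hypothesis. *)
Lemma ball_estimate (c : 'rV[R]_N) (r eta : R) (g : 'rV[R]_N -> R) : 0 < r -> 0 < eta ->
  test_function (eball c r) g ->
  pint q g <= eta * pint p (gnorm g) +
    eta `^ (- (q / (p - q))) * (2 * r) `^ (p * q / (p - q) + N%:R).
Proof.
move=> r0 eta0 tg; have r20 : 0 < 2 * r by rewrite mulr_gt0.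
have pq0 : p - q != 0 by rewrite gt_eqF ?subr_gt0.
(* so that the Poincare constant cancels *)
pose e := eta * (2 * r) `^ (- p).
have e0 : 0 < e by rewrite mulr_gt0// powR_gt0.
have P := poincare_test r0 tg (fun y yB => eball_coord ord_max yB).
have eE : e `^ (- (q / (p - q))) = eta `^ (- (q / (p - q))) * (2 * r) `^ (p * q / (p - q)).
  rewrite /e powRM ?powR_ge0 ?(ltW eta0)// -powRrM; congr (_ * _ `^ _).
  by field.
have H : pint q g <= e * pint p g + e `^ (- (q / (p - q))) * (2 * r) ^+ N.
  rewrite -lee_fin EFinD EFinM -(test_pintE tg q0) -(test_pintE tg p0).
  have mg := test_measurable tg; have mB := eball_measurable c r.
  have -> : (\int[mu]_x (`|g x| `^ q)%:E = \int[mu]_(x in eball c r) (`|g x| `^ q)%:E)%E.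
    rewrite [RHS]integral_mkcond; apply: eq_integral => x _; rewrite patchE.
    case: ifPn => // /negP xB; rewrite (test_out tg) ?normr0 ?powR0 ?gt_eqF//.
    by move=> Bx; apply: xB; rewrite inE.
  have mgp := @measurable_powR_norm _ _ R p g mg.
  have mgq := @measurable_powR_norm _ _ R q g mg.
  apply: (@le_trans _ _ (\int[mu]_(x in eball c r)
     (e%:E * (`|g x| `^ p)%:E + (cst (e `^ (- (q / (p - q))))%:E x))))%E.
    apply: ge0_le_integral => //.
    - exact: measurable_funTS.
    - by apply: emeasurable_funD => //; apply: measurable_funeM; exact: measurable_funTS.
    - move=> x _; rewrite -EFinM -EFinD lee_fin.
      exact: powR_absorb.
  rewrite ge0_integralD//; last 3 first.
  - by move=> x _; rewrite mule_ge0 ?lee_fin ?powR_ge0// ltW.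
  - by apply: measurable_funeM; exact: measurable_funTS.
  - by move=> x _; rewrite lee_fin powR_ge0.
  rewrite integral_cst//; apply: leeD.
    rewrite ge0_integralZl//; [|exact: measurable_funTS|by rewrite lee_fin ltW].
    rewrite lee_pmul2l//; apply: ge0_subset_integral => //.
  rewrite EFinM lee_pmul2l ?lte_fin ?powR_gt0//.
  exact: lebesgue_eball_le.
apply: le_trans H _; apply: lerD.
  have h : e * pint p g <= e * ((2 * r) `^ p * pint p (gnorm g)).
    by rewrite ler_pM2l.
  apply: le_trans h _; rewrite mulrA /e -[X in X * _]mulrA -powRD; last first.
    by rewrite (gt_eqF r20) implybT.
  by rewrite addNr powRr0 mulr1.
rewrite eE -mulrA ler_wpM2l ?powR_ge0// powRD; last by rewrite (gt_eqF r20) implybT.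
by rewrite -(powR_mulrn N (ltW r20)).
Qed.

Lemma Jsup_ball_le (c : 'rV[R]_N) (r : R) : 0 < r ->
  Jsup (eball c r) p q <= (2 * r) `^ (p * q / (p - q) + N%:R).
Proof.
move=> r0; apply: ge_sup.
  by exists (Jpq p q ((fun=> 0) : 'rV[R]_N -> R)), (fun=> 0) => //; exact: test_cst0.
move=> _ [g tg <-]; have := ball_estimate r0 ltr01 tg.
by rewrite /Jpq powR1 !mul1r lerBlDl.
Qed.

(** Young's inequality bounds |f|^q by a small multiple of |f|^p, which the
    Poincare inequality controls, and a multiple of |f|, to which Rellich's
    inequality applies. *)
Lemma bounded_compact (O : set 'rV[R]_N) (L : R) : 0 < L -> O `<=` box N L ->
  compactly_embedded p q O.
Proof.
move=> L0 OL eta eta0.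
have eta40 : 0 < eta / 2 by rewrite divr_gt0.
have L20 : 0 < 2 * (L + 1) by rewrite mulr_gt0// addr_gt0.
pose e := eta / 2 / (2 * (L + 1)) `^ p.
have e0 : 0 < e by rewrite divr_gt0// powR_gt0.
pose Ce := e `^ (- ((q - 1) / (p - q))); have Ce0 : 0 < Ce by rewrite powR_gt0.
pose V := fine (mu (box N L)); have V0 : 0 <= V by exact: fine_ge0.
pose eta1 := eta / (2 * (Ce * (N%:R * (V + 1)))).
have NV0 : 0 < Ce * (N%:R * (V + 1)) by rewrite !mulr_gt0// ltr_wpDl.
have eta10 : 0 < eta1 by rewrite divr_gt0// mulr_gt0.
have [I [Q [mQ HQ]]] := rellich_L1 N L0 eta10.
exists I, Q, Ce; split.
- move=> k; have [mQk QL] := mQ k; split => //.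
  apply: le_lt_trans (lebesgue_box_lty N L).
  by apply: le_measure; rewrite ?inE//; exact: box_measurable.
- exact: ltW.
move=> f tf; have [M HM] := test_bounded tf.
have Cf := smooth_C1 (test_smooth tf).
have mf := test_measurable tf.
have P : pint p f <= (2 * (L + 1)) `^ p * pint p (gnorm f).
  apply: (@poincare_test O f 0 (L + 1)) => //; first by rewrite addr_gt0.
  move=> y /OL /(_ ord_max); rewrite in_itv/= subr0 ltr_norml => /andP[h1 h2].
  by apply/andP; split; lra.
pose B := box N L; have mB : measurable B := @box_measurable R N L.
have fB : mu B \is a fin_num by rewrite ge0_fin_numE// lebesgue_box_lty.
have H1 : ((pint q f)%:E <= (e * pint p f)%:E + Ce%:E * \int[mu]_(x in B) `|f x|%:E)%E.
  rewrite EFinM -(test_pintE tf q0) -(test_pintE tf p0).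
  have -> : (\int[mu]_x (`|f x| `^ q)%:E = \int[mu]_(x in B) (`|f x| `^ q)%:E)%E.
    rewrite [RHS]integral_mkcond; apply: eq_integral => x _; rewrite patchE.
    case: ifPn => // /negP xB; rewrite (test_out tf) ?normr0 ?powR0 ?gt_eqF//.
    by move=> /OL Bx; apply: xB; rewrite inE.
  have mfp := @measurable_powR_norm _ _ R p f mf.
  have mfq := @measurable_powR_norm _ _ R q f mf.
  have mfa : measurable_fun B (fun x => `|f x|%:E).
    by apply/measurable_EFinP; apply: measurableT_comp => //; exact: measurable_funTS.
  apply: (@le_trans _ _ (\int[mu]_(x in B) (e%:E * (`|f x| `^ p)%:E + Ce%:E * `|f x|%:E)))%E.
    apply: ge0_le_integral => //.
    - exact: measurable_funTS.
    - by apply: emeasurable_funD; apply: measurable_funeM => //; exact: measurable_funTS.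
    - move=> x _; rewrite -!EFinM -EFinD lee_fin; exact: powR_absorb_id.
  rewrite ge0_integralD//; last 4 first.
  - by move=> x _; rewrite mule_ge0 ?lee_fin ?powR_ge0// ltW.
  - by apply: measurable_funeM; exact: measurable_funTS.
  - by move=> x _; rewrite mule_ge0 ?lee_fin// ltW.
  - exact: measurable_funeM.
  apply: leeD; rewrite ge0_integralZl//; try by rewrite lee_fin ltW.
    rewrite lee_pmul2l//; exact: ge0_subset_integral.
  exact: measurable_funTS.
have H2 : (\int[mu]_(x in B) (sum_partial f x)%:E <= (N%:R * (V + 1) * (1 + pint p (gnorm f)))%:E)%E.
  have mg := @measurable_powR_norm _ _ R p _ (test_measurable_gnorm tf).
  apply: (@le_trans _ _ (\int[mu]_(x in B) (N%:R%:E * (1 + (`|gnorm f x| `^ p)%:E))))%E.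
    apply: ge0_le_integral => //.
    - by move=> x _; rewrite lee_fin sum_partial_ge0.
    - by apply/measurable_EFinP; apply: measurable_funTS; exact: measurable_sum_partial.
    - apply: measurable_funeM; apply: emeasurable_funD; first exact: measurable_cst.
      exact: measurable_funTS.
    - move=> x _; rewrite -EFinD -EFinM lee_fin /sum_partial.
      apply: (@le_trans _ _ (\sum_(i < N) (1 + `|gnorm f x| `^ p))).
        apply: ler_sum => i _; apply: (@le_trans _ _ `|gnorm f x|).
          rewrite (ger0_norm (enorm_ge0 _)).
          have -> : partial_deriv i f x = grad f x 0 i by rewrite mxE.
          exact: normr_coord_le.
        have [gle|ggt] := lerP `|gnorm f x| 1; first by rewrite (le_trans gle)// lerDl powR_ge0.
        rewrite -[leLHS]powRr1//; apply: le_trans (ler_powR (ltW ggt) (ltW p1)) _.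
        by rewrite lerDr.
      by rewrite sumr_const card_ord -[_ *+ N]mulr_natl.
  rewrite ge0_integralZl//; last 2 first.
  - by apply: emeasurable_funD; [exact: measurable_cst|exact: measurable_funTS].
  - by move=> x _; rewrite adde_ge0// lee_fin powR_ge0.
  rewrite -[X in (_ <= X%:E)%E]mulrA EFinM lee_pmul2l//.
  rewrite ge0_integralD//; last exact: measurable_funTS.
  rewrite integral_cst// mul1e.
  apply: (@le_trans _ _ (V%:E + (pint p (gnorm f))%:E))%E.
    apply: leeD; first by rewrite /V fineK.
    by rewrite -(test_pint_gradE tf p0); exact: ge0_subset_integral.
  rewrite -EFinD lee_fin; have := fine_pint_ge0 p (gnorm f).
  set D := pint p _ => D0; have := mulr_ge0 V0 D0; rewrite mulrDl mul1r mulrDr mulr1; lra.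
have H3 : (\sum_k `|\int[mu]_(x in Q k) (f x)%:E| =
    (\sum_k `|\int[mu]_(x in Q k) f x|)%:E)%E.
  rewrite -sumEFin; apply: eq_bigr => k _; have [mQk QL] := mQ k.
  rewrite /Rintegral EFin_normr_Rintegral//.
  exact: (integrableS measurableT mQk (@subsetT _ _) (test_integrable tf)).
rewrite -lee_fin; apply: le_trans H1 _.
apply: (@le_trans _ _ ((e * pint p f)%:E + Ce%:E * (eta1%:E * (N%:R * (V + 1) * (1 + pint p (gnorm f)))%:E
   + (\sum_k `|\int[mu]_(x in Q k) f x|)%:E)))%E.
  rewrite leeD2l// lee_pmul2l//; apply: le_trans (HQ f M Cf HM) _.
  by rewrite H3 leeD2r// lee_pmul2l.
set S := (\sum_k `|\int[mu]_(x in Q k) f x|)%R; set Z := N%:R * (V + 1) * _.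
rewrite EFin_affine lee_fin mulrDr addrA lerD2r.
have k1 : e * pint p f <= eta / 2 * pint p (gnorm f).
  have -> : eta / 2 = e * (2 * (L + 1)) `^ p by rewrite /e divfK// gt_eqF// powR_gt0.
  by rewrite -mulrA ler_pM2l.
have k2 : Ce * (eta1 * (N%:R * (V + 1) * (1 + pint p (gnorm f)))) =
    eta / 2 * (1 + pint p (gnorm f)).
  rewrite /eta1; move: (gt_eqF NV0); set w := N%:R * (V + 1); set D := 1 + _ => h.
  have Cn : Ce != 0 by rewrite gt_eqF.
  have wn : w != 0 by apply/eqP => w0; move: NV0; rewrite -/w w0 mulr0 ltxx.
  by field; rewrite Cn wn.
rewrite /Z k2 [leRHS](_ : _ = eta / 2 * (1 + pint p (gnorm f)) + eta / 2 * (1 + pint p (gnorm f))); last by field.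
rewrite lerD2r; apply: le_trans k1 _.
by rewrite ler_pM2l// lerDr.
Qed.

End slab_estimates.

Lemma compact_budget {R : realType} (eta a1 a2 d1 d2 s t : R) :
  a1 <= eta / 2 * d1 + s -> s <= eta / 2 -> a2 <= eta / 2 * (1 + d2) + t ->
  0 <= eta * d1 -> 0 <= eta * d2 ->
  a1 + a2 <= eta * (1 + (d1 + d2)) + t.
Proof. by move=> *; lra. Qed.

(** ** Countable families *)
Section ball_family.
Context {R : realType} {n : nat}.
Local Notation N := n.+1.
Local Notation mu := (@lebesgue_rV R N).
Variables (p q : R).
Hypotheses (q1 : 1 < q) (qp : q < p).
Variables (r : nat -> R) (x : nat -> 'rV[R]_N).
Hypothesis (r0 : forall i, 0 < r i).
Local Notation B i := (eball (x i) (r i)).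
Hypothesis disjB : forall i j y, B i y -> B j y -> i = j.
Definition ball_mass i : R := (2 * r i) `^ (p * q / (p - q) + N%:R).
Hypothesis summable : cvgn (series ball_mass).

Let p1 : 1 < p. Proof. exact: lt_trans q1 qp. Qed.
Let p0 : 0 < p. Proof. exact: lt_trans p1. Qed.
Let q0 : 0 < q. Proof. exact: lt_trans q1. Qed.

Definition balls (S : set nat) : set 'rV[R]_N := \bigcup_(i in S) B i.

Lemma open_balls S : open (balls S).
Proof. by apply: bigcup_open => i _; exact: open_eball. Qed.

Lemma measurable_balls S : measurable (balls S).
Proof. by apply: bigcup_measurable => i _; exact: eball_measurable. Qed.

Lemma ballsU S S' : balls (S `|` S') = balls S `|` balls S'.
Proof. exact: bigcup_setU. Qed.

Lemma balls_disj S S' : S `&` S' = set0 -> balls S `&` balls S' = set0.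
Proof.
move=> SS'; apply/seteqP; split => // y [[i Si Bi] [j Sj Bj]].
have ij := disjB Bi Bj; have : (S `&` S') i by split => //; rewrite ij.
by rewrite SS'.
Qed.

Lemma balls1 i : balls [set i] = B i.
Proof. exact: bigcup_set1. Qed.

Definition below (k : nat) : set nat := [set i | (i < k)%N].
Definition above (k : nat) : set nat := [set i | (k <= i)%N].

(** The support of a test function is compact, so it meets finitely many balls. *)
Lemma test_balls_finite S f : test_function (balls S) f ->
  exists m, test_function (balls (S `&` below m)) f.
Proof.
move=> [sf cf fS].
have := cf; rewrite compact_near_coveringP => /(_ nat \oo (fun m y => balls (S `&` below m) y) _).
case=> [y yf|m _ Hm]; last first.
  by exists m; split => // y yf; exact: (Hm m (leqnn m) y yf).
have [i Si Biy] := fS y yf.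
have nB : nbhs y (B i) by apply: open_nbhs_nbhs; split => //; exact: open_eball.
exists (B i, above i.+1) => /=; first by split => //; exists i.+1.
by move=> [z m] /= [Biz im]; exists i.
Qed.

Lemma ball_mass_ge0 i : 0 <= ball_mass i. Proof. exact: powR_ge0. Qed.

(** The two integrals split over disjoint open sets, so the estimates of the
    single balls add up. *)
Lemma finite_balls_estimate (eta : R) k m f : 0 < eta ->
  test_function (balls (above k `&` below m)) f ->
  pint q f <= eta * pint p (gnorm f) +
    eta `^ (- (q / (p - q))) * \sum_(k <= i < m) ball_mass i.
Proof.
move=> eta0; elim: m f => [|m IH] f tf.
  rewrite big_geq// mulr0 addr0.
  have f0 : f = (fun x => 0 * f x).
    apply/funext => y; rewrite mul0r (test_out tf)// => -[i [_]].
    by rewrite /below /= ltn0.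
  rewrite {1}f0 pint_scale; last exact: test_measurable tf.
  by rewrite normr0 powR0 ?gt_eqF// mul0r mulr_ge0 ?fine_pint_ge0// ltW.
have [km|mk] := leqP k m; last first.
  have E : above k `&` below m.+1 = above k `&` below m.
    apply/seteqP; split => i [ki im]; split => //; move: ki im; rewrite /above /below /=.
      by move=> ki; rewrite ltnS => im; have := leq_trans (leq_trans mk ki) im; rewrite ltnn.
    by move=> ki im; exact: ltnW.
  rewrite E in tf; apply: le_trans (IH f tf) _.
  by rewrite !big_geq// ltnW.
have SE : above k `&` below m.+1 = (above k `&` below m) `|` [set m].
  apply/seteqP; split => i.
    move=> [ki]; rewrite /below /= ltnS leq_eqVlt => /orP[/eqP ->|im]; first by right.
    by left.
  by move=> [[ki im]|->]; split => //; rewrite /below/= ltnS// ltnW.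
have Sd : (above k `&` below m) `&` [set m] = set0.
  by apply/seteqP; split => // i [[_ im] /= im']; move: im; rewrite /below/= im' ltnn.
rewrite SE ballsU in tf.
have dj := balls_disj Sd.
have o1 : open (balls (above k `&` below m)) by exact: open_balls.
have o2 : open (balls [set m]) by exact: open_balls.
have t1 := test_cut o1 o2 dj tf.
have dj' : balls [set m] `&` balls (above k `&` below m) = set0 by rewrite setIC.
have tf' : test_function (balls [set m] `|` balls (above k `&` below m)) f by rewrite setUC.
have t2 := test_cut o2 o1 dj' tf'.
have [sq _] := test_cut_split o1 o2 dj tf q0.
have [_ sp] := test_cut_split o1 o2 dj tf p0.
rewrite sq sp big_nat_recr//= !mulrDr addrACA; apply: lerD; first exact: IH.
by rewrite balls1 in t2 *; exact: (ball_estimate q1 qp (r0 m) eta0 t2).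
Qed.

Let mass : R := limn (series ball_mass).

Lemma series_mass_le m : series ball_mass m <= mass.
Proof.
apply: nondecreasing_cvgn_le => //; apply/nondecreasing_seqP => j.
by rewrite /series /= big_nat_recr//= lerDl ball_mass_ge0.
Qed.

Lemma tail_mass (e : R) : 0 < e -> exists k, forall m, \sum_(k <= i < m) ball_mass i <= e.
Proof.
move=> e0; have := summable; move/cvgrPdist_le => /(_ _ e0)[k _ Hk].
exists k => m; have [km|/ltnW mk] := leqP k m; last by rewrite big_geq// ltW.
have -> : \sum_(k <= i < m) ball_mass i = series ball_mass m - series ball_mass k.
  apply/esym/eqP; rewrite subr_eq addrC; apply/eqP.
  by rewrite /series /=; exact: big_cat_nat.
have := Hk k (leqnn k); have := series_mass_le m; rewrite -/mass ler_norml => h1 /andP[_ h2].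
by move: h1 h2; set a := series _ _; set b := series _ _; lra.
Qed.

Lemma ball_mass_cvg0 : ball_mass i @[i --> \oo] --> (0 : R).
Proof. exact: cvg_series_cvg_0 summable. Qed.

Lemma coercive_balls S : coercive p q (balls S).
Proof.
exists mass => f /test_balls_finite[m tf].
have tf' : test_function (balls (above 0 `&` below m)) f.
  by apply: test_functionS tf; apply: bigcup_subset => i [_ im].
have := finite_balls_estimate ltr01 tf'; rewrite powR1 !mul1r => /le_trans; apply.
rewrite lerD2l; exact: series_mass_le.
Qed.

Lemma balls_below_bounded k : exists2 L : R, 0 < L & balls (below k) `<=` box N L.
Proof.
(* every centre and radius with index below k fits in this box *)
pose L : R := 1 + \sum_(i < k) (enorm (x i) + r i).
have s0 : forall i : 'I_k, true -> 0 <= enorm (x i) + r i.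
  by move=> i _; rewrite addr_ge0 ?enorm_ge0// ltW.
exists L; first by rewrite ltr_pwDl// sumr_ge0.
move=> y [i ik Biy] j; rewrite in_itv/=.
have h : `|y 0 j| < L.
  apply: le_lt_trans (normr_coord_le _ _) _.
  have -> : y = (y - x i) + x i by rewrite subrK.
  apply: le_lt_trans (enormD _ _) _.
  apply: (@lt_le_trans _ _ (enorm (x i) + r i)); first by rewrite addrC ltrD2l.
  rewrite /L (bigD1 (Ordinal (ik : (i < k)%N)))//= addrCA lerDl addr_ge0//.
  by rewrite sumr_ge0// => l _; exact: s0.
by move: h; rewrite ltr_norml => /andP[h1 h2]; rewrite (ltW h1) h2.
Qed.

Lemma above_below k : above k `&` below k = set0.
Proof.
by apply/seteqP; split => // i [ki ik]; have := leq_trans ik ki; rewrite ltnn.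
Qed.

(** The embedding is compact: the far balls contribute little by summability, and
    the remaining ones form a bounded set. *)
Lemma compact_balls S : compactly_embedded p q (balls S).
Proof.
move=> eta eta0; have e20 : 0 < eta / 2 by rewrite divr_gt0.
pose c := (eta / 2) `^ (- (q / (p - q))); have c0 : 0 < c by rewrite powR_gt0.
have [k Hk] := tail_mass (divr_gt0 e20 c0).
have [L L0 kL] := balls_below_bounded k.
have [I [Q [C [mQ C0 HQ]]]] := bounded_compact q1 qp L0 kL e20.
exists I, (fun i => Q i `&` balls (below k)), C; split => //.
  move=> i; have [mQi fQi] := mQ i.
  have mQB : measurable (Q i `&` balls (below k)).
    by apply: measurableI => //; exact: measurable_balls.
  split => //; apply: le_lt_trans fQi.
  by apply: le_measure; rewrite ?inE//; exact: subIsetl.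
move=> f tS.
have tf : test_function (balls (above k) `|` balls (below k)) f.
  apply: test_functionS tS; rewrite -ballsU; apply: bigcup_subset => i _.
  by have [ki|ik] := leqP k i; [left|right].
have dj := balls_disj (above_below k).
have dj' : balls (below k) `&` balls (above k) = set0 by rewrite setIC.
have tf' : test_function (balls (below k) `|` balls (above k)) f by rewrite setUC.
have o1 : open (balls (above k)) by exact: open_balls.
have o2 : open (balls (below k)) by exact: open_balls.
have t1 := test_cut o1 o2 dj tf.
have t2 := test_cut o2 o1 dj' tf'.
have [sq _] := test_cut_split o1 o2 dj tf q0.
have [_ sp] := test_cut_split o1 o2 dj tf p0.
have [m t1m] := test_balls_finite t1.
have e1 := finite_balls_estimate e20 t1m.
have e2 := HQ _ t2.
have e3 : c * \sum_(k <= i < m) ball_mass i <= eta / 2.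
  by rewrite mulrC -ler_pdivlMr.
have intE i : \int[mu]_(x in Q i) cut (balls (below k)) f x =
    \int[mu]_(x in Q i `&` balls (below k)) f x.
  rewrite /Rintegral [in LHS]integral_mkcond [in RHS]integral_mkcond; congr fine.
  apply: eq_integral => y _; rewrite !patchE in_setI.
  case: (y \in Q i) => //=; case: ifPn => [|/negP] yb; last first.
    by rewrite cut_out// => By; apply: yb; rewrite inE.
  by rewrite cutE//; rewrite inE in yb.
under eq_bigr => i _ do rewrite -intE.
rewrite sq sp.
apply: compact_budget e1 e3 e2 _ _; rewrite mulr_ge0 ?fine_pint_ge0//; exact: ltW.
Qed.

End ball_family.

(** ** Additivity and positivity of the supremum *)
Section Jsup_facts.
Context {R : realType} {N : nat}.
Local Notation mu := (@lebesgue_rV R N).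
Variables (p q : R).
Hypotheses (q1 : 1 < q) (qp : q < p).

Let p1 : 1 < p. Proof. exact: lt_trans q1 qp. Qed.
Let p0 : 0 < p. Proof. exact: lt_trans p1. Qed.
Let q0 : 0 < q. Proof. exact: lt_trans q1. Qed.

Lemma Jsup_nonempty (O : set 'rV[R]_N) : [set Jpq p q f | f in test_function O] !=set0.
Proof.
by exists (Jpq p q ((fun=> 0) : 'rV[R]_N -> R)), (fun=> 0) => //; exact: test_cst0.
Qed.

(** Test functions on the union are the sums of a test function on each piece,
    and the functional is additive on such sums. *)
Lemma Jsup_union (O O' : set 'rV[R]_N) : open O -> open O' -> O `&` O' = set0 ->
  coercive p q (O `|` O') -> Jsup (O `|` O') p q = Jsup O p q + Jsup O' p q.
Proof.
move=> oO oO' OO' [K HK].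
have HO f : test_function O f -> pint q f <= pint p (gnorm f) + K.
  by move=> tf; apply: HK; apply: test_functionS tf; exact: subsetUl.
have HO' f : test_function O' f -> pint q f <= pint p (gnorm f) + K.
  by move=> tf; apply: HK; apply: test_functionS tf; exact: subsetUr.
have OO'' : O' `&` O = set0 by rewrite setIC.
have disj y : O y -> ~ O' y.
  by move=> Oy O'y; have : (O `&` O') y by []; rewrite OO'.
have JE f : test_function (O `|` O') f -> Jpq p q f = Jpq p q (cut O f) + Jpq p q (cut O' f).
  move=> tf; have [sq _] := test_cut_split oO oO' OO' tf q0.
  have [_ sp] := test_cut_split oO oO' OO' tf p0.
  by rewrite /Jpq sq sp opprD addrACA.
apply/eqP; rewrite eq_le; apply/andP; split.
  apply: ge_sup; first exact: Jsup_nonempty.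
  move=> _ [f tf <-]; rewrite JE// lerD//.
    exact: (Jpq_le q1 qp HO (test_cut oO oO' OO' tf)).
  by apply: (Jpq_le q1 qp HO'); apply: (test_cut oO' oO OO''); rewrite setUC.
rewrite -lerBrDr; apply: ge_sup; first exact: Jsup_nonempty.
move=> _ [f tf <-]; rewrite lerBrDl -lerBrDr; apply: ge_sup; first exact: Jsup_nonempty.
move=> _ [g tg <-]; rewrite lerBrDl addrC.
pose h y := 1 * f y + g y.
have th : test_function (O `|` O') h.
  apply: test_lin; first by apply: test_functionS tf; exact: subsetUl.
  by apply: test_functionS tg; exact: subsetUr.
have hf : cut O h = f.
  apply/funext => y; have [Oy|Oy] := pselect (O y).
    by rewrite cutE// /h mul1r (test_out tg (disj y Oy)) addr0.
  by rewrite cut_out// (test_out tf Oy).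
have hg : cut O' h = g.
  apply/funext => y; have [yO|yO] := pselect (O' y).
    by rewrite cutE// /h mul1r (test_out tf) ?add0r// => Oy; exact: (disj y Oy yO).
  by rewrite cut_out// (test_out tg yO).
by rewrite -{1}hf -hg addrC -JE//; exact: (Jpq_le q1 qp HK th).
Qed.

(** A bump with zero integral would vanish almost everywhere on its cube, which
    has positive measure. *)
Lemma pint_bump_gt0 (c : 'rV[R]_N) (rho : R) : 0 < rho -> 0 < pint q (bump c rho).
Proof.
move=> rho0; rewrite lt_neqAle fine_pint_ge0 andbT eq_sym; apply/eqP => p00.
have tb : test_function setT (bump c rho) by exact: bump_test.
have mb := test_measurable tb.
have i0 : (\int[mu]_x `|(`|bump c rho x| `^ q)%:E| = 0)%E.
  under eq_integral do rewrite /= ger0_norm ?powR_ge0//.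
  by rewrite (test_pintE tb q0) p00.
have /(ae_eq_integral_abs mu measurableT) ae0 := i0.
have {}ae0 := ae0 (measurable_powR_norm q mb).
have [Z [mZ Z0 HZ]] := ae0.
have cZ : cube c rho `<=` Z.
  move=> y yc; apply: HZ => /= /(_ I) /eqP; rewrite eqe powR_eq0.
  by rewrite normr_eq0 gt_eqF ?bump_gt0.
have : (mu (cube c rho) <= mu Z)%E.
  by apply: le_measure; rewrite ?inE//; exact: cube_measurable.
rewrite Z0; have -> : mu (cube c rho) = ((2 * rho) ^+ N)%:E by exact: lebesgue_cube.
by rewrite lee_fin leNgt exprn_gt0// mulr_gt0.
Qed.

(** For small multiples of a bump the term of degree q wins. *)
Lemma Jsup_gt0 (O : set 'rV[R]_N) (c : 'rV[R]_N) (r : R) : 0 < r ->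
  eball c r `<=` O -> coercive p q O -> 0 < Jsup O p q.
Proof.
move=> r0 cO [K HK]; have rho0 : 0 < r / N.+1%:R by rewrite divr_gt0.
have tf : test_function O (bump c (r / N.+1%:R)).
  by apply: bump_test => // y yc; apply: cO; exact: cube_sub_eball yc.
have A0 := pint_bump_gt0 c rho0.
move: (bump _ _) tf A0 => f tf A0.
have D0 := fine_pint_ge0 p (gnorm f).
have pq0 : 0 < p - q by rewrite subr_gt0.
have D1 : 0 < 2 * (pint p (gnorm f) + 1) by rewrite mulr_gt0// ltr_wpDl.
pose t := (pint q f / (2 * (pint p (gnorm f) + 1))) `^ ((p - q)^-1).
have t0 : 0 < t by rewrite powR_gt0// divr_gt0.
apply: lt_le_trans (Jpq_le q1 qp HK (test_scale t tf)).
rewrite (Jpq_scale p q t tf) gtr0_norm//.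
have -> : t `^ p = t `^ q * t `^ (p - q).
  by rewrite -powRD ?(gt_eqF t0) ?implybT// addrC subrK.
have -> : t `^ (p - q) = pint q f / (2 * (pint p (gnorm f) + 1)).
  by rewrite /t -powRrM mulVf ?powRr1 ?gt_eqF// divr_ge0 ?ltW.
rewrite -(mulrA (t `^ q)) -mulrBr; apply: mulr_gt0; first exact: powR_gt0.
rewrite subr_gt0 mulrAC ltr_pdivrMr//.
by rewrite ltr_pM2l// mulrDr mulr1; move: D0; set d := pint p _; lra.
Qed.

End Jsup_facts.

Section eigen_of_facts.
Context {R : realType}.
Variables (p q : R).
Hypotheses (q1 : 1 < q) (qp : q < p).

Let p0 : 0 < p. Proof. exact: lt_trans (lt_trans ltr01 q1) qp. Qed.
Let q0 : 0 < q. Proof. exact: lt_trans q1. Qed.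
Let pq0 : 0 < p - q. Proof. by rewrite subr_gt0. Qed.

Lemma eigen_ofE (E : R) :
  eigen_of p q E = q / p * ((E * p / (p - q)) `^ ((p - q) / q))^-1.
Proof. by rewrite /eigen_of powRN. Qed.

Lemma eigen_of_decreasing (E E' : R) : 0 < E -> E < E' -> eigen_of p q E' < eigen_of p q E.
Proof.
move=> E0 EE'; have E'0 := lt_trans E0 EE'.
have b (F : R) : 0 < F -> 0 < F * p / (p - q) by move=> F0; rewrite divr_gt0// mulr_gt0.
rewrite !eigen_ofE ltr_pM2l ?divr_gt0// ltf_pV2 ?posrE ?powR_gt0 ?b//.
have k : E * p / (p - q) < E' * p / (p - q) by rewrite ltr_pM2r ?invr_gt0// ltr_pM2r.
apply: gt0_ltr_powR k; rewrite ?nnegrE ?divr_gt0//; exact/ltW/b.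
Qed.

Lemma eigen_of_cvg (E : nat -> R) (l : R) : (forall n, 0 < E n) -> 0 < l ->
  E n @[n --> \oo] --> l -> eigen_of p q (E n) @[n --> \oo] --> eigen_of p q l.
Proof.
move=> E0 l0 El.
have b (F : R) : 0 < F -> 0 < F * p / (p - q) by move=> F0; rewrite divr_gt0// mulr_gt0.
have h : E n * p / (p - q) @[n --> \oo] --> l * p / (p - q).
  by apply: cvgM; [apply: cvgM => //; exact: cvg_cst|exact: cvg_cst].
have := cvg_normr_powR (divr_gt0 pq0 q0) h.
rewrite (gtr0_norm (b _ l0)); under eq_fun => n do rewrite (gtr0_norm (b _ (E0 n))).
move=> {}h; rewrite eigen_ofE; under eq_fun do rewrite eigen_ofE.
apply: cvgM; first exact: cvg_cst.
by apply: cvgV => //; rewrite gt_eqF// powR_gt0// b.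
Qed.

End eigen_of_facts.

(** * The spectrum of a union of balls *)
Section spectrum_of_balls.
Context {R : realType} {n : nat}.
Local Notation N := n.+1.
Variables (p q : R).
Hypotheses (q1 : 1 < q) (qp : q < p).
Variables (r : nat -> R) (x : nat -> 'rV[R]_N).
Hypothesis (r0 : forall i, 0 < r i).
Hypothesis disjB : forall i j y, eball (x i) (r i) y -> eball (x j) (r j) y -> i = j.
Hypothesis summable : cvgn (series (@ball_mass R n p q r)).

Local Notation U := (balls r x).

Definition Eballs (S : set nat) : R := Jsup (U S) p q.

Lemma coerciveU S : coercive p q (U S).
Proof. exact: (coercive_balls q1 qp r0 disjB summable). Qed.

Lemma Eballs_union S S' : S `&` S' = set0 -> Eballs (S `|` S') = Eballs S + Eballs S'.
Proof.
move=> SS'; rewrite /Eballs ballsU; apply: (Jsup_union q1 qp).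
- exact: open_balls.
- exact: open_balls.
- exact: balls_disj.
- by rewrite -ballsU; exact: coerciveU.
Qed.

Lemma Eballs_gt0 S i : S i -> 0 < Eballs S.
Proof.
move=> Si; apply: (Jsup_gt0 q1 qp (r0 i) _ (coerciveU S) (c := x i)).
by move=> y Biy; exists i.
Qed.

Lemma Eballs1_le i : Eballs [set i] <= @ball_mass R n p q r i.
Proof. by rewrite /Eballs balls1; exact: (Jsup_ball_le q1 qp). Qed.

Lemma Eballs1_gt0 i : 0 < Eballs [set i].
Proof. exact: Eballs_gt0. Qed.

Lemma Eballs1_cvg0 k : Eballs [set (k + i)%N] @[i --> \oo] --> (0 : R).
Proof.
have h : @ball_mass R n p q r (k + i)%N @[i --> \oo] --> (0 : R).
  under eq_fun do rewrite addnC.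
  have := ball_mass_cvg0 summable; rewrite -(cvg_shiftn k); exact.
apply: squeeze_cvgr (cvg_cst (0 : R)) h; apply: nearW => i.
by rewrite (ltW (Eballs1_gt0 _)) Eballs1_le.
Qed.

Definition lam (S : set nat) : R := eigen_of p q (Eballs S).

(** The maximisers on a subfamily of balls are eigenfunctions of the whole union. *)
Lemma lam_Spec S i : S i -> Spec (U setT) p q (lam S).
Proof.
move=> Si; apply: (@eigen_of_Spec _ _ p q q1 qp (U S) (U (~` S))).
- exact: measurable_balls.
- exact: open_balls.
- exact: open_balls.
- by apply: balls_disj => //; rewrite setICr.
- by rewrite -ballsU setUCr.
- exact: coerciveU.
- exact: (compact_balls q1 qp r0 disjB summable).
- exact: Eballs_gt0 Si.
Qed.

Lemma lam_first : first_eigenvalue (U setT) p q (lam setT).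
Proof.
apply: (eigen_of_first q1 qp).
- exact: measurable_balls.
- exact: open_balls.
- exact: coerciveU.
- exact: (compact_balls q1 qp r0 disjB summable).
- exact: (@Eballs_gt0 setT 0%N).
Qed.

Lemma Eballs_below k : Eballs (below k.+1) = Eballs (below k) + Eballs [set k].
Proof.
rewrite -Eballs_union.
  congr Eballs; apply/seteqP; split => i; rewrite /below /=.
    by rewrite ltnS leq_eqVlt => /orP[/eqP ->|]; [right|left].
  by move=> [ik|->] //; rewrite ltnS ltnW.
by apply/seteqP; split => // i [ik /= ki]; move: ik; rewrite /below/= ki ltnn.
Qed.

Lemma lam_below_decreasing k : lam (below k.+2) < lam (below k.+1).
Proof.
rewrite /lam [in X in X < _]Eballs_below; apply: (eigen_of_decreasing q1 qp).
  by apply: (@Eballs_gt0 _ 0%N).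
by rewrite ltrDl Eballs1_gt0.
Qed.

(** Adding to the first balls one more ball, further and further away, moves the
    eigenvalue arbitrarily little. *)
Lemma limit_point_lam k : limit_point (Spec (U setT) p q) (lam (below k.+1)).
Proof.
pose S i := below k.+1 `|` [set (k.+1 + i)%N].
have E0 : 0 < Eballs (below k.+1) by exact: (@Eballs_gt0 _ 0%N).
have SE i : Eballs (S i) = Eballs (below k.+1) + Eballs [set (k.+1 + i)%N].
  apply: Eballs_union; apply/seteqP; split => // j [jk /= jE].
  by move: jk; rewrite /below/= jE ltnNge leq_addr.
apply/limit_pointP; exists (fun i => lam (S i)); split.
- move=> _ [i _ <-]; apply: (@lam_Spec _ 0%N); by left.
- move=> i; rewrite lt_eqF//; apply: (eigen_of_decreasing q1 qp) => //.
  by rewrite SE ltrDl Eballs1_gt0.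
- apply: (eigen_of_cvg q1 qp) => //.
    by move=> i; apply: (@Eballs_gt0 _ 0%N); left.
  under eq_fun do rewrite SE.
  have := cvgD (cvg_cst (Eballs (below k.+1))) (Eballs1_cvg0 k.+1).
  by rewrite addr0; apply.
Qed.

Lemma lam_below_lt j k : (j < k)%N -> lam (below k.+1) < lam (below j.+1).
Proof.
elim: k => // k IH; rewrite ltnS leq_eqVlt => /orP[/eqP ->|jk].
  exact: lam_below_decreasing.
exact: lt_trans (lam_below_decreasing k) (IH jk).
Qed.

Lemma infinite_limit_points : infinite_set (limit_point (Spec (U setT) p q)).
Proof.
move=> fl; apply: infinite_nat.
have inj : {in setT &, injective (fun k => lam (below k.+1))}.
  move=> j k _ _ /= jk; case: (ltngtP j k) => // /lam_below_lt; by rewrite jk ltxx.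
rewrite (_ : setT = (fun k => lam (below k.+1)) @^-1` limit_point (Spec (U setT) p q)).
  by apply: finite_preimage fl => j k _ _; apply: inj; rewrite in_setT.
by apply/seteqP; split => // k _; exact: limit_point_lam.
Qed.

(** Removing one far ball raises the first eigenvalue arbitrarily little. *)
Lemma lam_not_isolated : not_isolated (Spec (U setT) p q) (lam setT).
Proof.
pose S i := ~` [set i.+1].
have ET i : Eballs setT = Eballs (S i) + Eballs [set i.+1].
  by rewrite -Eballs_union ?setUCl ?setICl.
have S0 i : S i 0%N by [].
exists (fun i => lam (S i)); split.
- move=> i; split; first exact: (lam_Spec (S0 i)).
  apply/eqP; rewrite gt_eqF//; apply: (eigen_of_decreasing q1 qp).
    exact: Eballs_gt0 (S0 i).
  by rewrite (ET i) ltrDl Eballs1_gt0.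
- apply: (eigen_of_cvg q1 qp).
  + by move=> i; exact: Eballs_gt0 (S0 i).
  + exact: (@Eballs_gt0 setT 0%N).
  + have -> : (fun i => Eballs (S i)) = (fun i => Eballs setT - Eballs [set (1 + i)%N]).
      by apply/funext => i; rewrite (ET i) addrK.
    have := cvgB (cvg_cst (Eballs setT)) (Eballs1_cvg0 1).
    by rewrite subr0; apply.
Qed.

Lemma lambda_LS_nondecreasing (j k : nat) : (j <= k)%N ->
  (lambda_LS (U setT) p q j <= lambda_LS (U setT) p q k)%E.
Proof.
move=> jk; apply: ereal_inf_le_tmp => _ [A [sA cA yA gA] <-].
exists A => //; split => //; apply: le_trans gA.
by rewrite lee_fin ler_nat.
Qed.

(** The variational eigenvalues increase, so no strictly decreasing sequence of
    them exists, whereas the spectrum contains one. *)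
Lemma Spec_LS_neq : Spec_LS (U setT) p q <> Spec (U setT) p q.
Proof.
move=> E.
have /choice[m Hm] (k : nat) : exists m, lambda_LS (U setT) p q m = (lam (below k.+1))%:E.
  have : Spec (U setT) p q (lam (below k.+1)) by exact: (@lam_Spec _ 0%N).
  by rewrite -E => -[m _ Hm]; exists m.
have dec k : (m k.+1 < m k)%N.
  rewrite ltnNge; apply/negP => /lambda_LS_nondecreasing.
  by rewrite !Hm lee_fin leNgt lam_below_decreasing.
have bound k : (m k + k <= m 0)%N.
  elim: k => [|k IH]; first by rewrite addn0.
  by rewrite addnS -addSn (leq_trans _ IH)// leq_add2r.
by have := leq_trans (leq_addl _ _) (bound (m 0).+1); rewrite ltnn.
Qed.

End spectrum_of_balls.

(** The centres advance along the first axis by more than the sum of consecutive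
    radii, so the balls are disjoint. *)
Lemma aligned_balls_disjoint {R : realType} {n : nat} (r : nat -> R)
    (x : nat -> 'rV[R]_n.+1) :
  (forall i, 0 < r i) ->
  (forall i, x i.+1 = axis1 (2 ^- i + r i + r i.+1) + x i) ->
  forall i j y, eball (x i) (r i) y -> eball (x j) (r j) y -> i = j.
Proof.
move=> r0 xS.
pose a i := x i 0 ord0.
have aS i : a i.+1 = 2 ^- i + r i + r i.+1 + a i by rewrite /a xS !mxE.
have sep i j : (i < j)%N -> a i + r i < a j - r j.
  elim: j => // j IH; have e0 : (0 : R) < 2 ^- j by rewrite invr_gt0 exprn_gt0.
  rewrite ltnS leq_eqVlt aS => /orP[/eqP ->|/IH h]; first by lra.
  by have := r0 j; lra.
have key i j y : (i < j)%N -> eball (x i) (r i) y -> eball (x j) (r j) y -> False.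
  move=> /sep ij /(eball_coord ord0) h1 /(eball_coord ord0) h2.
  move: h1 h2; rewrite -!/(a _) !ltr_norml => /andP[_ h1] /andP[h2 _].
  by move: h1 h2; move: (y 0 ord0) => z h1 h2; lra.
move=> i j y iy jy; case: (ltngtP i j) => // ij; exfalso.
  exact: key ij iy jy.
exact: key ij jy iy.
Qed.

Lemma ball_mass_summable {R : realType} {n : nat} (p q : R) (r : nat -> R) :
  (forall i, 0 < r i) ->
  (\sum_(0 <= i <oo) (r i `^ (p * q / (p - q) + n.+1%:R))%:E < +oo)%E ->
  cvgn (series (@ball_mass R n p q r)).
Proof.
move=> r0 hs; pose e := p * q / (p - q) + n.+1%:R; rewrite -/e in hs.
set Z := (\sum_(0 <= i <oo) _)%E in hs.
have Z0 : (0 <= Z)%E by apply: nneseries_ge0 => i _ _; rewrite lee_fin powR_ge0.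
have Zf : Z \is a fin_num by rewrite ge0_fin_numE.
apply: nondecreasing_is_cvgn.
  apply/nondecreasing_seqP => j.
  by rewrite /series /= big_nat_recr//= lerDl powR_ge0.
exists (2 `^ e * fine Z) => _ [m _ <-]; rewrite /series /=.
have -> : \sum_(0 <= i < m) @ball_mass R n p q r i = 2 `^ e * \sum_(0 <= i < m) r i `^ e.
  rewrite mulr_sumr; apply: eq_bigr => i _.
  by rewrite /ball_mass powRM// ltW.
rewrite ler_wpM2l ?powR_ge0// -lee_fin fineK// -sumEFin.
by apply: nneseries_lim_ge => i _ _; rewrite lee_fin powR_ge0.
Qed.

Theorem theorem3p2 (R : realType) (N : nat) (hN : (0 < N)%N) (p q : R)
    (hq : 1 < q) (hqp : q < p)
    (r : nat -> R) (hr : forall i, 0 < r i)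
    (hsum : (\sum_(0 <= i <oo) (r i `^ (p * q / (p - q) + N%:R))%:E < +oo)%E)
    (x : nat -> 'rV[R]_N) (hx0 : x 0%N = 0)
    (hxS : forall i, x i.+1 = axis1 (2 ^- i + r i + r i.+1) + x i)
    (T : set 'rV[R]_N) (hT : T = \bigcup_i eball (x i) (r i)) :
  [/\ Spec_LS T p q <> Spec T p q,
      infinite_set (limit_point (Spec T p q)) &
      exists lambda1 : R, first_eigenvalue T p q lambda1 /\
        not_isolated (Spec T p q) lambda1].
Proof.
case: N hN x hx0 hsum hxS T hT => // n _ x' hx0' hsum' hxS' T' ->.
have dB := aligned_balls_disjoint hr hxS'.
have sB := ball_mass_summable hr hsum'.
split.
- exact: (Spec_LS_neq hq hqp hr dB sB).
- exact: (infinite_limit_points hq hqp hr dB sB).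
exists (lam p q r x' setT); split; first exact: (lam_first hq hqp hr dB sB).
exact: (lam_not_isolated hq hqp hr dB sB).
Qed.
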